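(* Assume the extensionality schemes and the identity extension schema. Let $\alpha,\beta\vdash\sigma(\alpha,\beta)$ be an inductively constructed type in which $\alpha$ occurs only negatively and $\beta$ only positively. Then, in ${\rm LinType}_\Xi$, there exists an initial dialgebra for $\sigma$ (up to internal equality): there are types $\tau,\tau'$ and terms $\mathit{in}:\sigma(\tau',\tau)\multimap\tau$ and $\mathit{out}:\tau'\multimap\sigma(\tau,\tau')$ such that for every dialgebra $(\tau_0,\tau_0',g,g')$ there is a morphism of dialgebras $(h,h')$ from $(\tau,\tau',\mathit{in},\mathit{out})$ to $(\tau_0,\tau_0',g,g')$, and any two such morphisms are componentwise provably internally equal.
   Context: PILL$_Y$ is the polymorphic intuitionistic/linear lambda calculus with fixed points. Types in a context $\Xi$ of type variables are given by $\sigma ::= \alpha \mid I \mid \sigma\otimes\sigma \mid \sigma\multimap\sigma \mid\ !\sigma \mid \Pi\alpha.\sigma$. Terms are typed in judgements $\Xi\mid\Gamma;\Delta\vdash t:\tau$ with an intuitionistic variable context $\Gamma$ and a linear variable context $\Delta$; the constructs are variables, $\star:I$, linear abstraction $\lambda^\circ x{:}\sigma.t$ and application $t\,u$, $t\otimes s$, $!t$ (allowed only when the linear context is empty), type abstraction $\Lambda\alpha.t$ and type application $t\,\sigma$, the eliminations $\mathrm{let}\ x\otimes y = s\ \mathrm{in}\ t$, $\mathrm{let}\ !x = s\ \mathrm{in}\ t$, $\mathrm{let}\ \star = s\ \mathrm{in}\ t$, and a constant $Y:\Pi\alpha.(\alpha\to\alpha)\to\alpha$. Here $\sigma\to\tau$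 abbreviates $!\sigma\multimap\tau$. External equality of terms is generated by the $\beta$- and $\eta$-rules of all constructs, commuting conversions of the let-constructs with linear contexts, congruence, and $f\,(!(Y\,\sigma\,(!f))) = Y\,\sigma\,(!f)$. $g\circ f=\lambda^\circ x.g(f\,x)$. LAPL is an intuitionistic higher-order predicate logic over PILL$_Y$ with contexts $\Xi\mid\Gamma\mid\Theta$, where $\Theta$ declares relation variables and admissible relation variables $R:\mathrm{AdmRel}(\sigma,\tau)$; propositions include internal equality $t=_\sigma u$ (externally equal terms are internally equal), $\rho(t,u)$ for definable relations, connectives and quantifiers over types, terms, relations and admissible relations. Admissible relations are a designated class of definable relations containing equality relations and graphs of linear terms. Each type $\sigma(\vec\alpha)$ has a relational interpretation $\sigma[\vec\rho]$ at admissible relations $\vec\rho$, with $\alpha_i[\vec\rho]\equiv\rho_i$, $(\sigma\multimap\sigma')[\vec\rho](f,g)\Leftrightarrow\forall x,y.\ \sigma[\vec\rho](x,y)\supset\sigma'[\vec\rho](f\,x,g\,y)$, and $(\Pi\beta.\sigma)[\vec\rho](t,u)\Leftrightarrow\forall\beta,\beta'.\forall R:\mathrm{AdmRel}(\beta,\beta').\ \sigma[\vec\rho,R](t\,\beta,u\,\beta')$ (and analogous clauses for $\otimes,!,I$). The extensionality schemes are $(\forall x.\ t\,x=u\,x)\supset t=_{\sigma\multimap\tau}u$ and $(\forall\alpha.\ t\,\alpha=u\,\alpha)\supset t=_{\Pi\alpha.\tau}u$; the identity extension schema is $\forall\vec\alpha.\ \sigma[eq_{\vec\alpha}]\equiv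 eq_{\sigma(\vec\alpha)}$ for every type $\sigma(\vec\alpha)$, $eq$ denoting internal equality. ${\rm LinType}_\Xi$ is the category with objects types in context $\Xi$ and morphisms terms $\Xi\mid-;-\vdash f:\sigma\multimap\tau$ modulo internal equality provable in LAPL plus extensionality and identity extension. A type is inductively constructed if it is built from type variables and closed types using $\multimap,\otimes,I,!,\Pi$; positive/negative occurrences are as usual ($\multimap$ reverses polarity in its argument, other constructors preserve it). For $\sigma(\alpha,\beta)$ inductively constructed with $\alpha$ only negative and $\beta$ only positive, and $f:\alpha'\multimap\alpha$, $g:\beta\multimap\beta'$, the term $\sigma(f,g):\sigma(\alpha,\beta)\multimap\sigma(\alpha',\beta')$ is defined by structural induction: $\beta(f,g)=g$; closed types act by identity; for $\sigma_1(\beta,\alpha)\multimap\sigma_2(\alpha,\beta)$ it is $\lambda^\circ h.\ \sigma_2(f,g)\circ h\circ\sigma_1(g,f)$; $\otimes$ componentwise; $(!\sigma_1)(f,g)=\lambda^\circ x.\mathrm{let}\ !y=x\ \mathrm{in}\ !(\sigma_1(f,g)\,y)$; $(\Pi\omega.\sigma_1)(f,g)=\lambda^\circ z.\Lambda\omega.\sigma_1(f,g)(z\,\omega)$. This gives a functor ${\rm LinType}_\Xi^{op}\times{\rm LinType}_\Xi\to{\rm LinType}_\Xi$. A dialgebra for $\sigma$ is a quadruple $(\tau,\tau',f,f')$ of types $\tau,\tau'$ and morphisms $f:\sigma(\tau',\tau)\multimap\tau$, $f':\tau'\multimap\sigma(\tau,\tau')$. A morphism of dialgebras from $(\tau_0,\tau_0',f_0,f_0')$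 to $(\tau_1,\tau_1',f_1,f_1')$ is a pair $h:\tau_0\multimap\tau_1$, $h':\tau_1'\multimap\tau_0'$ with $h\circ f_0=f_1\circ\sigma(h',h)$ and $f_0'\circ h'=\sigma(h,h')\circ f_1'$ (internally). An initial dialgebra is one with a unique morphism to every dialgebra. *)

(* Defs.v *)
From Stdlib Require List.
From mathcomp Require Import all_boot.
Set Implicit Arguments.
Unset Strict Implicit.
Unset Printing Implicit Defensive.

(* PILL_Y and LAPL as a deep embedding with de Bruijn indices.  Type variables,
   term variables and relation variables are three independent index spaces.
   A type context Xi is represented by its length n. *)

Definition scons (A : Type) (a : A) (s : nat -> A) (i : nat) : A :=
  if i is j.+1 then s j else a.

Definition upr (r : nat -> nat) (i : nat) : nat :=
  if i is j.+1 then (r j).+1 else 0.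

Inductive ty : Type :=
| TVar (i : nat)
| TOne
| TTens (a b : ty)
| TLolli (a b : ty)
| TBang (a : ty)
| TPi (a : ty).

Definition TArr (a b : ty) : ty := TLolli (TBang a) b.

Fixpoint twf (n : nat) (a : ty) : bool :=
  match a with
  | TVar i => i < n
  | TOne => true
  | TTens a b | TLolli a b => twf n a && twf n b
  | TBang a => twf n a
  | TPi a => twf n.+1 a
  end.

Fixpoint tren (r : nat -> nat) (a : ty) : ty :=
  match a with
  | TVar i => TVar (r i)
  | TOne => TOne
  | TTens a b => TTens (tren r a) (tren r b)
  | TLolli a b => TLolli (tren r a) (tren r b)
  | TBang a => TBang (tren r a)
  | TPi a => TPi (tren (upr r) a)
  end.

Definition tsh (k : nat) : ty -> ty := tren (addn k).

Definition tup (s : nat -> ty) : nat -> ty :=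
  scons (TVar 0) (fun i => tsh 1 (s i)).

Fixpoint tsub (s : nat -> ty) (a : ty) : ty :=
  match a with
  | TVar i => s i
  | TOne => TOne
  | TTens a b => TTens (tsub s a) (tsub s b)
  | TLolli a b => TLolli (tsub s a) (tsub s b)
  | TBang a => TBang (tsub s a)
  | TPi a => TPi (tsub (tup s) a)
  end.

Definition tinst (b a : ty) : ty := tsub (scons b TVar) a.

(* Intuitionistic and linear variables share one index space; which variables
   are linear is recorded in the typing context.  [LetPair s t] is
   "let x (x) y = s in t", where t sees x as [Var 1] and y as [Var 0]. *)
Inductive tm : Type :=
| Var (i : nat)
| Star
| FixY
| Lam (a : ty) (t : tm)
| App (t u : tm)
| Pair (t u : tm)
| Bang (t : tm)
| TLam (t : tm)
| TApp (t : tm) (a : ty)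
| LetStar (s t : tm)
| LetPair (s t : tm)
| LetBang (s t : tm).

(* [mren rt rm] renames type variables by rt and term variables by rm;
   likewise [msub], [pren], [psub], [rren], [rsub] below act simultaneously
   on all index spaces. *)
Fixpoint mren (rt rm : nat -> nat) (t : tm) : tm :=
  match t with
  | Var i => Var (rm i)
  | Star => Star
  | FixY => FixY
  | Lam a t => Lam (tren rt a) (mren rt (upr rm) t)
  | App t u => App (mren rt rm t) (mren rt rm u)
  | Pair t u => Pair (mren rt rm t) (mren rt rm u)
  | Bang t => Bang (mren rt rm t)
  | TLam t => TLam (mren (upr rt) rm t)
  | TApp t a => TApp (mren rt rm t) (tren rt a)
  | LetStar s t => LetStar (mren rt rm s) (mren rt rm t)
  | LetPair s t => LetPair (mren rt rm s) (mren rt (upr (upr rm)) t)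
  | LetBang s t => LetBang (mren rt rm s) (mren rt (upr rm) t)
  end.

Definition msh (kt km : nat) : tm -> tm := mren (addn kt) (addn km).

Definition mup (s : nat -> tm) : nat -> tm :=
  scons (Var 0) (fun i => msh 0 1 (s i)).

Fixpoint msub (st : nat -> ty) (sm : nat -> tm) (t : tm) : tm :=
  match t with
  | Var i => sm i
  | Star => Star
  | FixY => FixY
  | Lam a t => Lam (tsub st a) (msub st (mup sm) t)
  | App t u => App (msub st sm t) (msub st sm u)
  | Pair t u => Pair (msub st sm t) (msub st sm u)
  | Bang t => Bang (msub st sm t)
  | TLam t => TLam (msub (tup st) (fun i => msh 1 0 (sm i)) t)
  | TApp t a => TApp (msub st sm t) (tsub st a)
  | LetStar s t => LetStar (msub st sm s) (msub st sm t)
  | LetPair s t => LetPair (msub st sm s) (msub st (mup (mup sm)) t)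
  | LetBang s t => LetBang (msub st sm s) (msub st (mup sm) t)
  end.

Definition minst (u t : tm) : tm := msub TVar (scons u Var) t.
Definition minst2 (s u t : tm) : tm :=
  msub TVar (scons u (scons s Var)) t.
Definition mtinst (a : ty) (t : tm) : tm := msub (scons a TVar) Var t.

(* Gamma;Delta is a single list whose entries are marked: [Un] entries form
   Gamma, [Lin] entries form Delta, and an [Off] entry is a linear variable
   that belongs to another part of the term: it only keeps indices aligned
   and is not available. *)
Inductive mult : Type := Un | Lin | Off.

Definition is_off (m : mult) : bool := if m is Off then true else false.
Definition is_lin (m : mult) : bool := if m is Lin then true else false.

Definition ctx := seq (ty * mult).

Definition ctx_wf (n : nat) (G : ctx) : bool := all (fun d => twf n d.1) G.
Definition no_lin (G : ctx) : bool := all (fun d => ~~ is_lin d.2) G.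
Definition ctx_tsh (G : ctx) : ctx := [seq (tsh 1 d.1, d.2) | d <- G].
Definition un (G : seq ty) : ctx := [seq (a, Un) | a <- G].

(* The variable i is available and no other variable is linear. *)
Inductive lookup : ctx -> nat -> ty -> Prop :=
| lookup0 a m G : ~~ is_off m -> no_lin G -> lookup ((a, m) :: G) 0 a
| lookupS a b m G i :
    ~~ is_lin m -> lookup G i b -> lookup ((a, m) :: G) i.+1 b.

Inductive split_mult : mult -> mult -> mult -> Prop :=
| sm_un : split_mult Un Un Un
| sm_left : split_mult Lin Lin Off
| sm_right : split_mult Lin Off Lin
| sm_off : split_mult Off Off Off.

(* G is (Gamma; Delta1, Delta2), G1 is (Gamma; Delta1), G2 is (Gamma; Delta2). *)
Inductive split_ctx : ctx -> ctx -> ctx -> Prop :=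
| sc_nil : split_ctx [::] [::] [::]
| sc_cons a m m1 m2 G G1 G2 :
    split_mult m m1 m2 -> split_ctx G G1 G2 ->
    split_ctx ((a, m) :: G) ((a, m1) :: G1) ((a, m2) :: G2).

Definition TFixY : ty :=
  TPi (TArr (TArr (TVar 0) (TVar 0)) (TVar 0)).

Inductive has_type : nat -> ctx -> tm -> ty -> Prop :=
| ht_var n G i a : ctx_wf n G -> lookup G i a -> has_type n G (Var i) a
| ht_star n G : ctx_wf n G -> no_lin G -> has_type n G Star TOne
| ht_fix n G : ctx_wf n G -> no_lin G -> has_type n G FixY TFixY
| ht_lam n G a b t :
    has_type n ((a, Lin) :: G) t b -> has_type n G (Lam a t) (TLolli a b)
| ht_app n G G1 G2 a b t u :
    split_ctx G G1 G2 -> has_type n G1 t (TLolli a b) -> has_type n G2 u a ->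
    has_type n G (App t u) b
| ht_pair n G G1 G2 a b t u :
    split_ctx G G1 G2 -> has_type n G1 t a -> has_type n G2 u b ->
    has_type n G (Pair t u) (TTens a b)
| ht_bang n G a t :
    no_lin G -> has_type n G t a -> has_type n G (Bang t) (TBang a)
| ht_tlam n G a t :
    has_type n.+1 (ctx_tsh G) t a -> has_type n G (TLam t) (TPi a)
| ht_tapp n G a b t :
    has_type n G t (TPi a) -> twf n b -> has_type n G (TApp t b) (tinst b a)
| ht_letstar n G G1 G2 b s t :
    split_ctx G G1 G2 -> has_type n G1 s TOne -> has_type n G2 t b ->
    has_type n G (LetStar s t) b
| ht_letpair n G G1 G2 a1 a2 b s t :
    split_ctx G G1 G2 -> has_type n G1 s (TTens a1 a2) ->
    has_type n ((a2, Lin) :: (a1, Lin) :: G2) t b ->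
    has_type n G (LetPair s t) b
| ht_letbang n G G1 G2 a b s t :
    split_ctx G G1 G2 -> has_type n G1 s (TBang a) ->
    has_type n ((a, Un) :: G2) t b ->
    has_type n G (LetBang s t) b.

(* Linear contexts: terms with one hole, not under a !. *)
Inductive lctx : Type :=
| CHole
| CLam (a : ty) (C : lctx)
| CAppL (C : lctx) (u : tm)
| CAppR (t : tm) (C : lctx)
| CPairL (C : lctx) (u : tm)
| CPairR (t : tm) (C : lctx)
| CTLam (C : lctx)
| CTApp (C : lctx) (a : ty)
| CLetStarL (C : lctx) (t : tm)
| CLetStarR (s : tm) (C : lctx)
| CLetPairL (C : lctx) (t : tm)
| CLetPairR (s : tm) (C : lctx)
| CLetBangL (C : lctx) (t : tm)
| CLetBangR (s : tm) (C : lctx).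

Fixpoint plug (C : lctx) (h : tm) : tm :=
  match C with
  | CHole => h
  | CLam a C => Lam a (plug C h)
  | CAppL C u => App (plug C h) u
  | CAppR t C => App t (plug C h)
  | CPairL C u => Pair (plug C h) u
  | CPairR t C => Pair t (plug C h)
  | CTLam C => TLam (plug C h)
  | CTApp C a => TApp (plug C h) a
  | CLetStarL C t => LetStar (plug C h) t
  | CLetStarR s C => LetStar s (plug C h)
  | CLetPairL C t => LetPair (plug C h) t
  | CLetPairR s C => LetPair s (plug C h)
  | CLetBangL C t => LetBang (plug C h) t
  | CLetBangR s C => LetBang s (plug C h)
  end.

(* Numbers of term variables and of type variables bound above the hole. *)
Fixpoint depth (C : lctx) : nat :=
  match C with
  | CHole => 0
  | CLam _ C | CLetBangR _ C => (depth C).+1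
  | CLetPairR _ C => (depth C).+2
  | CAppL C _ | CAppR _ C | CPairL C _ | CPairR _ C | CTLam C | CTApp C _
  | CLetStarL C _ | CLetStarR _ C | CLetPairL C _ | CLetBangL C _ => depth C
  end.

Fixpoint tdepth (C : lctx) : nat :=
  match C with
  | CHole => 0
  | CTLam C => (tdepth C).+1
  | CLam _ C | CAppL C _ | CAppR _ C | CPairL C _ | CPairR _ C | CTApp C _
  | CLetStarL C _ | CLetStarR _ C | CLetPairL C _ | CLetPairR _ C
  | CLetBangL C _ | CLetBangR _ C => tdepth C
  end.

Fixpoint cren (r : nat -> nat) (C : lctx) : lctx :=
  match C with
  | CHole => CHole
  | CLam a C => CLam a (cren (upr r) C)
  | CAppL C u => CAppL (cren r C) (mren id r u)
  | CAppR t C => CAppR (mren id r t) (cren r C)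
  | CPairL C u => CPairL (cren r C) (mren id r u)
  | CPairR t C => CPairR (mren id r t) (cren r C)
  | CTLam C => CTLam (cren r C)
  | CTApp C a => CTApp (cren r C) a
  | CLetStarL C t => CLetStarL (cren r C) (mren id r t)
  | CLetStarR s C => CLetStarR (mren id r s) (cren r C)
  | CLetPairL C t => CLetPairL (cren r C) (mren id (upr (upr r)) t)
  | CLetPairR s C => CLetPairR (mren id r s) (cren (upr (upr r)) C)
  | CLetBangL C t => CLetBangL (cren r C) (mren id (upr r) t)
  | CLetBangR s C => CLetBangR (mren id r s) (cren (upr r) C)
  end.

Inductive letkind : Type := KStar | KPair | KBang.

Definition arity (k : letkind) : nat :=
  match k with KStar => 0 | KPair => 2 | KBang => 1 end.

Definition mlet (k : letkind) : tm -> tm -> tm :=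
  match k with KStar => LetStar | KPair => LetPair | KBang => LetBang end.

(* Exchange of an innermost block of d variables with the next k variables. *)
Definition swapb (d k i : nat) : nat :=
  if i < d then i + k else if i < d + k then i - d else i.

Inductive eq_axiom : tm -> tm -> Prop :=
| ea_beta_lam a t u : eq_axiom (App (Lam a t) u) (minst u t)
| ea_beta_tlam t a : eq_axiom (TApp (TLam t) a) (mtinst a t)
| ea_beta_star t : eq_axiom (LetStar Star t) t
| ea_beta_pair s u t : eq_axiom (LetPair (Pair s u) t) (minst2 s u t)
| ea_beta_bang u t : eq_axiom (LetBang (Bang u) t) (minst u t)
| ea_eta_lam a t : eq_axiom (Lam a (App (msh 0 1 t) (Var 0))) t
| ea_eta_tlam t : eq_axiom (TLam (TApp (msh 1 0 t) (TVar 0))) t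
| ea_eta_star t : eq_axiom (LetStar t Star) t
| ea_eta_pair t : eq_axiom (LetPair t (Pair (Var 1) (Var 0))) t
| ea_eta_bang t : eq_axiom (LetBang t (Bang (Var 0))) t
  (* let p = t in C[u]  =  C[let p = t in u] *)
| ea_comm k C t u :
    eq_axiom (mlet k t (plug (cren (addn (arity k)) C) u))
             (plug C (mlet k (msh (tdepth C) (depth C) t)
                             (mren id (swapb (depth C) (arity k)) u)))
| ea_fix a f :
    eq_axiom (App f (Bang (App (TApp FixY a) (Bang f))))
             (App (TApp FixY a) (Bang f)).

Inductive ext_eq : nat -> ctx -> tm -> tm -> ty -> Prop :=
| ee_ax n G t u a :
    eq_axiom t u -> has_type n G t a -> has_type n G u a -> ext_eq n G t u a
| ee_refl n G t a : has_type n G t a -> ext_eq n G t t a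
| ee_sym n G t u a : ext_eq n G t u a -> ext_eq n G u t a
| ee_trans n G t u v a :
    ext_eq n G t u a -> ext_eq n G u v a -> ext_eq n G t v a
| ee_lam n G a b t t' :
    ext_eq n ((a, Lin) :: G) t t' b ->
    ext_eq n G (Lam a t) (Lam a t') (TLolli a b)
| ee_app n G G1 G2 a b t t' u u' :
    split_ctx G G1 G2 ->
    ext_eq n G1 t t' (TLolli a b) -> ext_eq n G2 u u' a ->
    ext_eq n G (App t u) (App t' u') b
| ee_pair n G G1 G2 a b t t' u u' :
    split_ctx G G1 G2 -> ext_eq n G1 t t' a -> ext_eq n G2 u u' b ->
    ext_eq n G (Pair t u) (Pair t' u') (TTens a b)
| ee_bang n G a t t' :
    no_lin G -> ext_eq n G t t' a -> ext_eq n G (Bang t) (Bang t') (TBang a)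
| ee_tlam n G a t t' :
    ext_eq n.+1 (ctx_tsh G) t t' a -> ext_eq n G (TLam t) (TLam t') (TPi a)
| ee_tapp n G a b t t' :
    ext_eq n G t t' (TPi a) -> twf n b ->
    ext_eq n G (TApp t b) (TApp t' b) (tinst b a)
| ee_letstar n G G1 G2 b s s' t t' :
    split_ctx G G1 G2 -> ext_eq n G1 s s' TOne -> ext_eq n G2 t t' b ->
    ext_eq n G (LetStar s t) (LetStar s' t') b
| ee_letpair n G G1 G2 a1 a2 b s s' t t' :
    split_ctx G G1 G2 -> ext_eq n G1 s s' (TTens a1 a2) ->
    ext_eq n ((a2, Lin) :: (a1, Lin) :: G2) t t' b ->
    ext_eq n G (LetPair s t) (LetPair s' t') b
| ee_letbang n G G1 G2 a b s s' t t' :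
    split_ctx G G1 G2 -> ext_eq n G1 s s' (TBang a) ->
    ext_eq n ((a, Un) :: G2) t t' b ->
    ext_eq n G (LetBang s t) (LetBang s' t') b.

Inductive rkind : Type := Rel | AdmRel.

(* [RAbs a b p] is (x : a, y : b). p, where p sees x as [Var 1], y as [Var 0]. *)
Inductive prop : Type :=
| PEq (a : ty) (t u : tm)
| PRel (r : rel) (t u : tm)
| PTop
| PBot
| PAnd (p q : prop)
| POr (p q : prop)
| PImp (p q : prop)
| PAllT (p : prop)
| PExT (p : prop)
| PAllM (a : ty) (p : prop)
| PExM (a : ty) (p : prop)
| PAllR (k : rkind) (a b : ty) (p : prop)
| PExR (k : rkind) (a b : ty) (p : prop)
with rel : Type :=
| RVar (i : nat)
| RAbs (a b : ty) (p : prop).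

Definition PIff (p q : prop) : prop := PAnd (PImp p q) (PImp q p).

Fixpoint pren (rt rm rr : nat -> nat) (p : prop) : prop :=
  match p with
  | PEq a t u => PEq (tren rt a) (mren rt rm t) (mren rt rm u)
  | PRel r t u => PRel (rren rt rm rr r) (mren rt rm t) (mren rt rm u)
  | PTop => PTop
  | PBot => PBot
  | PAnd p q => PAnd (pren rt rm rr p) (pren rt rm rr q)
  | POr p q => POr (pren rt rm rr p) (pren rt rm rr q)
  | PImp p q => PImp (pren rt rm rr p) (pren rt rm rr q)
  | PAllT p => PAllT (pren (upr rt) rm rr p)
  | PExT p => PExT (pren (upr rt) rm rr p)
  | PAllM a p => PAllM (tren rt a) (pren rt (upr rm) rr p)
  | PExM a p => PExM (tren rt a) (pren rt (upr rm) rr p)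
  | PAllR k a b p => PAllR k (tren rt a) (tren rt b) (pren rt rm (upr rr) p)
  | PExR k a b p => PExR k (tren rt a) (tren rt b) (pren rt rm (upr rr) p)
  end
with rren (rt rm rr : nat -> nat) (r : rel) : rel :=
  match r with
  | RVar i => RVar (rr i)
  | RAbs a b p => RAbs (tren rt a) (tren rt b) (pren rt (upr (upr rm)) rr p)
  end.

Definition psh (kt km kr : nat) : prop -> prop :=
  pren (addn kt) (addn km) (addn kr).
Definition rsh (kt km kr : nat) : rel -> rel :=
  rren (addn kt) (addn km) (addn kr).

Definition rup (s : nat -> rel) : nat -> rel :=
  scons (RVar 0) (fun i => rsh 0 0 1 (s i)).

Fixpoint psub (st : nat -> ty) (sm : nat -> tm) (sr : nat -> rel) (p : prop) :
    prop :=
  match p with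
  | PEq a t u => PEq (tsub st a) (msub st sm t) (msub st sm u)
  | PRel r t u => PRel (rsub st sm sr r) (msub st sm t) (msub st sm u)
  | PTop => PTop
  | PBot => PBot
  | PAnd p q => PAnd (psub st sm sr p) (psub st sm sr q)
  | POr p q => POr (psub st sm sr p) (psub st sm sr q)
  | PImp p q => PImp (psub st sm sr p) (psub st sm sr q)
  | PAllT p =>
      PAllT (psub (tup st) (fun i => msh 1 0 (sm i))
                  (fun i => rsh 1 0 0 (sr i)) p)
  | PExT p =>
      PExT (psub (tup st) (fun i => msh 1 0 (sm i))
                 (fun i => rsh 1 0 0 (sr i)) p)
  | PAllM a p =>
      PAllM (tsub st a) (psub st (mup sm) (fun i => rsh 0 1 0 (sr i)) p)
  | PExM a p =>
      PExM (tsub st a) (psub st (mup sm) (fun i => rsh 0 1 0 (sr i)) p)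
  | PAllR k a b p => PAllR k (tsub st a) (tsub st b) (psub st sm (rup sr) p)
  | PExR k a b p => PExR k (tsub st a) (tsub st b) (psub st sm (rup sr) p)
  end
with rsub (st : nat -> ty) (sm : nat -> tm) (sr : nat -> rel) (r : rel) : rel :=
  match r with
  | RVar i => sr i
  | RAbs a b p =>
      RAbs (tsub st a) (tsub st b)
           (psub st (mup (mup sm)) (fun i => rsh 0 2 0 (sr i)) p)
  end.

Definition pinstT (a : ty) (p : prop) : prop := psub (scons a TVar) Var RVar p.
Definition pinstM (t : tm) (p : prop) : prop := psub TVar (scons t Var) RVar p.
Definition pinstM2 (t u : tm) (p : prop) : prop :=
  psub TVar (scons u (scons t Var)) RVar p.
Definition pinstR (r : rel) (p : prop) : prop :=
  psub TVar Var (scons r RVar) p.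

Definition rctx := seq (rkind * ty * ty).
Definition rctx_tsh (T : rctx) : rctx :=
  [seq (d.1.1, tsh 1 d.1.2, tsh 1 d.2) | d <- T].

Fixpoint pwf (n : nat) (G : seq ty) (T : rctx) (p : prop) : Prop :=
  match p with
  | PEq a t u => has_type n (un G) t a /\ has_type n (un G) u a
  | PRel r t u =>
      exists a b, [/\ rwf n G T r a b, has_type n (un G) t a
                    & has_type n (un G) u b]
  | PTop | PBot => True
  | PAnd p q | POr p q | PImp p q => pwf n G T p /\ pwf n G T q
  | PAllT p | PExT p => pwf n.+1 [seq tsh 1 a | a <- G] (rctx_tsh T) p
  | PAllM a p | PExM a p => twf n a /\ pwf n (a :: G) T p
  | PAllR k a b p | PExR k a b p =>
      [/\ twf n a, twf n b & pwf n G ((k, a, b) :: T) p]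
  end
with rwf (n : nat) (G : seq ty) (T : rctx) (r : rel) (a b : ty) : Prop :=
  match r with
  | RVar i => exists k, onth T i = Some (k, a, b)
  | RAbs a' b' p =>
      [/\ a' = a, b' = b, twf n a, twf n b & pwf n (b :: a :: G) T p]
  end.

Definition req (a : ty) : rel := RAbs a a (PEq a (Var 1) (Var 0)).

(* r = r' as relations between a and b: forall x y, r(x,y) <-> r'(x,y) *)
Definition PRelEquiv (a b : ty) (r r' : rel) : prop :=
  PAllM a (PAllM b (PIff (PRel (rsh 0 2 0 r) (Var 1) (Var 0))
                         (PRel (rsh 0 2 0 r') (Var 1) (Var 0)))).

Definition rlolli (a a' b b' : ty) (r r' : rel) : rel :=
  RAbs (TLolli a b) (TLolli a' b')
    (PAllM a (PAllM a'
      (PImp (PRel (rsh 0 4 0 r) (Var 1) (Var 0))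
            (PRel (rsh 0 4 0 r') (App (Var 3) (Var 1))
                                 (App (Var 2) (Var 0)))))).

(* The relations on tensor, ! and I are the impredicative ones: (x,y) is
   related iff every admissible R that is respected on pairs (resp. on
   promoted terms, on the unit) is respected at (x,y). *)
Definition rtens (a a' b b' : ty) (r r' : rel) : rel :=
  RAbs (TTens a b) (TTens a' b')
    (PAllT (PAllT (PAllR AdmRel (TVar 1) (TVar 0)
      (PAllM (TLolli (tsh 2 a) (TLolli (tsh 2 b) (TVar 1)))
      (PAllM (TLolli (tsh 2 a') (TLolli (tsh 2 b') (TVar 0)))
        (PImp
          (PRel (rlolli (tsh 2 a) (tsh 2 a')
                   (TLolli (tsh 2 b) (TVar 1)) (TLolli (tsh 2 b') (TVar 0))
                   (rsh 2 4 1 r)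
                   (rlolli (tsh 2 b) (tsh 2 b') (TVar 1) (TVar 0)
                      (rsh 2 4 1 r') (RVar 0)))
                (Var 1) (Var 0))
          (PRel (RVar 0)
             (LetPair (Var 3) (App (App (Var 3) (Var 1)) (Var 0)))
             (LetPair (Var 2) (App (App (Var 2) (Var 1)) (Var 0)))))))))).

Definition rone : rel :=
  RAbs TOne TOne
    (PAllT (PAllT (PAllR AdmRel (TVar 1) (TVar 0)
      (PAllM (TVar 1) (PAllM (TVar 0)
        (PImp (PRel (RVar 0) (Var 1) (Var 0))
              (PRel (RVar 0) (LetStar (Var 3) (Var 1))
                             (LetStar (Var 2) (Var 0))))))))).

Definition rbang (a a' : ty) (r : rel) : rel :=
  RAbs (TBang a) (TBang a')
    (PAllT (PAllT (PAllR AdmRel (TVar 1) (TVar 0)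
      (PAllM (TArr (tsh 2 a) (TVar 1)) (PAllM (TArr (tsh 2 a') (TVar 0))
        (PImp
          (PAllM (tsh 2 a) (PAllM (tsh 2 a')
            (PImp (PRel (rsh 2 6 1 r) (Var 1) (Var 0))
                  (PRel (RVar 0) (App (Var 3) (Bang (Var 1)))
                                 (App (Var 2) (Bang (Var 0)))))))
          (PRel (RVar 0) (App (Var 1) (Var 3)) (App (Var 0) (Var 2))))))))).

(* Here r lives under two further type variables and one relation variable
   R : AdmRel(TVar 1, TVar 0); [TPi a], [TPi a'] are the source and target. *)
Definition rpi (a a' : ty) (r : rel) : rel :=
  RAbs (TPi a) (TPi a')
    (PAllT (PAllT (PAllR AdmRel (TVar 1) (TVar 0)
      (PRel (rsh 0 2 0 r) (TApp (Var 1) (TVar 1)) (TApp (Var 0) (TVar 0)))))).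

(* sigma[e] : Rel(sigma[s1], sigma[s2]), for e i : AdmRel(s1 i, s2 i). *)
Fixpoint tyrel (s1 s2 : nat -> ty) (e : nat -> rel) (a : ty) : rel :=
  match a with
  | TVar i => e i
  | TOne => rone
  | TTens a b =>
      rtens (tsub s1 a) (tsub s2 a) (tsub s1 b) (tsub s2 b)
            (tyrel s1 s2 e a) (tyrel s1 s2 e b)
  | TLolli a b =>
      rlolli (tsub s1 a) (tsub s2 a) (tsub s1 b) (tsub s2 b)
             (tyrel s1 s2 e a) (tyrel s1 s2 e b)
  | TBang a => rbang (tsub s1 a) (tsub s2 a) (tyrel s1 s2 e a)
  | TPi a =>
      rpi (tsub (tup s1) a) (tsub (tup s2) a)
          (tyrel (scons (TVar 1) (fun i => tsh 2 (s1 i)))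
                 (scons (TVar 0) (fun i => tsh 2 (s2 i)))
                 (scons (RVar 0) (fun i => rsh 2 0 1 (e i))) a)
  end.

(* A set of non-logical axioms: Ax n G T p means that p, in the context
   n | G | T, is an axiom. *)
Definition theory := nat -> seq ty -> rctx -> prop -> Prop.

(* [isrel Ax n G T k r a b]: r is a definable (k = Rel), resp. admissible
   (k = AdmRel), relation between a and b.
   [prov Ax n G T H p]: n | G | T | H |- p in LAPL extended with Ax. *)
Inductive isrel (Ax : theory) :
    nat -> seq ty -> rctx -> rkind -> rel -> ty -> ty -> Prop :=
| ir_rel n G T r a b : rwf n G T r a b -> isrel Ax n G T Rel r a b
| ir_var n G T i a b :
    onth T i = Some (AdmRel, a, b) -> isrel Ax n G T AdmRel (RVar i) a b
| ir_eq n G T a : twf n a -> isrel Ax n G T AdmRel (req a) a a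
| ir_reindex n G T r a b a' b' t u :
    isrel Ax n G T AdmRel r a b ->
    has_type n (un G) t (TLolli a' a) -> has_type n (un G) u (TLolli b' b) ->
    isrel Ax n G T AdmRel
      (RAbs a' b' (PRel (rsh 0 2 0 r) (App (msh 0 2 t) (Var 1))
                                      (App (msh 0 2 u) (Var 0)))) a' b'
| ir_op n G T r a b :
    isrel Ax n G T AdmRel r a b ->
    isrel Ax n G T AdmRel
      (RAbs b a (PRel (rsh 0 2 0 r) (Var 0) (Var 1))) b a
| ir_top n G T a b :
    twf n a -> twf n b -> isrel Ax n G T AdmRel (RAbs a b PTop) a b
| ir_and n G T r r' a b :
    isrel Ax n G T AdmRel r a b -> isrel Ax n G T AdmRel r' a b ->
    isrel Ax n G T AdmRel
      (RAbs a b (PAnd (PRel (rsh 0 2 0 r) (Var 1) (Var 0))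
                      (PRel (rsh 0 2 0 r') (Var 1) (Var 0)))) a b
| ir_imp n G T p r a b :
    pwf n G T p -> isrel Ax n G T AdmRel r a b ->
    isrel Ax n G T AdmRel
      (RAbs a b (PImp (psh 0 2 0 p) (PRel (rsh 0 2 0 r) (Var 1) (Var 0)))) a b
| ir_allT n G T r a b :
    twf n a -> twf n b ->
    isrel Ax n.+1 [seq tsh 1 c | c <- G] (rctx_tsh T) AdmRel r
          (tsh 1 a) (tsh 1 b) ->
    isrel Ax n G T AdmRel
      (RAbs a b (PAllT (PRel (rsh 0 2 0 r) (Var 1) (Var 0)))) a b
| ir_allM n G T c r a b :
    twf n c -> isrel Ax n (c :: G) T AdmRel r a b ->
    isrel Ax n G T AdmRel
      (RAbs a b (PAllM c (PRel (rren id (upr (addn 2)) id r)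
                               (Var 2) (Var 1)))) a b
| ir_allR n G T k c d r a b :
    twf n c -> twf n d -> isrel Ax n G ((k, c, d) :: T) AdmRel r a b ->
    isrel Ax n G T AdmRel
      (RAbs a b (PAllR k c d (PRel (rsh 0 2 0 r) (Var 1) (Var 0)))) a b
| ir_equiv n G T r r' a b :
    isrel Ax n G T AdmRel r a b -> rwf n G T r' a b ->
    prov Ax n G T [::] (PRelEquiv a b r r') ->
    isrel Ax n G T AdmRel r' a b
with prov (Ax : theory) :
    nat -> seq ty -> rctx -> seq prop -> prop -> Prop :=
| pr_axiom n G T H p : Ax n G T p -> prov Ax n G T H p
| pr_hyp n G T H p : List.In p H -> pwf n G T p -> prov Ax n G T H p
| pr_topI n G T H : prov Ax n G T H PTop
| pr_botE n G T H p : pwf n G T p -> prov Ax n G T H PBot -> prov Ax n G T H p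
| pr_andI n G T H p q :
    prov Ax n G T H p -> prov Ax n G T H q -> prov Ax n G T H (PAnd p q)
| pr_andE1 n G T H p q : prov Ax n G T H (PAnd p q) -> prov Ax n G T H p
| pr_andE2 n G T H p q : prov Ax n G T H (PAnd p q) -> prov Ax n G T H q
| pr_orI1 n G T H p q :
    pwf n G T q -> prov Ax n G T H p -> prov Ax n G T H (POr p q)
| pr_orI2 n G T H p q :
    pwf n G T p -> prov Ax n G T H q -> prov Ax n G T H (POr p q)
| pr_orE n G T H p q s :
    prov Ax n G T H (POr p q) -> prov Ax n G T (p :: H) s ->
    prov Ax n G T (q :: H) s -> prov Ax n G T H s
| pr_impI n G T H p q :
    pwf n G T p -> prov Ax n G T (p :: H) q -> prov Ax n G T H (PImp p q)
| pr_impE n G T H p q :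
    prov Ax n G T H (PImp p q) -> prov Ax n G T H p -> prov Ax n G T H q
| pr_allTI n G T H p :
    prov Ax n.+1 [seq tsh 1 a | a <- G] (rctx_tsh T)
         [seq psh 1 0 0 h | h <- H] p ->
    prov Ax n G T H (PAllT p)
| pr_allTE n G T H p a :
    prov Ax n G T H (PAllT p) -> twf n a -> prov Ax n G T H (pinstT a p)
| pr_exTI n G T H p a :
    pwf n G T (PExT p) -> twf n a -> prov Ax n G T H (pinstT a p) ->
    prov Ax n G T H (PExT p)
| pr_exTE n G T H p q :
    pwf n G T q -> prov Ax n G T H (PExT p) ->
    prov Ax n.+1 [seq tsh 1 a | a <- G] (rctx_tsh T)
         (p :: [seq psh 1 0 0 h | h <- H]) (psh 1 0 0 q) ->
    prov Ax n G T H q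
| pr_allMI n G T H a p :
    twf n a -> prov Ax n (a :: G) T [seq psh 0 1 0 h | h <- H] p ->
    prov Ax n G T H (PAllM a p)
| pr_allME n G T H a p t :
    prov Ax n G T H (PAllM a p) -> has_type n (un G) t a ->
    prov Ax n G T H (pinstM t p)
| pr_exMI n G T H a p t :
    pwf n G T (PExM a p) -> has_type n (un G) t a ->
    prov Ax n G T H (pinstM t p) -> prov Ax n G T H (PExM a p)
| pr_exME n G T H a p q :
    pwf n G T q -> prov Ax n G T H (PExM a p) ->
    prov Ax n (a :: G) T (p :: [seq psh 0 1 0 h | h <- H]) (psh 0 1 0 q) ->
    prov Ax n G T H q
| pr_allRI n G T H k a b p :
    twf n a -> twf n b ->
    prov Ax n G ((k, a, b) :: T) [seq psh 0 0 1 h | h <- H] p ->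
    prov Ax n G T H (PAllR k a b p)
| pr_allRE n G T H k a b p r :
    prov Ax n G T H (PAllR k a b p) -> isrel Ax n G T k r a b ->
    prov Ax n G T H (pinstR r p)
| pr_exRI n G T H k a b p r :
    pwf n G T (PExR k a b p) -> isrel Ax n G T k r a b ->
    prov Ax n G T H (pinstR r p) -> prov Ax n G T H (PExR k a b p)
| pr_exRE n G T H k a b p q :
    pwf n G T q -> prov Ax n G T H (PExR k a b p) ->
    prov Ax n G ((k, a, b) :: T) (p :: [seq psh 0 0 1 h | h <- H])
         (psh 0 0 1 q) ->
    prov Ax n G T H q
| pr_relI n G T H a b p t u :
    pwf n G T (PRel (RAbs a b p) t u) -> prov Ax n G T H (pinstM2 t u p) ->
    prov Ax n G T H (PRel (RAbs a b p) t u)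
| pr_relE n G T H a b p t u :
    prov Ax n G T H (PRel (RAbs a b p) t u) ->
    prov Ax n G T H (pinstM2 t u p)
| pr_ext_eq n G T H a t u :
    ext_eq n (un G) t u a -> prov Ax n G T H (PEq a t u)
| pr_eqE n G T H a t u p :
    pwf n (a :: G) T p -> prov Ax n G T H (PEq a t u) ->
    prov Ax n G T H (pinstM t p) -> prov Ax n G T H (pinstM u p).

Inductive extensionality : theory :=
| ext_lolli n G T a b t u :
    has_type n (un G) t (TLolli a b) -> has_type n (un G) u (TLolli a b) ->
    extensionality n G T
      (PImp (PAllM a (PEq b (App (msh 0 1 t) (Var 0))
                            (App (msh 0 1 u) (Var 0))))
            (PEq (TLolli a b) t u))
| ext_pi n G T a t u :
    has_type n (un G) t (TPi a) -> has_type n (un G) u (TPi a) ->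
    extensionality n G T
      (PImp (PAllT (PEq a (TApp (msh 1 0 t) (TVar 0))
                          (TApp (msh 1 0 u) (TVar 0))))
            (PEq (TPi a) t u)).

(* For a type a in the k type variables bound by the leading quantifiers. *)
Inductive identity_extension : theory :=
| id_ext n G T k a :
    twf k a ->
    identity_extension n G T
      (iter k PAllT
         (PRelEquiv a a (tyrel TVar TVar (fun i => req (TVar i)) a) (req a))).

Definition LAPL_par : theory :=
  fun n G T p => extensionality n G T p \/ identity_extension n G T p.

Inductive ind_constructed : ty -> Prop :=
| ic_var i : ind_constructed (TVar i)
| ic_closed a : twf 0 a -> ind_constructed a
| ic_lolli a b :
    ind_constructed a -> ind_constructed b -> ind_constructed (TLolli a b)
| ic_tens a b :
    ind_constructed a -> ind_constructed b -> ind_constructed (TTens a b)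
| ic_one : ind_constructed TOne
| ic_bang a : ind_constructed a -> ind_constructed (TBang a)
| ic_pi a : ind_constructed a -> ind_constructed (TPi a).

(* The variable i has a positive (pos = true) or negative occurrence in a. *)
Fixpoint occurs (pos : bool) (i : nat) (a : ty) : bool :=
  match a with
  | TVar j => pos && (i == j)
  | TOne => false
  | TTens a b => occurs pos i a || occurs pos i b
  | TLolli a b => occurs (~~ pos) i a || occurs pos i b
  | TBang a => occurs pos i a
  | TPi a => occurs pos i.+1 a
  end.

Definition only_negative (i : nat) (a : ty) : bool := ~~ occurs true i a.
Definition only_positive (i : nat) (a : ty) : bool := ~~ occurs false i a.

Definition midt (a : ty) : tm := Lam a (Var 0).

Definition mcomp (a : ty) (g f : tm) : tm :=
  Lam a (App (msh 0 1 g) (App (msh 0 1 f) (Var 0))).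

(* Action of a type on morphisms, a[s] -o a[s'], given for each type variable i
   a term m i : s i -o s' i if i occurs positively, and m i : s' i -o s i if i
   occurs negatively.  In the argument of -o the roles of s and s' are
   exchanged, which is sigma1(g,f) for sigma1(beta,alpha). *)
Fixpoint tact (s s' : nat -> ty) (m : nat -> tm) (a : ty) : tm :=
  if twf 0 a then midt a else
  match a with
  | TVar i => m i
  | TOne => midt TOne
  | TTens a b =>
      Lam (TTens (tsub s a) (tsub s b))
        (LetPair (Var 0)
           (Pair (App (msh 0 3 (tact s s' m a)) (Var 1))
                 (App (msh 0 3 (tact s s' m b)) (Var 0))))
  | TLolli a b =>
      Lam (TLolli (tsub s a) (tsub s b))
        (mcomp (tsub s' a)
           (mcomp (tsub s a) (msh 0 1 (tact s s' m b)) (Var 0))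
           (msh 0 1 (tact s' s m a)))
  | TBang a =>
      Lam (TBang (tsub s a))
        (LetBang (Var 0) (Bang (App (msh 0 2 (tact s s' m a)) (Var 0))))
  | TPi a =>
      Lam (TPi (tsub (tup s) a))
        (TLam (App (msh 0 1
                      (tact (tup s) (tup s')
                         (scons (midt (TVar 0)) (fun i => msh 1 0 (m i))) a))
                   (TApp (Var 0) (TVar 0))))
  end.

(* For sigma(alpha, beta) the variable alpha is [TVar 0], beta is [TVar 1]. *)
Definition env2 (a b : ty) : nat -> ty := scons a (scons b TVar).
Definition ty2 (c a b : ty) : ty := tsub (env2 a b) c.

(* For f : a' -o a and g : b -o b', the term
   c(f, g) : c(a, b) -o c(a', b'). *)
Definition fmap2 (c a b a' b' : ty) (f g : tm) : tm :=
  tact (env2 a b) (env2 a' b') (scons f (scons g Var)) c.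

Definition mor (n : nat) (a b : ty) (f : tm) : Prop :=
  has_type n [::] f (TLolli a b).

Definition mor_eq (Ax : theory) (n : nat) (a b : ty) (f g : tm) : Prop :=
  prov Ax n [::] [::] [::] (PEq (TLolli a b) f g).

(* In (tau, tau', f, f'), tau is [dpos] and tau' is [dneg]. *)
Record dialg : Type := Dialg
  { dpos : ty; dneg : ty; din : tm; dout : tm }.

Definition is_dialg (n : nat) (c : ty) (D : dialg) : Prop :=
  [/\ twf n (dpos D), twf n (dneg D),
      mor n (ty2 c (dneg D) (dpos D)) (dpos D) (din D)
    & mor n (dneg D) (ty2 c (dpos D) (dneg D)) (dout D)].

Definition is_dialg_mor (Ax : theory) (n : nat) (c : ty) (D0 D1 : dialg)
    (h h' : tm) : Prop :=
  [/\ mor n (dpos D0) (dpos D1) h,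
      mor n (dneg D1) (dneg D0) h',
      mor_eq Ax n (ty2 c (dneg D0) (dpos D0)) (dpos D1)
        (mcomp (ty2 c (dneg D0) (dpos D0)) h (din D0))
        (mcomp (ty2 c (dneg D0) (dpos D0)) (din D1)
           (fmap2 c (dneg D0) (dpos D0) (dneg D1) (dpos D1) h' h))
    & mor_eq Ax n (dneg D1) (ty2 c (dpos D0) (dneg D0))
        (mcomp (dneg D1) (dout D0) h')
        (mcomp (dneg D1)
           (fmap2 c (dpos D1) (dneg D1) (dpos D0) (dneg D0) h h')
           (dout D1))].

Definition initial_dialg (Ax : theory) (n : nat) (c : ty) (D : dialg) : Prop :=
  is_dialg n c D /\
  forall D1 : dialg, is_dialg n c D1 ->
    (exists h h' : tm, is_dialg_mor Ax n c D D1 h h') /\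
    (forall h1 h1' h2 h2' : tm,
       is_dialg_mor Ax n c D D1 h1 h1' -> is_dialg_mor Ax n c D D1 h2 h2' ->
       mor_eq Ax n (dpos D) (dpos D1) h1 h2 /\
       mor_eq Ax n (dneg D1) (dneg D) h1' h2').

(* Main.v *)
(* Write s(a, b) for the given type, a dialgebra being g : s(a', a) -o a with g' : a' -o s(a, a').
   The initial one is obtained directly as a limit:
     tau = Pi a a'. !(s(a', a) -o a) -o !(a' -o s(a, a')) -o a,
   while tau' encodes exists a a'. !(s(a', a) -o a) (x) !(a' -o s(a, a')) (x) a' by its eliminator.
   Evaluation at, and packing with, (g, g') give the maps fold : tau -o a and pack : a' -o tau', and
   the structure maps in, out are defined so that (fold, pack) is a dialgebra morphism by beta.

   Uniqueness is parametricity.  The graph lemma says that s maps graphs to the graph of its action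
   on morphisms, so for any morphism (h, h') the graphs of h and h' relate (in, out) to (g, g').
   Every z : tau therefore satisfies h (z in out) = z g g', and every continuation k out of tau'
   satisfies k in out (h' x) = k g g' x.  Taking fold for h yields z in out = z, hence h = fold;
   dually k in out p = p k for p : tau', by naturality of p and by taking pack for h', and hence
   h' = pack. *)

From Stdlib Require List FunctionalExtensionality.
From mathcomp Require Import all_boot.
Require Import Defs.
Set Implicit Arguments.
Unset Strict Implicit.
Unset Printing Implicit Defensive.

(** The calculus has no limits or colimits of types, so both carriers are impredicative encodings,
    and parametricity has to supply the eta laws that make such encodings universal. The structure
    maps are quantified under [!] because [in] and [out] use them repeatedly: once directly and
    again inside fold and pack. Hence equality of maps out of [!] must be testable on promoted
    elements, which is itself drawn from identity extension.

    The graph lemma is not proved by cases on s. It is read off from identity extension at the type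
    of one closed term, the polymorphic action of s; an induction on the type only has to show that
    the action preserves identities.

    Relations substituted for type variables must be admissible. Equality reindexed along a pair of
    linear terms is, and this single form covers a graph as well as its converse, which is what the
    contravariant half of a dialgebra morphism calls for.

    Naturality of an element p of tau' in its result type is again parametricity. Since p is an
    arbitrary term, it enters as a parameter of a term whose type is closed, and identity extension
    applies to every term of a closed type. *)

Ltac fext := apply: FunctionalExtensionality.functional_extensionality.

(** * Substitution algebra *)

Lemma upr_comp r r' : upr r \o upr r' = upr (r \o r').
Proof. by fext; case. Qed.

Lemma tren_ren r r' a : tren r (tren r' a) = tren (r \o r') a.
Proof.
elim: a r r' => //= [a IHa b IHb|a IHa b IHb|a IHa|a IHa] r r';
  by rewrite IHa ?IHb ?upr_comp.
Qed.

Lemma tsub_ren s r a : tsub s (tren r a) = tsub (s \o r) a.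
Proof.
elim: a s r => //= [a IHa b IHb|a IHa b IHb|a IHa|a IHa] s r;
  rewrite IHa ?IHb //.
by congr (TPi (tsub _ _)); fext; case.
Qed.

Lemma tren_sub r s a : tren r (tsub s a) = tsub (tren r \o s) a.
Proof.
elim: a s r => //= [a IHa b IHb|a IHa b IHb|a IHa|a IHa] s r;
  rewrite IHa ?IHb //.
by congr (TPi (tsub _ _)); fext; case=> //= i; rewrite /tsh !tren_ren.
Qed.

Lemma tsub_sub s s' a : tsub s (tsub s' a) = tsub (tsub s \o s') a.
Proof.
elim: a s s' => //= [a IHa b IHb|a IHa b IHb|a IHa|a IHa] s s';
  rewrite IHa ?IHb //.
by congr (TPi (tsub _ _)); fext; case=> //= i; rewrite /tsh tsub_ren tren_sub.
Qed.

Lemma tren_as_sub r a : tren r a = tsub (TVar \o r) a.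
Proof.
elim: a r => //= [a IHa b IHb|a IHa b IHb|a IHa|a IHa] r; rewrite IHa ?IHb //.
by congr (TPi (tsub _ _)); fext; case.
Qed.

Lemma tup_var : tup TVar = TVar.
Proof. by fext; case. Qed.

Lemma tsub_id a : tsub TVar a = a.
Proof. by elim: a => //= [a -> b ->|a -> b ->|a ->|a]; rewrite ?tup_var // => ->. Qed.

Lemma mren_ren rt rm rt' rm' t :
  mren rt rm (mren rt' rm' t) = mren (rt \o rt') (rm \o rm') t.
Proof.
by elim: t rt rm rt' rm' => //=; intros; rewrite ?tren_ren ?H ?H0 ?upr_comp.
Qed.

Lemma msub_ren st sm rt rm t :
  msub st sm (mren rt rm t) = msub (st \o rt) (sm \o rm) t.
Proof.
have E (s : nat -> tm) r : mup s \o upr r = mup (s \o r) by fext; case.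
have F (s : nat -> ty) r : tup s \o upr r = tup (s \o r) by fext; case.
by elim: t st sm rt rm => //=; intros; rewrite ?tsub_ren ?H ?H0 ?E ?F.
Qed.

Lemma mren_sub rt rm st sm t :
  mren rt rm (msub st sm t) = msub (tren rt \o st) (mren rt rm \o sm) t.
Proof.
have E r r' (s : nat -> tm) : mren r (upr r') \o mup s = mup (mren r r' \o s).
  by fext; case=> //= i; rewrite /msh !mren_ren.
have F r (s : nat -> ty) : tren (upr r) \o tup s = tup (tren r \o s).
  by fext; case=> //= i; rewrite /tsh !tren_ren.
elim: t rt rm st sm => //=; intros; rewrite ?tren_sub ?H ?H0 ?E ?F //.
by congr (TLam (msub _ _ _)); fext => i /=; rewrite /msh !mren_ren.
Qed.

Lemma msub_sub st sm st' sm' t :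
  msub st sm (msub st' sm' t) = msub (tsub st \o st') (msub st sm \o sm') t.
Proof.
have E s s' (s1 : nat -> tm) : msub s (mup s') \o mup s1 = mup (msub s s' \o s1).
  fext; case=> //= i; rewrite /msh msub_ren mren_sub.
  by congr msub; fext=> j /=; rewrite tren_as_sub tsub_id.
have F s (s' : nat -> ty) : tsub (tup s) \o tup s' = tup (tsub s \o s').
  by fext; case=> //= i; rewrite /tsh tsub_ren tren_sub.
elim: t st sm st' sm' => //=; intros; rewrite ?tsub_sub ?H ?H0 ?E ?F //.
by congr (TLam (msub _ _ _)); fext => i /=; rewrite /msh msub_ren mren_sub.
Qed.

Lemma mren_as_sub rt rm t : mren rt rm t = msub (TVar \o rt) (Var \o rm) t.
Proof.
have E r : Var \o upr r = mup (Var \o r) by fext; case.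
have F r : TVar \o upr r = tup (TVar \o r) by fext; case.
by elim: t rt rm => //=; intros; rewrite ?tren_as_sub ?H ?H0 ?E ?F.
Qed.

Lemma mup_var : mup Var = Var.
Proof. by fext; case. Qed.

Lemma msub_id t : msub TVar Var t = t.
Proof.
elim: t => //=; intros; rewrite ?tsub_id ?mup_var ?tup_var ?H ?H0 //.
Qed.

Scheme prop_rel_rect := Induction for prop Sort Prop
with rel_prop_rect := Induction for rel Sort Prop.
Combined Scheme prop_rel_ind from prop_rel_rect, rel_prop_rect.

Lemma pr_ren_ren :
  (forall p rt rm rr rt' rm' rr', pren rt rm rr (pren rt' rm' rr' p) =
     pren (rt \o rt') (rm \o rm') (rr \o rr') p) /\
  (forall r rt rm rr rt' rm' rr', rren rt rm rr (rren rt' rm' rr' r) =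
     rren (rt \o rt') (rm \o rm') (rr \o rr') r).
Proof.
by apply: prop_rel_ind => //=; intros;
  rewrite ?tren_ren ?mren_ren ?H ?H0 ?upr_comp.
Qed.

Lemma pr_sub_ren :
  (forall p st sm sr rt rm rr, psub st sm sr (pren rt rm rr p) =
     psub (st \o rt) (sm \o rm) (sr \o rr) p) /\
  (forall r st sm sr rt rm rr, rsub st sm sr (rren rt rm rr r) =
     rsub (st \o rt) (sm \o rm) (sr \o rr) r).
Proof.
have E (s : nat -> tm) r : mup s \o upr r = mup (s \o r) by fext; case.
have F (s : nat -> ty) r : tup s \o upr r = tup (s \o r) by fext; case.
have K (s : nat -> rel) r : rup s \o upr r = rup (s \o r) by fext; case.
by apply: prop_rel_ind => //=; intros;
  rewrite ?tsub_ren ?msub_ren ?H ?H0 ?E ?F ?K.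
Qed.

Lemma pr_ren_sub :
  (forall p rt rm rr st sm sr, pren rt rm rr (psub st sm sr p) =
     psub (tren rt \o st) (mren rt rm \o sm) (rren rt rm rr \o sr) p) /\
  (forall r rt rm rr st sm sr, rren rt rm rr (rsub st sm sr r) =
     rsub (tren rt \o st) (mren rt rm \o sm) (rren rt rm rr \o sr) r).
Proof.
have [_ RR] := pr_ren_ren.
have E r r' (s : nat -> tm) : mren r (upr r') \o mup s = mup (mren r r' \o s).
  by fext; case=> //= i; rewrite /msh !mren_ren.
have F r (s : nat -> ty) : tren (upr r) \o tup s = tup (tren r \o s).
  by fext; case=> //= i; rewrite /tsh !tren_ren.
have K r r' r'' (s : nat -> rel) :
    rren r r' (upr r'') \o rup s = rup (rren r r' r'' \o s).
  by fext; case=> //= i; rewrite /rsh !RR.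
apply: prop_rel_ind => //=; intros;
  rewrite ?tren_sub ?mren_sub ?H ?H0 ?E ?F ?K //;
  by (congr PAllT || congr PExT || congr PAllM || congr PExM || congr RAbs);
  congr psub; fext => i /=; rewrite /msh /rsh ?mren_ren ?RR.
Qed.

Lemma pr_sub_sub :
  (forall p st sm sr st' sm' sr', psub st sm sr (psub st' sm' sr' p) =
     psub (tsub st \o st') (msub st sm \o sm') (rsub st sm sr \o sr') p) /\
  (forall r st sm sr st' sm' sr', rsub st sm sr (rsub st' sm' sr' r) =
     rsub (tsub st \o st') (msub st sm \o sm') (rsub st sm sr \o sr') r).
Proof.
have [_ RS] := pr_ren_sub; have [_ SR] := pr_sub_ren.
(* A shift in one index space also renames the other ones by [addn 0]; [I] and [I'] remove these
   trivial renamings. *)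
have I (s : nat -> ty) : tren (addn 0) \o s = s.
  by fext=> j /=; rewrite tren_as_sub tsub_id.
have I' (s : nat -> tm) : mren (addn 0) (addn 0) \o s = s.
  by fext=> j /=; rewrite mren_as_sub msub_id.
have E s s' (s1 : nat -> tm) : msub s (mup s') \o mup s1 = mup (msub s s' \o s1).
  by fext; case=> //= i; rewrite /msh msub_ren mren_sub I.
have F s (s' : nat -> ty) : tsub (tup s) \o tup s' = tup (tsub s \o s').
  by fext; case=> //= i; rewrite /tsh tsub_ren tren_sub.
have E2 s : mup (mup s) \o addn 2 = mren (addn 0) (addn 2) \o s.
  by fext=> i /=; rewrite /msh mren_ren.
have K s s' s'' (s1 : nat -> rel) :
    rsub s s' (rup s'') \o rup s1 = rup (rsub s s' s'' \o s1).
  by fext; case=> //= i; rewrite /rsh SR RS I I'.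
apply: prop_rel_ind => //=; intros;
  rewrite ?tsub_sub ?msub_sub ?H ?H0 ?E ?F ?K //;
  (congr PAllT || congr PExT || congr PAllM || congr PExM || congr RAbs);
  congr psub; fext => i /=;
  by rewrite /msh /rsh ?msub_ren ?mren_sub ?SR ?RS ?I ?E2.
Qed.

Lemma pr_ren_as_sub :
  (forall p rt rm rr, pren rt rm rr p = psub (TVar \o rt) (Var \o rm) (RVar \o rr) p) /\
  (forall r rt rm rr, rren rt rm rr r = rsub (TVar \o rt) (Var \o rm) (RVar \o rr) r).
Proof.
have E r : Var \o upr r = mup (Var \o r) by fext; case.
have F r : TVar \o upr r = tup (TVar \o r) by fext; case.
have K r : RVar \o upr r = rup (RVar \o r) by fext; case.
by apply: prop_rel_ind => //=; intros;
  rewrite ?tren_as_sub ?mren_as_sub ?H ?H0 ?E ?F ?K.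
Qed.

Lemma pr_sub_id :
  (forall p, psub TVar Var RVar p = p) /\ (forall r, rsub TVar Var RVar r = r).
Proof.
have K : rup RVar = RVar by fext; case.
apply: prop_rel_ind => //=; intros;
  rewrite ?tsub_id ?msub_id ?mup_var ?tup_var ?K ?H ?H0 //;
  (congr PAllT || congr PExT || congr PAllM || congr PExM || congr RAbs);
  exact: H.
Qed.

Definition psub_sub := pr_sub_sub.1.
Definition rsub_sub := pr_sub_sub.2.
Definition pren_as_sub := pr_ren_as_sub.1.
Definition rren_as_sub := pr_ren_as_sub.2.
Definition psub_id := pr_sub_id.1.
Definition rsub_id := pr_sub_id.2.

Lemma tsub_ext n s s' a :
  twf n a -> (forall i, i < n -> s i = s' i) -> tsub s a = tsub s' a.
Proof.
elim: a n s s' => //= [i|a IHa b IHb|a IHa b IHb|a IHa|a IHa] n s s' W E.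
- exact: E.
- by case/andP: W => /IHa W1 /IHb W2; rewrite (W1 _ _ E) (W2 _ _ E).
- by case/andP: W => /IHa W1 /IHb W2; rewrite (W1 _ _ E) (W2 _ _ E).
- by rewrite (IHa _ _ _ W E).
- by congr TPi; apply: IHa W _; case=> //= i /E->.
Qed.

Lemma tsub_closed s a : twf 0 a -> tsub s a = a.
Proof. by move=> W; rewrite -[RHS]tsub_id; apply: tsub_ext W _. Qed.

Lemma twf_ren n m r a :
  twf n a -> (forall i, i < n -> r i < m) -> twf m (tren r a).
Proof.
elim: a n m r => //= [i|a IHa b IHb|a IHa b IHb|a IHa] n m r W E.
- exact: E.
- by case/andP: W => /IHa W1 /IHb W2; rewrite (W1 _ _ E) (W2 _ _ E).
- by case/andP: W => /IHa W1 /IHb W2; rewrite (W1 _ _ E) (W2 _ _ E).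
- by apply: IHa W _; case=> //= i; apply: E.
Qed.

Lemma twf_sub n m s a :
  twf n a -> (forall i, i < n -> twf m (s i)) -> twf m (tsub s a).
Proof.
elim: a n m s => //= [i|a IHa b IHb|a IHa b IHb|a IHa] n m s W E.
- exact: E.
- by case/andP: W => /IHa W1 /IHb W2; rewrite (W1 _ _ E) (W2 _ _ E).
- by case/andP: W => /IHa W1 /IHb W2; rewrite (W1 _ _ E) (W2 _ _ E).
- by apply: IHa W _; case=> //= i /E W; apply: twf_ren W _.
Qed.

Lemma twf_mono n m a : n <= m -> twf n a -> twf m a.
Proof.
move=> nm W; rewrite -[a]tsub_id; apply: twf_sub W _ => i /=.
by move/leq_trans; apply.
Qed.

Lemma twf_closed n a : twf 0 a -> twf n a.
Proof. exact: twf_mono. Qed.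

Lemma twf_sh n k a : twf n a -> twf (k + n) (tsh k a).
Proof. by move=> W; apply: twf_ren W _ => i; rewrite ltn_add2l. Qed.

Lemma twf_inst n a b : twf n.+1 a -> twf n b -> twf n (tinst b a).
Proof. by move=> W Wb; apply: twf_sub W _; case. Qed.

(** * Typing *)

(** Retiring the linear variables leaves the intuitionistic part of a context without moving any
    index. Terms typed there may be promoted or duplicated. *)
Definition off_mult (m : mult) : mult := if m is Lin then Off else m.
Definition off (G : ctx) : ctx := [seq (d.1, off_mult d.2) | d <- G].

Lemma no_lin_off G : no_lin (off G).
Proof. by elim: G => //= -[a []]. Qed.

Lemma off_no_lin G : no_lin G -> off G = G.
Proof. by elim: G => //= -[a []] //= G IH /IH->. Qed.

Lemma split_off_l G : split_ctx G G (off G).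
Proof. by elim: G => [|[a []] G IH] /=; constructor=> //; constructor. Qed.

Lemma split_off_r G : split_ctx G (off G) G.
Proof. by elim: G => [|[a []] G IH] /=; constructor=> //; constructor. Qed.

Lemma split_no_lin G G1 G2 : no_lin G -> split_ctx G G1 G2 -> G1 = G /\ G2 = G.
Proof.
move=> N S; elim: S N => //= a m m1 m2 G' G1' G2' S _ IH /andP[nl /IH[-> ->]].
by case: S nl.
Qed.

Lemma split_self G : no_lin G -> split_ctx G G G.
Proof. by move=> N; rewrite -{3}(off_no_lin N); apply: split_off_l. Qed.

Lemma split_wf n G G1 G2 : split_ctx G G1 G2 ->
  ctx_wf n G = ctx_wf n G1 /\ ctx_wf n G = ctx_wf n G2.
Proof. by elim=> //= a m m1 m2 {}G {}G1 {}G2 _ _ [<- <-]. Qed.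

Lemma no_lin_un G : no_lin (un G).
Proof. by elim: G. Qed.

Lemma wf_un n G : ctx_wf n (un G) = all (twf n) G.
Proof. by elim: G => //= a G ->. Qed.

Lemma un_tsh G : ctx_tsh (un G) = un [seq tsh 1 a | a <- G].
Proof. by elim: G => //= a G ->. Qed.

Lemma off_un G : off (un G) = un G.
Proof. exact: off_no_lin (no_lin_un G). Qed.

Lemma ctx_wf_tsh n G : ctx_wf n G -> ctx_wf n.+1 (ctx_tsh G).
Proof.
elim: G => //= -[a m] G IH /= /andP[W /IH->].
by rewrite andbT; apply: (twf_sh 1).
Qed.

Lemma twf_unsh n a : twf n.+1 (tsh 1 a) -> twf n a.
Proof.
move=> W.
(* Generalised from the shift to the renaming that skips index k, because going under a [TPi] moves
   the skipped index up by one. *)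
suff E m k c : k <= m -> twf m.+1 (tren (fun i => if i < k then i else i.+1) c) -> twf m c.
  by apply: (E n 0 a).
elim: c m k {W a} => //= [i|a IHa b IHb|a IHa b IHb|a IHa] m k km.
- by case: (ltnP i k) => [ik _|]; [apply: leq_trans km|].
- by case/andP=> /(IHa _ _ km)-> /(IHb _ _ km)->.
- by case/andP=> /(IHa _ _ km)-> /(IHb _ _ km)->.
- move=> W; apply: (IHa m.+1 k.+1) => //; move: W; congr (twf _ (tren _ _)).
  by fext; case=> //= i; rewrite ltnS; case: ifP.
Qed.

Lemma ctx_wf_untsh n G : ctx_wf n.+1 (ctx_tsh G) -> ctx_wf n G.
Proof.
elim: G => //= -[a m] G IH /= /andP[/twf_unsh W /IH->].
by rewrite andbT.
Qed.

Lemma lookup_wf n G i a : ctx_wf n G -> lookup G i a -> twf n a.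
Proof.
move=> W L; elim: L W => {G i a} [a m G _ _|a b m G i _ _ IH] /= /andP[] //.
Qed.

Lemma has_type_wf n G t a : has_type n G t a -> ctx_wf n G /\ twf n a.
Proof.
elim=> {n G t a} //=.
- by move=> n G i a W L; split=> //; apply: lookup_wf L.
- by move=> n G a b t _ [/andP[-> ->] ->].
- by move=> n G G1 G2 a b t u S _ [W1 /andP[_ W]] _ _; rewrite (split_wf n S).1.
- by move=> n G G1 G2 a b t u S _ [W1 ->] _ [_ ->]; rewrite (split_wf n S).1.
- by move=> n G a t _ [W1 ->]; split=> //; apply: ctx_wf_untsh.
- by move=> n G a b t _ [W1 W] Wb; split=> //; apply: twf_inst.
- by move=> n G G1 G2 b s t S _ _ _ [W ->]; rewrite (split_wf n S).2.
- move=> n G G1 G2 a b c s t S _ _ _ [W ->]; rewrite (split_wf n S).2.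
  by case/and3P: W.
- move=> n G G1 G2 a b s t S _ _ _ [W ->]; rewrite (split_wf n S).2.
  by case/andP: W.
Qed.

(** Only order-preserving renamings, generated entry by entry, so that a split of the source context
    can be followed in the target. Added entries must not be linear, since a linear variable has to
    be used. *)
Inductive ctx_ren (rt : nat -> nat) : (nat -> nat) -> ctx -> ctx -> Prop :=
| ctx_ren_nil rm G' : no_lin G' -> ctx_ren rt rm [::] G'
| ctx_ren_keep rm a m G G' :
    ctx_ren rt rm G G' -> ctx_ren rt (upr rm) ((a, m) :: G) ((tren rt a, m) :: G')
| ctx_ren_skip rm a m G G' :
    ~~ is_lin m -> ctx_ren rt rm G G' -> ctx_ren rt (succn \o rm) G ((a, m) :: G').

Lemma ctx_ren_no_lin rt rm G G' : ctx_ren rt rm G G' -> no_lin G -> no_lin G'.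
Proof.
elim=> //= {rm G G'}; first by move=> rm a m G G' _ IH /andP[-> /IH->].
by move=> rm a m G G' -> _ IH /IH->.
Qed.

Lemma ctx_ren_lookup rt rm G G' i a :
  ctx_ren rt rm G G' -> lookup G i a -> lookup G' (rm i) (tren rt a).
Proof.
move=> K; elim: K i a => {rm G G'} [rm G' N|rm b m G G' K IH|rm b m G G' N K IH] i a L.
- by inversion L.
- by inversion L; subst; constructor; eauto using ctx_ren_no_lin.
- by constructor; eauto.
Qed.

Lemma ctx_ren_split rt rm G G' G1 G2 : ctx_ren rt rm G G' -> split_ctx G G1 G2 ->
  exists G1' G2', [/\ split_ctx G' G1' G2', ctx_ren rt rm G1 G1' & ctx_ren rt rm G2 G2'].
Proof.
move=> K; elim: K G1 G2 => {rm G G'} [rm G' N|rm b m G G' K IH|rm b m G G' N K IH] G1 G2 S.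
- inversion S; subst; exists G', G'; split; try by constructor.
  exact: split_self.
- inversion S; subst; case: (IH _ _ H5) => G1' [G2' [S' K1 K2]].
  exists ((tren rt b, m1) :: G1'), ((tren rt b, m2) :: G2').
  by split; constructor.
- case: (IH _ _ S) => G1' [G2' [S' K1 K2]].
  exists ((b, m) :: G1'), ((b, m) :: G2').
  by split; constructor=> //; case: {IH} m N => // _; constructor.
Qed.

Lemma upr_sh rt a : tren (upr rt) (tsh 1 a) = tsh 1 (tren rt a).
Proof. by rewrite /tsh !tren_ren. Qed.

Lemma ctx_ren_tsh rt rm G G' :
  ctx_ren rt rm G G' -> ctx_ren (upr rt) rm (ctx_tsh G) (ctx_tsh G').
Proof.
elim=> {rm G G'} /= [rm G' N|rm b m G G' K IH|rm b m G G' N K IH]; last by constructor.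
- by constructor; rewrite /no_lin all_map.
- by rewrite -upr_sh; constructor.
Qed.

Lemma tren_inst rt b a : tren rt (tinst b a) = tinst (tren rt b) (tren (upr rt) a).
Proof. by rewrite /tinst tren_sub tsub_ren; congr tsub; fext; case. Qed.

Lemma has_type_ren n G t a n' rt rm G' :
  has_type n G t a -> (forall i, i < n -> rt i < n') -> ctx_ren rt rm G G' ->
  ctx_wf n' G' -> has_type n' G' (mren rt rm t) (tren rt a).
Proof.
move=> T; elim: T n' rt rm G' => {n G t a} /=.
- by move=> n G i a W L n' rt rm G' R K W'; constructor=> //; apply: ctx_ren_lookup K L.
- by move=> n G W N n' rt rm G' R K W'; constructor=> //; apply: ctx_ren_no_lin K N.
- by move=> n G W N n' rt rm G' R K W'; constructor=> //; apply: ctx_ren_no_lin K N.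
- move=> n G a b t T IH n' rt rm G' R K W'; constructor; apply: IH => //.
    by constructor.
  by rewrite /= W' andbT; have [/andP[/= W _] _] := has_type_wf T; apply: twf_ren W _.
- move=> n G G1 G2 a b t u S T1 IH1 T2 IH2 n' rt rm G' R K W'.
  case: (ctx_ren_split K S) => G1' [G2' [S' K1 K2]].
  by have [E1 E2] := split_wf n' S'; apply: (ht_app S'); [apply: IH1|apply: IH2];
    rewrite -?E1 -?E2.
- move=> n G G1 G2 a b t u S T1 IH1 T2 IH2 n' rt rm G' R K W'.
  case: (ctx_ren_split K S) => G1' [G2' [S' K1 K2]].
  by have [E1 E2] := split_wf n' S'; apply: (ht_pair S'); [apply: IH1|apply: IH2];
    rewrite -?E1 -?E2.
- move=> n G a t N T IH n' rt rm G' R K W'; constructor; first exact: ctx_ren_no_lin K N.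
  exact: IH.
- move=> n G a t T IH n' rt rm G' R K W'; constructor; apply: IH.
  + by case=> //= i; apply: R.
  + exact: ctx_ren_tsh.
  + exact: ctx_wf_tsh.
- move=> n G a b t T IH Wb n' rt rm G' R K W'; rewrite tren_inst.
  by constructor; [apply: IH|apply: twf_ren Wb _].
- move=> n G G1 G2 b t u S T1 IH1 T2 IH2 n' rt rm G' R K W'.
  case: (ctx_ren_split K S) => G1' [G2' [S' K1 K2]].
  by have [E1 E2] := split_wf n' S'; apply: (ht_letstar S'); [apply: IH1|apply: IH2];
    rewrite -?E1 -?E2.
- move=> n G G1 G2 a b c t u S T1 IH1 T2 IH2 n' rt rm G' R K W'.
  case: (ctx_ren_split K S) => G1' [G2' [S' K1 K2]].
  have [E1 E2] := split_wf n' S'; apply: (ht_letpair S'); [apply: IH1|apply: IH2] => //;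
    rewrite -?E1 //=; first by do !constructor.
  have [/and3P[/= Wa Wb _] _] := has_type_wf T2.
  by rewrite (twf_ren Wa R) (twf_ren Wb R) -E2.
- move=> n G G1 G2 a b t u S T1 IH1 T2 IH2 n' rt rm G' R K W'.
  case: (ctx_ren_split K S) => G1' [G2' [S' K1 K2]].
  have [E1 E2] := split_wf n' S'; apply: (ht_letbang S'); [apply: IH1|apply: IH2] => //;
    rewrite -?E1 //=; first by do !constructor.
  have [/andP[/= Wa _] _] := has_type_wf T2.
  by rewrite (twf_ren Wa R) -E2.
Qed.

Lemma tren_idP r : (r =1 id) -> tren r =1 id.
Proof.
by move=> E a; rewrite tren_as_sub -[RHS]tsub_id; congr tsub; fext=> i /=; rewrite E.
Qed.

Lemma tsh0 : tsh 0 = id.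
Proof. by fext; apply: tren_idP. Qed.

Lemma tsh_sh j k a : tsh j (tsh k a) = tsh (j + k) a.
Proof. by rewrite /tsh tren_ren; congr tren; fext=> i /=; rewrite addnA. Qed.

Lemma upr_add0 : upr (addn 0) = addn 0.
Proof. by fext; case. Qed.

Lemma ctx_ren_refl G : ctx_ren (addn 0) (addn 0) G G.
Proof.
elim: G => [|[a m] G IH]; first by constructor.
by have := ctx_ren_keep a m IH; rewrite upr_add0 tren_idP.
Qed.

Lemma ctx_ren_skips k rm A G G' : no_lin A -> size A = k -> ctx_ren (addn 0) rm G G' ->
  ctx_ren (addn 0) (addn k \o rm) G (A ++ G').
Proof.
move=> N <- {k} K; elim: A N => [_|[a m] A IH] /=; first exact: K.
by case/andP=> nl /IH; apply: ctx_ren_skip.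
Qed.

Lemma has_type_sh k n A G t a :
  has_type n G t a -> no_lin A -> size A = k -> ctx_wf n A ->
  has_type n (A ++ G) (msh 0 k t) a.
Proof.
move=> Ht N E W; rewrite -[a](tren_idP (r := addn 0)) //.
apply: (has_type_ren Ht) => //; first exact: (ctx_ren_skips N E (ctx_ren_refl G)).
by have [WG _] := has_type_wf Ht; move: W WG; rewrite /ctx_wf all_cat => -> ->.
Qed.

Lemma ctx_ren_to_tsh G : ctx_ren (addn 1) (addn 0) G (ctx_tsh G).
Proof.
elim: G => [|[a m] G IH]; first by constructor.
by have := ctx_ren_keep a m IH; rewrite upr_add0.
Qed.

Lemma has_type_tsh n G t a :
  has_type n G t a -> has_type n.+1 (ctx_tsh G) (msh 1 0 t) (tsh 1 a).
Proof.
move=> T; apply: (has_type_ren T) => //; first exact: ctx_ren_to_tsh.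
by have [W _] := has_type_wf T; apply: ctx_wf_tsh.
Qed.

(* The substituted terms are typed without linear variables, so they may replace linear and
   intuitionistic variables alike and may be duplicated. *)
Inductive ctx_sub (n : nat) (st : nat -> ty) : (nat -> tm) -> ctx -> ctx -> Prop :=
| ctx_sub_nil sm G' : no_lin G' -> ctx_sub n st sm [::] G'
| ctx_sub_keep sm a m G G' :
    ctx_sub n st sm G G' -> ctx_sub n st (mup sm) ((a, m) :: G) ((tsub st a, m) :: G')
| ctx_sub_cons sm u a m G G' :
    has_type n (off G') u (tsub st a) -> ctx_sub n st sm G G' ->
    ctx_sub n st (scons u sm) ((a, m) :: G) G'.

Lemma ctx_sub_no_lin n st sm G G' : ctx_sub n st sm G G' -> no_lin G -> no_lin G'.
Proof.
elim=> //= {sm G G'}; first by move=> sm a m G G' _ IH /andP[-> /IH->].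
by move=> sm u a m G G' _ _ IH /andP[_ /IH->].
Qed.

Lemma split_off_eq G G1 G2 : split_ctx G G1 G2 -> off G1 = off G /\ off G2 = off G.
Proof. by elim=> //= a m m1 m2 {}G {}G1 {}G2 [] _ [-> ->]. Qed.

Lemma ctx_sub_lookup n st sm G G' i a : ctx_sub n st sm G G' -> lookup G i a ->
  ctx_wf n G' -> has_type n G' (sm i) (tsub st a).
Proof.
move=> K; elim: K i a => {sm G G'} [sm G' N|sm b m G G' K IH|sm u b m G G' U K IH] i a L W.
- by inversion L.
- inversion L; subst.
    by do 2!constructor=> //; apply: ctx_sub_no_lin K _.
  case/andP: W => /= Wb W.
  by apply: (has_type_sh (A := [:: (_, _)])) => //=; rewrite ?andbT //; apply: IH.
- inversion L; subst=> /=; last exact: IH.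
  by rewrite -(off_no_lin (ctx_sub_no_lin K _)).
Qed.

Lemma ctx_sub_split n st sm G G' G1 G2 : ctx_sub n st sm G G' -> split_ctx G G1 G2 ->
  exists G1' G2', [/\ split_ctx G' G1' G2', ctx_sub n st sm G1 G1' & ctx_sub n st sm G2 G2'].
Proof.
move=> K; elim: K G1 G2 => {sm G G'} [sm G' N|sm b m G G' K IH|sm u b m G G' U K IH] G1 G2 S.
- inversion S; subst; exists G', G'; split; try by constructor.
  exact: split_self.
- inversion S; subst; case: (IH _ _ H5) => G1' [G2' [S' K1 K2]].
  exists ((tsub st b, m1) :: G1'), ((tsub st b, m2) :: G2').
  by split; constructor.
- inversion S; subst; case: (IH _ _ H5) => G1' [G2' [S' K1 K2]].
  have [E1 E2] := split_off_eq S'.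
  by exists G1', G2'; split=> //; constructor; rewrite ?E1 ?E2.
Qed.

Lemma tsub_up_sh st a : tsub (tup st) (tsh 1 a) = tsh 1 (tsub st a).
Proof. by rewrite /tsh tsub_ren tren_sub. Qed.

Lemma off_tsh G : off (ctx_tsh G) = ctx_tsh (off G).
Proof. by rewrite /off /ctx_tsh -!map_comp. Qed.

Lemma ctx_sub_tsh n st sm G G' : ctx_sub n st sm G G' ->
  ctx_sub n.+1 (tup st) (fun i => msh 1 0 (sm i)) (ctx_tsh G) (ctx_tsh G').
Proof.
elim=> {sm G G'} /= [sm G' N|sm b m G G' K IH|sm u b m G G' U K IH].
- by constructor; rewrite /no_lin all_map.
- rewrite -tsub_up_sh.
  have -> : (fun i => msh 1 0 (mup sm i)) = mup (fun i => msh 1 0 (sm i)).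
    by fext; case=> //= i; rewrite /msh !mren_ren.
  by constructor.
- have -> : (fun i => msh 1 0 (scons u sm i)) =
            scons (msh 1 0 u) (fun i => msh 1 0 (sm i)) by fext; case.
  constructor=> //; rewrite off_tsh tsub_up_sh; exact: has_type_tsh.
Qed.

Lemma tsub_inst s b a : tsub s (tinst b a) = tinst (tsub s b) (tsub (tup s) a).
Proof.
rewrite /tinst !tsub_sub; congr tsub; fext; case=> //= i.
by rewrite /tsh tsub_ren -[LHS]tsub_id.
Qed.

Lemma has_type_sub n G t a n' st sm G' :
  has_type n G t a -> (forall i, i < n -> twf n' (st i)) -> ctx_sub n' st sm G G' ->
  ctx_wf n' G' -> has_type n' G' (msub st sm t) (tsub st a).
Proof.
move=> T; elim: T n' st sm G' => {n G t a} /=.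
- by move=> n G i a W L n' st sm G' R K W'; apply: ctx_sub_lookup K L W'.
- by move=> n G W N n' st sm G' R K W'; constructor=> //; apply: ctx_sub_no_lin K N.
- by move=> n G W N n' st sm G' R K W'; constructor=> //; apply: ctx_sub_no_lin K N.
- move=> n G a b t T IH n' st sm G' R K W'; constructor; apply: IH => //.
    by constructor.
  by rewrite /= W' andbT; have [/andP[/= W _] _] := has_type_wf T; apply: twf_sub W _.
- move=> n G G1 G2 a b t u S T1 IH1 T2 IH2 n' st sm G' R K W'.
  case: (ctx_sub_split K S) => G1' [G2' [S' K1 K2]].
  by have [E1 E2] := split_wf n' S'; apply: (ht_app S'); [apply: IH1|apply: IH2];
    rewrite -?E1 -?E2.
- move=> n G G1 G2 a b t u S T1 IH1 T2 IH2 n' st sm G' R K W'.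
  case: (ctx_sub_split K S) => G1' [G2' [S' K1 K2]].
  by have [E1 E2] := split_wf n' S'; apply: (ht_pair S'); [apply: IH1|apply: IH2];
    rewrite -?E1 -?E2.
- move=> n G a t N T IH n' st sm G' R K W'; constructor; first exact: ctx_sub_no_lin K N.
  exact: IH.
- move=> n G a t T IH n' st sm G' R K W'; constructor; apply: IH.
  + by case=> //= i /R; apply: (twf_sh 1).
  + exact: ctx_sub_tsh.
  + exact: ctx_wf_tsh.
- move=> n G a b t T IH Wb n' st sm G' R K W'; rewrite tsub_inst.
  by constructor; [apply: IH|apply: twf_sub Wb _].
- move=> n G G1 G2 b t u S T1 IH1 T2 IH2 n' st sm G' R K W'.
  case: (ctx_sub_split K S) => G1' [G2' [S' K1 K2]].
  by have [E1 E2] := split_wf n' S'; apply: (ht_letstar S'); [apply: IH1|apply: IH2];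
    rewrite -?E1 -?E2.
- move=> n G G1 G2 a b c t u S T1 IH1 T2 IH2 n' st sm G' R K W'.
  case: (ctx_sub_split K S) => G1' [G2' [S' K1 K2]].
  have [E1 E2] := split_wf n' S'; apply: (ht_letpair S'); [apply: IH1|apply: IH2] => //;
    rewrite -?E1 //=; first by do !constructor.
  have [/and3P[/= Wa Wb _] _] := has_type_wf T2.
  by rewrite (twf_sub Wa R) (twf_sub Wb R) -E2.
- move=> n G G1 G2 a b t u S T1 IH1 T2 IH2 n' st sm G' R K W'.
  case: (ctx_sub_split K S) => G1' [G2' [S' K1 K2]].
  have [E1 E2] := split_wf n' S'; apply: (ht_letbang S'); [apply: IH1|apply: IH2] => //;
    rewrite -?E1 //=; first by do !constructor.
  have [/andP[/= Wa _] _] := has_type_wf T2.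
  by rewrite (twf_sub Wa R) -E2.
Qed.

Lemma ctx_sub_id n G : ctx_sub n TVar Var G G.
Proof.
elim: G => [|[a m] G IH]; first by constructor.
by have := ctx_sub_keep a m IH; rewrite mup_var tsub_id.
Qed.

Lemma has_type_minst n G a m b t u :
  has_type n ((a, m) :: G) t b -> has_type n (off G) u a ->
  has_type n G (minst u t) b.
Proof.
move=> Ht Hu; rewrite -[b]tsub_id; apply: (has_type_sub Ht) => //.
  by constructor; rewrite ?tsub_id //; apply: ctx_sub_id.
by have [/andP[]] := has_type_wf Ht.
Qed.

Lemma tsub_sh b s : tsub (scons b s) \o tsh 1 = tsub s.
Proof. by fext=> a /=; rewrite /tsh tsub_ren. Qed.

Lemma ctx_sub_tinst n b G : ctx_sub n (scons b TVar) Var (ctx_tsh G) G.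
Proof.
elim: G => [|[a m] G IH] /=; first by constructor.
have := ctx_sub_keep (tsh 1 a) m IH.
by rewrite mup_var (congr1 (@^~ a) (tsub_sh b TVar) : tsub _ _ = _) tsub_id.
Qed.

Lemma has_type_mtinst n G b t a :
  has_type n.+1 (ctx_tsh G) t a -> twf n b ->
  has_type n G (mtinst b t) (tinst b a).
Proof.
move=> Ht Wb; apply: (has_type_sub Ht).
- by case.
- exact: ctx_sub_tinst.
- by have [/ctx_wf_untsh] := has_type_wf Ht.
Qed.

Lemma ext_eq_typed n G t u a :
  ext_eq n G t u a -> has_type n G t a /\ has_type n G u a.
Proof.
by elim=> //= {n G t u a}; intros; repeat match goal with
  | H : _ /\ _ |- _ => case: H => ? ? end; split; try (by []); econstructor; eauto.
Qed.

Lemma has_type_app n G a b t u : no_lin G ->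
  has_type n G t (TLolli a b) -> has_type n G u a -> has_type n G (App t u) b.
Proof. by move/split_self; apply: ht_app. Qed.

Lemma has_type_app_inv n G t u b : no_lin G -> has_type n G (App t u) b ->
  exists2 a, has_type n G t (TLolli a b) & has_type n G u a.
Proof.
move=> N Ht; inversion Ht; subst.
by case: (split_no_lin N H1) => ? ?; subst; exists a.
Qed.

Lemma has_type_lam_inv n G a t c : has_type n G (Lam a t) c ->
  exists2 b, c = TLolli a b & has_type n ((a, Lin) :: G) t b.
Proof. by move=> Ht; inversion Ht; subst; exists b. Qed.

Lemma has_type_bang_inv n G t c : has_type n G (Bang t) c ->
  exists2 b, c = TBang b & has_type n G t b.
Proof. by move=> Ht; inversion Ht; subst; exists a. Qed.

Lemma has_type_tlam_inv n G t c : has_type n G (TLam t) c ->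
  exists2 b, c = TPi b & has_type n.+1 (ctx_tsh G) t b.
Proof. by move=> Ht; inversion Ht; subst; exists a. Qed.

Lemma has_type_tapp_inv n G t b c : has_type n G (TApp t b) c ->
  exists a, [/\ c = tinst b a, has_type n G t (TPi a) & twf n b].
Proof. by move=> Ht; inversion Ht; subst; exists a. Qed.

Lemma has_type_letbang_inv n G s t c : no_lin G -> has_type n G (LetBang s t) c ->
  exists2 a, has_type n G s (TBang a) & has_type n ((a, Un) :: G) t c.
Proof.
move=> N Ht; inversion Ht; subst.
by case: (split_no_lin N H1) => ? ?; subst; exists a.
Qed.

(** Beta for -o, Pi and [!], closed only under term formers in positions that bind nothing. Over a
    context without linear variables no genuine splitting occurs, so the typing of the left-hand
    side alone turns a computation into an external equality. *)
Inductive red : tm -> tm -> Prop :=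
| r_lam a t u : red (App (Lam a t) u) (minst u t)
| r_tlam t a : red (TApp (TLam t) a) (mtinst a t)
| r_let u t : red (LetBang (Bang u) t) (minst u t)
| r_appl t t' u : red t t' -> red (App t u) (App t' u)
| r_appr t u u' : red u u' -> red (App t u) (App t u')
| r_tapp t t' a : red t t' -> red (TApp t a) (TApp t' a)
| r_letl s s' t : red s s' -> red (LetBang s t) (LetBang s' t).

Lemma red_ext_eq n G t t' a :
  red t t' -> no_lin G -> has_type n G t a -> ext_eq n G t t' a.
Proof.
move=> R N; elim: R a => {t t'}.
- move=> a t u b Ht; have [c /has_type_lam_inv[b' [? ?] Hb] Hu] := has_type_app_inv N Ht; subst.
  by apply: (ee_ax _ Ht); [constructor|apply: has_type_minst Hb _; rewrite off_no_lin].
- move=> t b a Ht; have [c [? /has_type_tlam_inv[c' [?] Hc] Wb]] := has_type_tapp_inv Ht; subst.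
  by apply: (ee_ax _ Ht); [constructor|apply: has_type_mtinst Hc Wb].
- move=> u t b Ht; have [c /has_type_bang_inv[b' [?] Hb] Hu] := has_type_letbang_inv N Ht; subst.
  by apply: (ee_ax _ Ht); [constructor|apply: has_type_minst Hu _; rewrite off_no_lin].
- move=> t t' u _ IH b Ht; have [c H1 H2] := has_type_app_inv N Ht.
  by apply: (ee_app (split_self N)); [apply: IH H1|constructor].
- move=> t u u' _ IH b Ht; have [c H1 H2] := has_type_app_inv N Ht.
  by apply: (ee_app (split_self N)); [constructor; apply: H1|apply: IH].
- move=> t t' b _ IH c Ht; have [d [-> Hd Wb]] := has_type_tapp_inv Ht.
  by constructor=> //; apply: IH.
- move=> s s' t _ IH b Ht; have [c H1 H2] := has_type_letbang_inv N Ht.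
  by apply: (ee_letbang (split_self N)); [apply: IH H1|constructor].
Qed.

Inductive reds : tm -> tm -> Prop :=
| reds_refl t : reds t t
| reds_step t u v : red t u -> reds u v -> reds t v.

Lemma reds_trans t u v : reds t u -> reds u v -> reds t v.
Proof. by elim=> // {}t {}u w R _ IH /IH; apply: reds_step. Qed.

Lemma reds_appl t t' u : reds t t' -> reds (App t u) (App t' u).
Proof. by elim=> [s|s s' s'' R _]; [constructor|apply/reds_step/r_appl]. Qed.

Lemma reds_appr t u u' : reds u u' -> reds (App t u) (App t u').
Proof. by elim=> [s|s s' s'' R _]; [constructor|apply/reds_step/r_appr]. Qed.

Lemma reds_tapp t t' a : reds t t' -> reds (TApp t a) (TApp t' a).
Proof. by elim=> [s|s s' s'' R _]; [constructor|apply/reds_step/r_tapp]. Qed.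

Lemma reds_ext_eq n G t t' a :
  reds t t' -> no_lin G -> has_type n G t a -> ext_eq n G t t' a.
Proof.
move=> R N; elim: R => {t t'} [t|t u v R _ IH] Ht; first by constructor.
have E := red_ext_eq R N Ht; apply: (ee_trans E); apply: IH.
by have [] := ext_eq_typed E.
Qed.

Lemma lookup_un G i a : onth G i = Some a -> lookup (un G) i a.
Proof.
elim: G i => [|b G IH] [|i] //= => [[->]|E]; constructor=> //.
- exact: no_lin_un.
- exact: IH.
Qed.

Lemma has_type_var n G i a : all (twf n) G -> onth G i = Some a -> has_type n (un G) (Var i) a.
Proof. by move=> W /lookup_un; apply: ht_var; rewrite wf_un. Qed.

Lemma has_type_tapp n G t a b c : has_type n G t (TPi a) -> twf n b ->
  c = tinst b a -> has_type n G (TApp t b) c.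
Proof. by move=> Ht Wb ->; constructor. Qed.

Lemma has_type_bang n G t a : no_lin G -> has_type n G t a -> has_type n G (Bang t) (TBang a).
Proof. exact: ht_bang. Qed.

(** * Well-formed propositions *)

Definition rc_ren (rt rr : nat -> nat) (T T' : rctx) :=
  forall i k a b, onth T i = Some (k, a, b) ->
    onth T' (rr i) = Some (k, tren rt a, tren rt b).

Lemma onth_map A B (f : A -> B) s i : onth (map f s) i = omap f (onth s i).
Proof. by elim: s i => [|x s IH] []. Qed.

Lemma rc_tsh rt rr T T' : rc_ren rt rr T T' ->
  rc_ren (upr rt) rr (rctx_tsh T) (rctx_tsh T').
Proof.
move=> E i k a b; rewrite !onth_map; case Ei: (onth T i) => [[[k' a'] b']|] //=.
by case=> <- <- <-; rewrite (E _ _ _ _ Ei) /= !upr_sh.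
Qed.

Lemma rc_up rt rr T T' k a b : rc_ren rt rr T T' ->
  rc_ren rt (upr rr) ((k, a, b) :: T) ((k, tren rt a, tren rt b) :: T').
Proof. by move=> E [|i] k' a' b' /=; [case=> -> -> ->|apply: E]. Qed.

Lemma all_tsh n G : all (twf n) G -> all (twf n.+1) [seq tsh 1 a | a <- G].
Proof.
by elim: G => //= a G IH /andP[W /IH->]; rewrite andbT; apply: (twf_sh 1).
Qed.

Lemma pwf_rwf_ren :
  (forall p n G T n' rt rm rr G' T', pwf n G T p ->
     (forall i, i < n -> rt i < n') -> ctx_ren rt rm (un G) (un G') ->
     rc_ren rt rr T T' -> all (twf n') G' -> pwf n' G' T' (pren rt rm rr p)) /\
  (forall r n G T n' rt rm rr G' T' a b, rwf n G T r a b ->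
     (forall i, i < n -> rt i < n') -> ctx_ren rt rm (un G) (un G') ->
     rc_ren rt rr T T' -> all (twf n') G' ->
     rwf n' G' T' (rren rt rm rr r) (tren rt a) (tren rt b)).
Proof.
apply: prop_rel_ind => //=.
- move=> a t u n G T n' rt rm rr G' T' [Ht Hu] R K E W.
  by split; [apply: (has_type_ren Ht)|apply: (has_type_ren Hu)]; rewrite ?wf_un.
- move=> r IH t u n G T n' rt rm rr G' T' [a [b [Hr Ht Hu]]] R K E W.
  exists (tren rt a), (tren rt b); split; first exact: IH Hr _ _ _ _.
    by apply: (has_type_ren Ht); rewrite ?wf_un.
  by apply: (has_type_ren Hu); rewrite ?wf_un.
- move=> p IHp q IHq n G T n' rt rm rr G' T' [Hp Hq] R K E W.
  by split; [apply: IHp Hp _ _ _ _|apply: IHq Hq _ _ _ _].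
- move=> p IHp q IHq n G T n' rt rm rr G' T' [Hp Hq] R K E W.
  by split; [apply: IHp Hp _ _ _ _|apply: IHq Hq _ _ _ _].
- move=> p IHp q IHq n G T n' rt rm rr G' T' [Hp Hq] R K E W.
  by split; [apply: IHp Hp _ _ _ _|apply: IHq Hq _ _ _ _].
- move=> p IH n G T n' rt rm rr G' T' Hp R K E W; apply: (IH _ _ _ _ _ _ _ _ _ Hp).
  + by case=> // i; apply: R.
  + by rewrite -!un_tsh; apply: ctx_ren_tsh.
  + exact: rc_tsh.
  + exact: all_tsh.
- move=> p IH n G T n' rt rm rr G' T' Hp R K E W; apply: (IH _ _ _ _ _ _ _ _ _ Hp).
  + by case=> // i; apply: R.
  + by rewrite -!un_tsh; apply: ctx_ren_tsh.
  + exact: rc_tsh.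
  + exact: all_tsh.
- move=> a p IH n G T n' rt rm rr G' T' [Wa Hp] R K E W.
  have Wa' := twf_ren Wa R; split=> //; apply: (IH _ _ _ _ _ _ _ _ _ Hp) => //=.
    exact: ctx_ren_keep.
  by rewrite Wa'.
- move=> a p IH n G T n' rt rm rr G' T' [Wa Hp] R K E W.
  have Wa' := twf_ren Wa R; split=> //; apply: (IH _ _ _ _ _ _ _ _ _ Hp) => //=.
    exact: ctx_ren_keep.
  by rewrite Wa'.
- move=> k a b p IH n G T n' rt rm rr G' T' [Wa Wb Hp] R K E W.
  split; rewrite ?(twf_ren Wa R) ?(twf_ren Wb R) //.
  by apply: (IH _ _ _ _ _ _ _ _ _ Hp) => //; apply: rc_up.
- move=> k a b p IH n G T n' rt rm rr G' T' [Wa Wb Hp] R K E W.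
  split; rewrite ?(twf_ren Wa R) ?(twf_ren Wb R) //.
  by apply: (IH _ _ _ _ _ _ _ _ _ Hp) => //; apply: rc_up.
- move=> i n G T n' rt rm rr G' T' a b [k Ei] R K E W.
  by exists k; apply: E.
- move=> a' b' p IH n G T n' rt rm rr G' T' a b [-> -> Wa Wb Hp] R K E W.
  have Wa' := twf_ren Wa R; have Wb' := twf_ren Wb R.
  split=> //; apply: (IH _ _ _ _ _ _ _ _ _ Hp) => //=; last by rewrite Wa' Wb'.
  by do 2!apply: ctx_ren_keep.
Qed.

Lemma ctx_ren_un_app A G : ctx_ren (addn 0) (addn (size A)) (un G) (un (A ++ G)).
Proof.
rewrite /un map_cat.
by apply: (ctx_ren_skips _ _ (ctx_ren_refl (un G))); [apply: no_lin_un|rewrite size_map].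
Qed.

Lemma rwf_sh k j n G T r a b A U :
  rwf n G T r a b -> size A = k -> size U = j -> all (twf n) (A ++ G) ->
  rwf n (A ++ G) (U ++ T) (rsh 0 k j r) a b.
Proof.
move=> Hr <- <- W; rewrite -[a](tren_idP (r := addn 0)) // -[b](tren_idP (r := addn 0)) //.
apply: pwf_rwf_ren.2 Hr _ _ _ _ => //; first exact: ctx_ren_un_app.
move=> i l c d; rewrite !tren_idP //.
by elim: U => //= s U IH.
Qed.

Lemma pwf_sh k n G T p A : pwf n G T p -> size A = k -> all (twf n) (A ++ G) ->
  pwf n (A ++ G) T (psh 0 k 0 p).
Proof.
move=> Hp <- W.
apply: pwf_rwf_ren.1 Hp _ _ _ _ => //; first exact: ctx_ren_un_app.
by move=> i l c d; rewrite !tren_idP.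
Qed.

Lemma ctx_ren_un_tsh G : ctx_ren (addn 1) (addn 0) (un G) (un [seq tsh 1 a | a <- G]).
Proof. by rewrite -un_tsh; apply: ctx_ren_to_tsh. Qed.

Lemma rwf_tsh n G T r a b : rwf n G T r a b -> all (twf n) G ->
  rwf n.+1 [seq tsh 1 c | c <- G] (rctx_tsh T) (rsh 1 0 0 r) (tsh 1 a) (tsh 1 b).
Proof.
move=> Hr W; apply: pwf_rwf_ren.2 Hr _ _ _ _ => //; first exact: ctx_ren_un_tsh.
  by move=> i l c d E; rewrite onth_map E.
exact: all_tsh.
Qed.

Lemma has_type_ush k n A G t a : has_type n (un G) t a -> size A = k ->
  all (twf n) A -> has_type n (un (A ++ G)) (msh 0 k t) a.
Proof.
move=> Ht E W; rewrite /un map_cat.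
by apply: (has_type_sh Ht); rewrite ?size_map ?wf_un //; apply: no_lin_un.
Qed.

Lemma has_type_utsh n G t a : has_type n (un G) t a ->
  has_type n.+1 (un [seq tsh 1 c | c <- G]) (msh 1 0 t) (tsh 1 a).
Proof. by rewrite -un_tsh; apply: has_type_tsh. Qed.

(** * Relational interpretation of types *)

Arguments un : simpl never.

(** Normal form for syntactic identities: every renaming, shift and instantiation becomes a parallel
    substitution, and nested substitutions are fused. *)
Ltac sub_simp := rewrite /tinst /minst /mtinst /minst2 /pinstT /pinstM /pinstM2 /pinstR /=;
  rewrite /tsh /msh /rsh /psh /TArr;
  repeat (progress (rewrite ?tren_as_sub ?mren_as_sub ?pren_as_sub ?rren_as_sub
    ?tsub_sub ?msub_sub ?psub_sub ?rsub_sub ?addSn ?add0n /=)).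

(** Substitutions applied to the same expression are compared pointwise. Up to seven indices are
    split off by cases before the remaining ones are treated uniformly; a missing substitution on
    one side is read as the identity. *)
Ltac sub_eq :=
  sub_simp;
  first [ reflexivity
  | lazymatch goal with
    | |- @eq (nat -> _) _ _ => fext; sub_eq_nat 7
    | |- tsub _ ?a = tsub _ _ => apply: (f_equal (fun z => tsub z a)); sub_eq
    | |- msub _ _ ?a = msub _ _ _ => apply: (f_equal2 (fun y z => msub y z a)); sub_eq
    | |- psub _ _ _ ?a = psub _ _ _ _ =>
        apply: (f_equal3 (fun x y z => psub x y z a)); sub_eq
    | |- rsub _ _ _ ?a = rsub _ _ _ _ =>
        apply: (f_equal3 (fun x y z => rsub x y z a)); sub_eq
    | |- tsub _ ?a = _ => rewrite -[RHS]tsub_id; apply: (f_equal (fun z => tsub z a)); sub_eq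
    | |- msub _ _ ?a = _ =>
        rewrite -[RHS]msub_id; apply: (f_equal2 (fun y z => msub y z a)); sub_eq
    | |- psub _ _ _ ?a = _ =>
        rewrite -[RHS]psub_id; apply: (f_equal3 (fun x y z => psub x y z a)); sub_eq
    | |- rsub _ _ _ ?a = _ =>
        rewrite -[RHS]rsub_id; apply: (f_equal3 (fun x y z => rsub x y z a)); sub_eq
    | |- _ = tsub _ _ => symmetry; sub_eq
    | |- _ = msub _ _ _ => symmetry; sub_eq
    | |- _ = psub _ _ _ _ => symmetry; sub_eq
    | |- _ = rsub _ _ _ _ => symmetry; sub_eq
    | |- _ => progress f_equal; sub_eq
    end ]
with sub_eq_nat n :=
  first [ solve [let i := fresh in intro i; sub_eq]
        | lazymatch n with S ?m => case; [sub_eq | sub_eq_nat m] end ].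

Lemma rsub_lolli st sm sr a a' b b' r r' :
  rsub st sm sr (rlolli a a' b b' r r') =
  rlolli (tsub st a) (tsub st a') (tsub st b) (tsub st b')
    (rsub st sm sr r) (rsub st sm sr r').
Proof. rewrite /rtens /rbang /rpi /rlolli. sub_eq. Qed.

Lemma rsub_bang st sm sr a a' r :
  rsub st sm sr (rbang a a' r) = rbang (tsub st a) (tsub st a') (rsub st sm sr r).
Proof. rewrite /rtens /rbang /rpi /rlolli. sub_eq. Qed.

Lemma rsub_tens st sm sr a a' b b' r r' :
  rsub st sm sr (rtens a a' b b' r r') =
  rtens (tsub st a) (tsub st a') (tsub st b) (tsub st b')
    (rsub st sm sr r) (rsub st sm sr r').
Proof. rewrite /rtens /rbang /rpi /rlolli. sub_eq. Qed.

Lemma rsub_pi st sm sr a a' r :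
  rsub st sm sr (rpi a a' r) = rpi (tsub (tup st) a) (tsub (tup st) a')
    (rsub (tup (tup st)) (fun i => msh 2 0 (sm i)) (rup (fun i => rsh 2 0 0 (sr i))) r).
Proof. rewrite /rtens /rbang /rpi /rlolli. sub_eq. Qed.

Lemma tyrel_tens s1 s2 e a b : tyrel s1 s2 e (TTens a b) =
  rtens (tsub s1 a) (tsub s2 a) (tsub s1 b) (tsub s2 b) (tyrel s1 s2 e a) (tyrel s1 s2 e b).
Proof. by []. Qed.

Lemma tyrel_lolli s1 s2 e a b : tyrel s1 s2 e (TLolli a b) =
  rlolli (tsub s1 a) (tsub s2 a) (tsub s1 b) (tsub s2 b) (tyrel s1 s2 e a) (tyrel s1 s2 e b).
Proof. by []. Qed.

Lemma tyrel_bang s1 s2 e a : tyrel s1 s2 e (TBang a) =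
  rbang (tsub s1 a) (tsub s2 a) (tyrel s1 s2 e a).
Proof. by []. Qed.

Lemma tyrel_pi s1 s2 e a : tyrel s1 s2 e (TPi a) =
  rpi (tsub (tup s1) a) (tsub (tup s2) a)
    (tyrel (scons (TVar 1) (fun i => tsh 2 (s1 i)))
           (scons (TVar 0) (fun i => tsh 2 (s2 i)))
           (scons (RVar 0) (fun i => rsh 2 0 1 (e i))) a).
Proof. by []. Qed.

Lemma tup_comp st s : tsub (tup st) \o tup s = tup (tsub st \o s).
Proof. fext; case=> // i /=; exact: tsub_up_sh. Qed.

Lemma rsub_tyrel st sm sr s1 s2 e a :
  rsub st sm sr (tyrel s1 s2 e a) =
  tyrel (tsub st \o s1) (tsub st \o s2) (rsub st sm sr \o e) a.
Proof.
elim: a st sm sr s1 s2 e => [i||a IHa b IHb|a IHa b IHb|a IHa|a IHa] st sm sr s1 s2 e.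
- by [].
- by [].
- by rewrite !tyrel_tens rsub_tens IHa IHb !tsub_sub.
- by rewrite !tyrel_lolli rsub_lolli IHa IHb !tsub_sub.
- by rewrite !tyrel_bang rsub_bang IHa !tsub_sub.
- rewrite !tyrel_pi rsub_pi IHa !tsub_sub !tup_comp; congr rpi; congr tyrel.
  + by fext; case=> //= i; sub_eq.
  + by fext; case=> //= i; sub_eq.
  + by fext; case=> //= i; sub_eq.
Qed.

Lemma tyrel_ext k s1 s2 e s1' s2' e' a : twf k a ->
  (forall i, i < k -> [/\ s1 i = s1' i, s2 i = s2' i & e i = e' i]) ->
  tyrel s1 s2 e a = tyrel s1' s2' e' a.
Proof.
elim: a k s1 s2 e s1' s2' e' => [i||a IHa b IHb|a IHa b IHb|a IHa|
    a IHa] k s1 s2 e s1' s2' e' /= W E.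
- by have [] := E _ W.
- by [].
- case/andP: W => Wa Wb; rewrite (IHa _ _ _ _ _ _ _ Wa E) (IHb _ _ _ _ _ _ _ Wb E).
  by congr rtens; apply: tsub_ext; eauto => i /E[].
- case/andP: W => Wa Wb; rewrite (IHa _ _ _ _ _ _ _ Wa E) (IHb _ _ _ _ _ _ _ Wb E).
  by congr rlolli; apply: tsub_ext; eauto => i /E[].
- rewrite (IHa _ _ _ _ _ _ _ W E).
  by congr rbang; apply: tsub_ext; eauto => i /E[].
- congr rpi.
  + by apply: tsub_ext W _; case=> //= i /E[->].
  + by apply: tsub_ext W _; case=> //= i /E[_ ->].
  + by apply: IHa W _; case=> //= i /E[-> -> ->].
Qed.

Lemma tyrel_tren s1 s2 e r a :
  tyrel s1 s2 e (tren r a) = tyrel (s1 \o r) (s2 \o r) (e \o r) a.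
Proof.
elim: a s1 s2 e r => [i||a IHa b IHb|a IHa b IHb|a IHa|a IHa] s1 s2 e r //=.
- by rewrite IHa IHb !tsub_ren.
- by rewrite IHa IHb !tsub_ren.
- by rewrite IHa !tsub_ren.
- rewrite IHa !tsub_ren; congr rpi.
  + by congr tsub; fext; case.
  + by congr tsub; fext; case.
  + by congr tyrel; fext; case.
Qed.

(** The substitution lemma for the relational interpretation, here a syntactic identity. It is what
    allows the interpretation of a type containing an instance of sigma to be read as the
    interpretation of sigma at the component relations. *)
Lemma tyrel_tsub s1 s2 e s a :
  tyrel s1 s2 e (tsub s a) =
  tyrel (tsub s1 \o s) (tsub s2 \o s) (tyrel s1 s2 e \o s) a.
Proof.
elim: a s1 s2 e s => [i||a IHa b IHb|a IHa b IHb|a IHa|a IHa] s1 s2 e s //=.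
- by rewrite IHa IHb !tsub_sub.
- by rewrite IHa IHb !tsub_sub.
- by rewrite IHa !tsub_sub.
- rewrite IHa !tsub_sub !tup_comp; congr rpi.
  congr tyrel; fext; case=> //= i; first by sub_eq.
  + by sub_eq.
  + rewrite /tsh tyrel_tren /rsh rren_as_sub rsub_tyrel; congr tyrel.
    * by fext=> j; sub_eq.
    * by fext=> j; sub_eq.
    * by fext=> j /=; sub_eq.
Qed.

Lemma rwf_lolli n G T a a' b b' r r' :
  twf n a -> twf n a' -> twf n b -> twf n b' -> all (twf n) G ->
  rwf n G T r a a' -> rwf n G T r' b b' ->
  rwf n G T (rlolli a a' b b' r r') (TLolli a b) (TLolli a' b').
Proof.
move=> Wa Wa' Wb Wb' W Hr Hr'; rewrite /rlolli /= Wa Wa' Wb Wb'; split=> //.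
do 4?split=> //.
- exists a, a'; split.
  + by apply: (rwf_sh (A := [:: _; _; _; _]) (U := [::])) => //=;
      rewrite Wa Wa' Wb Wb'.
  + by apply: has_type_var => //=; rewrite Wa Wa' Wb Wb'.
  + by apply: has_type_var => //=; rewrite Wa Wa' Wb Wb'.
- exists b, b'; split.
  + by apply: (rwf_sh (A := [:: _; _; _; _]) (U := [::])) => //=;
      rewrite Wa Wa' Wb Wb'.
  + by apply: (has_type_app (a := a) (no_lin_un _)); apply: has_type_var => //=;
      rewrite Wa Wa' Wb Wb'.
  + by apply: (has_type_app (a := a') (no_lin_un _)); apply: has_type_var => //=;
      rewrite Wa Wa' Wb Wb'.
Qed.

(** This is the position of a component inside the impredicative relations, which open with two type
    variables and a relation variable before any term variable. *)
Lemma rwf_sh2 n G T r a b A U k j c d :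
  rwf n G T r a b -> all (twf n) G -> size A = k -> size U = j -> all (twf n.+2) A ->
  c = tsh 2 a -> d = tsh 2 b ->
  rwf n.+2 (A ++ [seq tsh 1 c | c <- [seq tsh 1 c | c <- G]])
    (U ++ rctx_tsh (rctx_tsh T)) (rsh 2 k j r) c d.
Proof.
move=> Hr W Ek Ej WA -> ->.
have -> : rsh 2 k j r = rsh 0 k j (rsh 1 0 0 (rsh 1 0 0 r)) by sub_eq.
rewrite -[2]/(1 + 1) -!tsh_sh.
apply: rwf_sh => //; last by rewrite all_cat WA; do 2!apply: all_tsh.
by do 2!(apply: rwf_tsh; rewrite ?all_tsh //).
Qed.

Lemma has_type_letpair n G a b c t u :
  has_type n (un G) t (TTens a b) ->
  has_type n ((b, Lin) :: (a, Lin) :: un G) u c -> has_type n (un G) (LetPair t u) c.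
Proof. exact: (ht_letpair (split_self (no_lin_un G))). Qed.

Lemma all_cons (A : Type) (p : pred A) a s : p a -> all p s -> all p (a :: s).
Proof. by move=> /= -> ->. Qed.

Ltac solve_wf :=
  repeat match goal with
  | W : is_true ?x |- is_true ?x => exact: W
  | |- is_true (_ && _) => apply/andP; split
  | |- is_true (all _ (_ :: _)) => apply: all_cons
  | |- is_true (all _ (_ ++ _)) => rewrite all_cat
  | |- is_true (all _ [seq tsh 1 _ | _ <- _]) => apply: all_tsh
  | |- is_true (twf _ (tsh 2 _)) => apply: (twf_sh 2)
  | |- is_true (twf _ (tsh 1 _)) => apply: (twf_sh 1)
  | |- is_true (twf _ (tren (addn 1) _)) => apply: (twf_sh 1)
  | |- is_true (twf _ (tren (addn 2) _)) => apply: (twf_sh 2)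
  | |- is_true (twf _ _) => progress rewrite /=
  end; try done; try (by apply: twf_closed).

Ltac type_app a := apply: (has_type_app (a := a) (no_lin_un _)).
Ltac type_var := apply: has_type_var; [by solve_wf|by rewrite /= /tsh /= ?tren_ren].

Ltac split_triv := repeat first [split; [by []|] | split; [by []|by []|]
  | split; [by []|by []|by []|] | split; [by []|by []|by []|by []|]].

Lemma rwf_bang n G T a a' r :
  twf n a -> twf n a' -> all (twf n) G -> rwf n G T r a a' ->
  rwf n G T (rbang a a' r) (TBang a) (TBang a').
Proof.
move=> Wa Wa' W Hr; rewrite /rbang /= Wa Wa'; split=> //.
have W2 c : twf n c -> twf n.+2 (tsh 2 c) by apply: twf_sh.
rewrite /TArr /= !W2 //; split_triv; split; last first.
  exists (TVar 1), (TVar 0); split; first by exists AdmRel.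
  + by type_app (TBang (tsh 2 a)); type_var.
  + by type_app (TBang (tsh 2 a')); type_var.
split_triv; split.
- exists (tsh 2 a), (tsh 2 a'); split; try by type_var.
  by apply: (rwf_sh2 (A := [:: _; _; _; _; _; _]) (U := [:: _]) Hr) => //; solve_wf.
- exists (TVar 1), (TVar 0); split; first by exists AdmRel.
  + by type_app (TBang (tsh 2 a)); last apply: (has_type_bang (no_lin_un _)); type_var.
  + by type_app (TBang (tsh 2 a')); last apply: (has_type_bang (no_lin_un _)); type_var.
Qed.

Lemma rwf_one n G T : all (twf n) G -> rwf n G T rone TOne TOne.
Proof.
move=> W; rewrite /rone /=; split_triv; split.
  by exists (TVar 1), (TVar 0); split; [exists AdmRel|type_var|type_var].
exists (TVar 1), (TVar 0); split; first by exists AdmRel.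
  by apply: (ht_letstar (split_self (no_lin_un _))); type_var.
by apply: (ht_letstar (split_self (no_lin_un _))); type_var.
Qed.

Lemma has_type_letpair_app n G a b c i j :
  all (twf n) G -> twf n a -> twf n b ->
  onth G i = Some (TTens a b) -> onth G j = Some (TLolli a (TLolli b c)) ->
  has_type n (un G) (LetPair (Var i) (App (App (Var j.+2) (Var 1)) (Var 0))) c.
Proof.
move=> W Wa Wb Ei Ej; apply: has_type_letpair; first exact: has_type_var Ei.
have Wu : ctx_wf n (un G) by rewrite wf_un.
(* The two components of the pair are linear and feed different arguments, so each application needs
   its own split. *)
apply: (ht_app (a := b) (G1 := (b, Off) :: (a, Lin) :: un G)
               (G2 := (b, Lin) :: (a, Off) :: un G)).
- by do 2!(constructor; first by constructor); apply: split_self (no_lin_un G).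
- apply: (ht_app (a := a) (G1 := (b, Off) :: (a, Off) :: un G)
               (G2 := (b, Off) :: (a, Lin) :: un G)).
  + by do 2!(constructor; first by constructor); apply: split_self (no_lin_un G).
  + apply: ht_var; first by rewrite /= Wa Wb.
    by do 2!(constructor=> //); apply: lookup_un.
  + apply: ht_var; first by rewrite /= Wa Wb.
    by do 2!(constructor=> //); apply: no_lin_un.
- apply: ht_var; first by rewrite /= Wa Wb.
  by constructor=> //; apply: no_lin_un.
Qed.

Lemma rwf_tens n G T a a' b b' r r' :
  twf n a -> twf n a' -> twf n b -> twf n b' -> all (twf n) G ->
  rwf n G T r a a' -> rwf n G T r' b b' ->
  rwf n G T (rtens a a' b b' r r') (TTens a b) (TTens a' b').
Proof.
move=> Wa Wa' Wb Wb' W Hr Hr'; rewrite /rtens.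
move E: (rlolli _ _ _ _ _ _) => R; rewrite /= Wa Wa' Wb Wb'; split=> //.
have W2 c : twf n c -> twf n.+2 (tsh 2 c) by apply: twf_sh.
rewrite !W2 //; split_triv; split.
- exists (TLolli (tsh 2 a) (TLolli (tsh 2 b) (TVar 1))),
    (TLolli (tsh 2 a') (TLolli (tsh 2 b') (TVar 0))); split; try by type_var.
  rewrite -E; apply: rwf_lolli; try by solve_wf.
    by apply: (rwf_sh2 (A := [:: _; _; _; _]) (U := [:: _]) Hr) => //; solve_wf.
  apply: rwf_lolli; try by solve_wf.
    by apply: (rwf_sh2 (A := [:: _; _; _; _]) (U := [:: _]) Hr') => //; solve_wf.
  by exists AdmRel.
- exists (TVar 1), (TVar 0); split; first by exists AdmRel.
  + by apply: (has_type_letpair_app (a := tsh 2 a) (b := tsh 2 b)); [solve_wf|solve_wf|solve_wf| |];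
      rewrite /= /tsh /= ?tren_ren.
  + by apply: (has_type_letpair_app (a := tsh 2 a') (b := tsh 2 b'));
      [solve_wf|solve_wf|solve_wf| |];
      rewrite /= /tsh /= ?tren_ren.
Qed.

Lemma rwf_pi n G T a a' r : twf n.+1 a -> twf n.+1 a' -> all (twf n) G ->
  rwf n.+2 [seq tsh 1 c | c <- [seq tsh 1 c | c <- G]]
    ((AdmRel, TVar 1, TVar 0) :: rctx_tsh (rctx_tsh T)) r
    (tsub (scons (TVar 1) (fun i => TVar i.+2)) a)
    (tsub (scons (TVar 0) (fun i => TVar i.+2)) a') ->
  rwf n G T (rpi a a' r) (TPi a) (TPi a').
Proof.
move=> Wa Wa' W Hr; rewrite /rpi /= Wa Wa'; split_triv.
exists (tsub (scons (TVar 1) (fun i => TVar i.+2)) a),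
  (tsub (scons (TVar 0) (fun i => TVar i.+2)) a'); split.
- apply: (rwf_sh (A := [:: _; _]) (U := [::]) Hr) => //; solve_wf.
- apply: (has_type_tapp (a := tren (upr (addn 2)) a)) => //; last by sub_eq.
  apply: has_type_var; first by solve_wf.
  by rewrite /= /tsh /=; congr (Some (TPi _)); sub_eq.
- apply: (has_type_tapp (a := tren (upr (addn 2)) a')) => //; last by sub_eq.
  apply: has_type_var; first by solve_wf.
  by rewrite /= /tsh /=; congr (Some (TPi _)); sub_eq.
Qed.

Lemma rwf_tyrel k n G T s1 s2 e a : twf k a -> all (twf n) G ->
  (forall i, i < k -> [/\ twf n (s1 i), twf n (s2 i) & rwf n G T (e i) (s1 i) (s2 i)]) ->
  rwf n G T (tyrel s1 s2 e a) (tsub s1 a) (tsub s2 a).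
Proof.
have W1 k' n' (s s' : nat -> ty) e' G' T' b : twf k' b ->
  (forall i, i < k' -> [/\ twf n' (s i), twf n' (s' i) & rwf n' G' T' (e' i) (s i) (s' i)]) ->
  twf n' (tsub s b) /\ twf n' (tsub s' b).
  by move=> Wb E; split; apply: twf_sub Wb _ => i /E[].
elim: a k n G T s1 s2 e => [i||a IHa b IHb|a IHa b IHb|a IHa|a IHa] k n G T s1 s2 e W WG E.
- by have [] := E _ W.
- exact: rwf_one.
- rewrite tyrel_tens; case/andP: W => Wa Wb.
  have [A1 A2] := W1 _ _ _ _ _ _ _ _ Wa E; have [B1 B2] := W1 _ _ _ _ _ _ _ _ Wb E.
  by apply: rwf_tens => //; [apply: IHa Wa _ _|apply: IHb Wb _ _].
- rewrite tyrel_lolli; case/andP: W => Wa Wb.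
  have [A1 A2] := W1 _ _ _ _ _ _ _ _ Wa E; have [B1 B2] := W1 _ _ _ _ _ _ _ _ Wb E.
  by apply: rwf_lolli => //; [apply: IHa Wa _ _|apply: IHb Wb _ _].
- rewrite tyrel_bang.
  have [A1 A2] := W1 _ _ _ _ _ _ _ _ W E.
  by apply: rwf_bang => //; apply: IHa W _ _.
- rewrite tyrel_pi; rewrite [twf _ _]/= in W; apply: rwf_pi => //.
  + by apply: twf_sub W _; case=> [|i] // /E[A1 _ _]; rewrite /=; apply: (twf_sh 1).
  + by apply: twf_sub W _; case=> [|i] // /E[_ A2 _]; rewrite /=; apply: (twf_sh 1).
  rewrite !tsub_sub.
  have -> : tsub (scons (TVar 1) (fun i => TVar i.+2)) \o tup s1 =
     scons (TVar 1) (fun i => tsh 2 (s1 i)) by fext; case=> //= i; sub_eq.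
  have -> : tsub (scons (TVar 0) (fun i => TVar i.+2)) \o tup s2 =
     scons (TVar 0) (fun i => tsh 2 (s2 i)) by fext; case=> //= i; sub_eq.
  apply: IHa W _ _; first by solve_wf.
  case=> [_|i /E[A1 A2 Hr]]; first by split=> //; exists AdmRel.
  rewrite /=; split; try by apply: (twf_sh 2).
  by apply: (rwf_sh2 (A := [::]) (U := [:: _]) Hr).
Qed.

(** * Derived rules of LAPL *)

Notation pv := (prov LAPL_par).

(** Typings travel with the equation, because Leibniz replacement demands a well-formed predicate
    and hence the types of the terms placed in it. *)
Record eqv n G T H a t u : Prop := Eqv {
  eqv_l : has_type n (un G) t a;
  eqv_r : has_type n (un G) u a;
  eqv_p : pv n G T H (PEq a t u) }.

Section Congruence.
Variables (n : nat) (G : seq ty) (T : rctx) (H : seq prop).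
Notation eqv := (eqv n G T H).
Notation pr := (pv n G T H).
Notation ht := (has_type n (un G)).

Lemma has_type_ctx t a : ht t a -> all (twf n) G.
Proof. by case/has_type_wf; rewrite wf_un. Qed.

Lemma has_type_twf t a : ht t a -> twf n a.
Proof. by case/has_type_wf. Qed.

Lemma eqv_ext t u a : ext_eq n (un G) t u a -> eqv a t u.
Proof. by move=> E; have [A B] := ext_eq_typed E; split=> //; apply: pr_ext_eq. Qed.

Lemma eqv_refl t a : ht t a -> eqv a t t.
Proof. by move=> A; apply: eqv_ext; apply: ee_refl. Qed.

Lemma eqv_reds t u a : ht t a -> reds t u -> eqv a t u.
Proof. by move=> A R; apply/eqv_ext/(reds_ext_eq R _ A)/no_lin_un. Qed.

Lemma eqv_sym t u a : eqv a t u -> eqv a u t.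
Proof.
case=> A B P; split=> //.
have W := has_type_ctx A; have Wa := has_type_twf A.
have := @pr_eqE _ n G T H a t u (PEq a (Var 0) (msh 0 1 t)) _ P.
have E v : pinstM v (PEq a (Var 0) (msh 0 1 t)) = PEq a v t by sub_eq.
rewrite !E; apply; last by apply/pr_ext_eq/ee_refl.
split; first by type_var.
by apply: (has_type_ush (A := [:: _])) => //=; rewrite Wa.
Qed.

Lemma eqv_trans t u v a : eqv a t u -> eqv a u v -> eqv a t v.
Proof.
case=> A B P [_ C Q]; split=> //.
have W := has_type_ctx A; have Wa := has_type_twf A.
have := @pr_eqE _ n G T H a u v (PEq a (msh 0 1 t) (Var 0)) _ Q.
have E w : pinstM w (PEq a (msh 0 1 t) (Var 0)) = PEq a t w by sub_eq.
rewrite !E; apply=> //.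
split; last by type_var.
by apply: (has_type_ush (A := [:: _])) => //=; rewrite Wa.
Qed.

(** Leibniz replacement with the predicate [minst t c = c]. The marked variable of c is
    intuitionistic, so it may occur any number of times, also under [!]; the congruence rules are
    obtained by choosing c. *)
Lemma eqv_ctx a b c t u : has_type n (un (a :: G)) c b -> eqv a t u ->
  eqv b (minst t c) (minst u c).
Proof.
move=> C [A B P].
have W := has_type_ctx A; have Wa := has_type_twf A.
have M v : ht v a -> ht (minst v c) b.
  by move=> V; apply: (has_type_minst C); rewrite off_un.
split; [exact: M|exact: M|].
have := @pr_eqE _ n G T H a t u (PEq b (msh 0 1 (minst t c)) c) _ P.
have E w : pinstM w (PEq b (msh 0 1 (minst t c)) c) = PEq b (minst t c) (minst w c).
  by rewrite /pinstM /= tsub_id; congr PEq; sub_eq.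
rewrite !E; apply=> //; last by apply/pr_ext_eq/ee_refl/M.
split=> //.
by apply: (has_type_ush (A := [:: _]) (M _ A)) => //=; rewrite Wa.
Qed.

Lemma eqv_appl a b t t' u : eqv (TLolli a b) t t' -> ht u a -> eqv b (App t u) (App t' u).
Proof.
move=> E U; have W := has_type_ctx U; have Wf := has_type_twf (eqv_l E).
have M v : minst v (App (Var 0) (msh 0 1 u)) = App v u by rewrite /minst /=; congr App; sub_eq.
rewrite -!M; apply: eqv_ctx E.
type_app a; first by type_var.
by apply: (has_type_ush (A := [:: _])) => //; solve_wf.
Qed.

Lemma eqv_appr a b t u u' : ht t (TLolli a b) -> eqv a u u' -> eqv b (App t u) (App t u').
Proof.
move=> U E; have W := has_type_ctx U; have Wa := has_type_twf (eqv_l E).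
have M v : minst v (App (msh 0 1 t) (Var 0)) = App t v by rewrite /minst /=; congr App; sub_eq.
rewrite -!M; apply: eqv_ctx E.
type_app a; last by type_var.
by apply: (has_type_ush (A := [:: _])) => //; solve_wf.
Qed.

Lemma eqv_reds2 t u t' u' a : ht t a -> ht u a -> reds t t' -> reds u u' ->
  eqv a t' u' -> eqv a t u.
Proof.
move=> A B R S E.
by apply: eqv_trans (eqv_reds A R) (eqv_trans E (eqv_sym (eqv_reds B S))).
Qed.

Lemma prov_cut p q : pwf n G T p -> pr p -> pv n G T (p :: H) q -> pr q.
Proof. by move=> W P Q; apply: pr_impE P; apply: pr_impI. Qed.

Lemma rel_eqv r a b t t' u u' : rwf n G T r a b -> eqv a t t' -> eqv b u u' ->
  pr (PRel r t u) -> pr (PRel r t' u').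
Proof.
move=> Hr E F P.
have W := has_type_ctx (eqv_l E); have Wa := has_type_twf (eqv_l E);
    have Wb := has_type_twf (eqv_l F).
have P' : pr (PRel r t' u).
  have := @pr_eqE _ n G T H a t t' (PRel (rsh 0 1 0 r) (Var 0) (msh 0 1 u)) _ (eqv_p E).
  have M v : pinstM v (PRel (rsh 0 1 0 r) (Var 0) (msh 0 1 u)) = PRel r v u by sub_eq.
  rewrite !M; apply=> //; exists a, b; split.
  - by apply: (rwf_sh (A := [:: _]) (U := [::])) => //; solve_wf.
  - by type_var.
  - by apply: (has_type_ush (A := [:: _]) (eqv_l F)) => //; solve_wf.
have := @pr_eqE _ n G T H b u u' (PRel (rsh 0 1 0 r) (msh 0 1 t') (Var 0)) _ (eqv_p F).
have M v : pinstM v (PRel (rsh 0 1 0 r) (msh 0 1 t') (Var 0)) = PRel r t' v by sub_eq.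
rewrite !M; apply=> //; exists a, b; split.
- by apply: (rwf_sh (A := [:: _]) (U := [::])) => //; solve_wf.
- by apply: (has_type_ush (A := [:: _]) (eqv_r E)) => //; solve_wf.
- by type_var.
Qed.

Lemma pr_allM2E a b p x y : pr (PAllM a (PAllM b p)) -> ht x a -> ht y b ->
  pr (pinstM2 x y p).
Proof.
move=> P X Y; have := pr_allME P X; rewrite /pinstM /= tsub_id => /pr_allME /(_ Y).
by congr (prov _ _ _ _ _); sub_eq.
Qed.

Lemma rel_lolliE a a' b b' r r' t u x y :
  pr (PRel (rlolli a a' b b' r r') t u) -> ht x a -> ht y a' ->
  pr (PRel r x y) -> pr (PRel r' (App t x) (App u y)).
Proof.
move=> /pr_relE P X Y R; move: P; rewrite /pinstM2 /= !tsub_id => /pr_allM2E /(_ X Y) P.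
have /pr_impE : pr (PImp (PRel r x y) (PRel r' (App t x) (App u y))).
  by move: P; congr (prov _ _ _ _ _); sub_eq.
exact.
Qed.

Lemma rel_lolliI a a' b b' r r' t u :
  twf n b -> twf n b' -> rwf n G T r a a' -> rwf n G T r' b b' ->
  ht t (TLolli a b) -> ht u (TLolli a' b') ->
  pv n (a' :: a :: G) T (PRel (rsh 0 2 0 r) (Var 1) (Var 0) :: [seq psh 0 2 0 h | h <- H])
     (PRel (rsh 0 2 0 r') (App (msh 0 2 t) (Var 1)) (App (msh 0 2 u) (Var 0))) ->
  pr (PRel (rlolli a a' b b' r r') t u).
Proof.
move=> Wb Wb' Hr Hr' A B P; have W := has_type_ctx A.
have /andP[Wa _] := has_type_twf A; have /andP[Wa' _] := has_type_twf B.
apply: pr_relI.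
  by exists (TLolli a b), (TLolli a' b'); split=> //; apply: rwf_lolli.
have -> : pinstM2 t u (PAllM a (PAllM a'
      (PImp (PRel (rsh 0 4 0 r) (Var 1) (Var 0))
            (PRel (rsh 0 4 0 r') (App (Var 3) (Var 1)) (App (Var 2) (Var 0)))))) =
  PAllM a (PAllM a' (PImp (PRel (rsh 0 2 0 r) (Var 1) (Var 0))
     (PRel (rsh 0 2 0 r') (App (msh 0 2 t) (Var 1)) (App (msh 0 2 u) (Var 0))))).
  by sub_eq.
apply: pr_allMI => //; apply: pr_allMI => //; apply: pr_impI.
  exists a, a'; split; try by type_var.
  by apply: (rwf_sh (A := [:: _; _]) (U := [::])) => //; solve_wf.
rewrite -map_comp; move: P; congr (prov _ _ _ _ (_ :: _) _).
by apply: eq_map => p /=; sub_eq.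
Qed.

End Congruence.

(* The quantifier rules shift the hypothesis list: with [prov_cut], storing a derived fact there
   and tracking it by [known] replaces a weakening theorem for [prov]. *)
Definition known n G T H p := List.In p H /\ pwf n G T p.

Lemma In_map (A B : Type) (f : A -> B) x s :
  List.In x s -> List.In (f x) [seq f y | y <- s].
Proof. by elim: s => //= y s IH [->|/IH]; [left|right]. Qed.

Lemma known_allM n G T H p A k : known n G T H p -> size A = k ->
  all (twf n) (A ++ G) ->
  known n (A ++ G) T [seq psh 0 k 0 h | h <- H] (psh 0 k 0 p).
Proof. by case=> I P E W; split; [apply: In_map|apply: pwf_sh]. Qed.

Lemma known_allT n G T H p : known n G T H p -> all (twf n) G ->
  known n.+1 [seq tsh 1 a | a <- G] (rctx_tsh T) [seq psh 1 0 0 h | h <- H] (psh 1 0 0 p).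
Proof.
case=> I P W; split; first exact: In_map.
apply: pwf_rwf_ren.1 P _ _ _ _ => //; first exact: ctx_ren_un_tsh.
  by move=> i l c d E; rewrite onth_map E.
exact: all_tsh.
Qed.

Lemma known_allR n G T H p k a b : known n G T H p -> all (twf n) G ->
  known n G ((k, a, b) :: T) [seq psh 0 0 1 h | h <- H] (psh 0 0 1 p).
Proof.
case=> I P W; split; first exact: In_map.
apply: pwf_rwf_ren.1 P _ _ _ _ => //; first exact: ctx_ren_refl.
by move=> i l c d E; rewrite !tren_idP.
Qed.

Lemma known_cons n G T H p q : known n G T H p -> known n G T (q :: H) p.
Proof. by case=> I P; split=> //; right. Qed.

Lemma known_pr n G T H p : known n G T H p -> pv n G T H p.
Proof. by case=> I P; apply: pr_hyp. Qed.

Lemma known_head n G T H p : pwf n G T p -> known n G T (p :: H) p.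
Proof. by split=> //; left. Qed.

Lemma prov_cast n G T H p q : pv n G T H p -> p = q -> pv n G T H q.
Proof. by move=> P <-. Qed.

Lemma has_type_sh2 n G A k t a : has_type n (un G) t a -> size A = k ->
  all (twf n.+2) A ->
  has_type n.+2 (un (A ++ [seq tsh 1 c | c <- [seq tsh 1 c | c <- G]])) (msh 2 k t) (tsh 2 a).
Proof.
move=> X Ek W; rewrite -[2]/(1 + 1) -tsh_sh.
have -> : msh (1 + 1) k t = msh 0 k (msh 1 0 (msh 1 0 t)) by sub_eq.
by apply: has_type_ush => //; do 2!apply: has_type_utsh.
Qed.

(** * Rules for the relational connectives and extensionality *)

Section Relations.
Variables (n : nat) (G : seq ty) (T : rctx) (H : seq prop).
Notation eqv' := (eqv n G T H).
Notation pr := (pv n G T H).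
Notation ht := (has_type n (un G)).

Lemma rel_bangI a a' r x y : rwf n G T r a a' -> ht x a -> ht y a' ->
  pr (PRel r x y) -> pr (PRel (rbang a a' r) (Bang x) (Bang y)).
Proof.
move=> Hr X Y R; have W := has_type_ctx X; have Wa := has_type_twf X; have Wa' := has_type_twf Y.
have K0 : pwf n G T (PRel r x y) by exists a, a'.
apply: (prov_cut K0 R); have K := known_head H K0.
apply: pr_relI.
  by exists (TBang a), (TBang a'); split; [apply: rwf_bang| |]; rewrite //;
      apply: (has_type_bang (no_lin_un _)).
set p := (X in pinstM2 _ _ X).
have -> : pinstM2 (Bang x) (Bang y) p =
  PAllT (PAllT (PAllR AdmRel (TVar 1) (TVar 0)
      (PAllM (TArr (tsh 2 a) (TVar 1)) (PAllM (TArr (tsh 2 a') (TVar 0))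
        (PImp
          (PAllM (tsh 2 a) (PAllM (tsh 2 a')
            (PImp (PRel (rsh 2 4 1 r) (Var 1) (Var 0))
                  (PRel (RVar 0) (App (Var 3) (Bang (Var 1)))
                                 (App (Var 2) (Bang (Var 0)))))))
          (PRel (RVar 0) (App (Var 1) (Bang (msh 2 2 x))) (App (Var 0) (Bang (msh 2 2 y)))))))))
  by rewrite /p; sub_eq.
do 2!(apply: pr_allTI; have {}K := known_allT K ltac:(by solve_wf)).
apply: pr_allRI => //; have {}K := known_allR AdmRel (TVar 1) (TVar 0) K ltac:(by solve_wf).
apply: pr_allMI; first by rewrite /TArr; solve_wf.
have {}K := known_allM (A := [:: TArr (tsh 2 a) (TVar 1)]) (k :=
    1) K erefl ltac:(by rewrite /TArr; solve_wf).
apply: pr_allMI; first by rewrite /TArr; solve_wf.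
have {}K := known_allM (A := [:: TArr (tsh 2 a') (TVar 0)]) (k :=
    1) K erefl ltac:(by rewrite /TArr; solve_wf).
set P := PAllM _ _.
have WP : pwf n.+2 ([:: TArr (tsh 2 a') (TVar 0)] ++ [:: TArr (tsh 2 a) (TVar 1)] ++ 
   [seq tsh 1 c | c <- [seq tsh 1 c | c <- G]]) ((AdmRel, TVar 1,
       TVar 0) :: rctx_tsh (rctx_tsh T)) P.
  split; first by solve_wf.
  split; first by solve_wf.
  split.
  - exists (tsh 2 a), (tsh 2 a'); split; try by type_var.
    by apply: (rwf_sh2 (A := [:: _; _; _; _]) (U := [:: _]) Hr) => //; rewrite /TArr; solve_wf.
  - exists (TVar 1), (TVar 0); split; first by exists AdmRel.
    + by type_app (TBang (tsh 2 a)); last apply: (has_type_bang (no_lin_un _)); rewrite /TArr;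
        type_var.
    + by type_app (TBang (tsh 2 a')); last apply: (has_type_bang (no_lin_un _)); rewrite /TArr;
        type_var.
apply: pr_impI => //.
have {}K := known_cons P K.
have X2 := has_type_sh2 (k := 2) (A := [:: TArr (tsh 2 a') (TVar 0); TArr (tsh 2 a) (TVar 1)])
  X erefl ltac:(by rewrite /TArr; solve_wf).
have Y2 := has_type_sh2 (k := 2) (A := [:: TArr (tsh 2 a') (TVar 0); TArr (tsh 2 a) (TVar 1)])
  Y erefl ltac:(by rewrite /TArr; solve_wf).
(* The premise of the encoded universal property speaks about all related arguments; here it is used
   at x and y themselves. *)
have Q := pr_allM2E (known_pr (known_head _ WP)) X2 Y2.
set q := pinstM2 _ _ _ in Q.
have E : q = PImp (PRel (rsh 2 2 1 r) (msh 2 2 x) (msh 2 2 y))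
  (PRel (RVar 0) (App (Var 1) (Bang (msh 2 2 x))) (App (Var 0) (Bang (msh 2 2 y)))).
  by rewrite /q; sub_eq.
rewrite E in Q; apply: pr_impE (Q _) _.
by apply: prov_cast (known_pr K) _; sub_eq.
Qed.

Lemma rel_bangE a a' r c d q k k' t u :
  pr (PRel (rbang a a' r) t u) -> isrel LAPL_par n G T AdmRel q c d ->
  twf n c -> twf n d -> ht k (TArr a c) -> ht k' (TArr a' d) ->
  pr (PAllM a (PAllM a' (PImp (PRel (rsh 0 2 0 r) (Var 1) (Var 0))
    (PRel (rsh 0 2 0 q) (App (msh 0 2 k) (Bang (Var 1))) (App (msh 0 2 k') (Bang (Var 0))))))) ->
  pr (PRel q (App k t) (App k' u)).
Proof.
move=> /pr_relE P Q Wc Wd Hk Hk' B.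
have {}P := pr_allTE P Wc; have {P} P := pr_allTE P Wd.
have {P} P : pr (PAllR AdmRel c d (PAllM (TArr a (tsh 0 c)) (PAllM (TArr a' (tsh 0 d))
        (PImp
          (PAllM a (PAllM a'
            (PImp (PRel (rsh 0 4 1 r) (Var 1) (Var 0))
                  (PRel (RVar 0) (App (Var 3) (Bang (Var 1)))
                                 (App (Var 2) (Bang (Var 0)))))))
          (PRel (RVar 0) (App (Var 1) (msh 0 2 t)) (App (Var 0) (msh 0 2 u))))))).
  by apply: prov_cast P _; sub_eq.
have {P} P := pr_allRE P Q.
have {P} P : pr (PAllM (TArr a c) (PAllM (TArr a' d)
        (PImp
          (PAllM a (PAllM a'
            (PImp (PRel (rsh 0 4 0 r) (Var 1) (Var 0))
                  (PRel (rsh 0 4 0 q) (App (Var 3) (Bang (Var 1)))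
                                 (App (Var 2) (Bang (Var 0)))))))
          (PRel (rsh 0 2 0 q) (App (Var 1) (msh 0 2 t)) (App (Var 0) (msh 0 2 u)))))).
  by apply: prov_cast P _; sub_eq.
have {P} P := pr_allM2E P Hk Hk'.
have {P} /pr_impE : pr (PImp (PAllM a (PAllM a' (PImp (PRel (rsh 0 2 0 r) (Var 1) (Var 0))
    (PRel (rsh 0 2 0 q) (App (msh 0 2 k) (Bang (Var 1))) (App (msh 0 2 k') (Bang (Var 0)))))))
   (PRel q (App k t) (App k' u))).
  by apply: prov_cast P _; sub_eq.
exact.
Qed.

Lemma rel_piE a a' r t u c d q :
  pr (PRel (rpi a a' r) t u) -> isrel LAPL_par n G T AdmRel q c d ->
  twf n c -> twf n d ->
  pr (PRel (rsub (scons d (scons c TVar)) Var (scons q RVar) r) (TApp t c) (TApp u d)).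
Proof.
move=> /pr_relE P Q Wc Wd.
have {}P := pr_allTE P Wc; have {P} P := pr_allTE P Wd.
have {P} P : pr (PAllR AdmRel c d
   (PRel (rsub (scons d (scons c TVar)) Var RVar r) (TApp t c) (TApp u d))).
  by apply: prov_cast P _; sub_eq.
have {P} P := pr_allRE P Q.
by apply: prov_cast P _; sub_eq.
Qed.

(** The outcome is again an interpretation, in an environment extended by q, so that successive
    quantifiers can be instantiated one after the other. *)
Lemma tyrel_piE s1 s2 e a t u c d q :
  pr (PRel (tyrel s1 s2 e (TPi a)) t u) -> isrel LAPL_par n G T AdmRel q c d ->
  twf n c -> twf n d ->
  pr (PRel (tyrel (scons c s1) (scons d s2) (scons q e) a) (TApp t c) (TApp u d)).
Proof.
rewrite tyrel_pi => P Q Wc Wd; apply: prov_cast (rel_piE P Q Wc Wd) _.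
rewrite rsub_tyrel; congr (PRel (tyrel _ _ _ _) _ _).
- by fext; case=> // i; sub_eq.
- by fext; case=> // i; sub_eq.
- by fext; case=> // i; sub_eq.
Qed.

Lemma fun_ext a b t u : ht t (TLolli a b) -> ht u (TLolli a b) ->
  pv n (a :: G) T [seq psh 0 1 0 h | h <- H]
    (PEq b (App (msh 0 1 t) (Var 0)) (App (msh 0 1 u) (Var 0))) ->
  eqv' (TLolli a b) t u.
Proof.
move=> A B P; split=> //; have /andP[Wa _] := has_type_twf A.
have X : pr _ := pr_axiom H (or_introl (ext_lolli T A B)).
by apply: pr_impE X _; apply: pr_allMI.
Qed.

Lemma pi_ext a t u : ht t (TPi a) -> ht u (TPi a) ->
  pv n.+1 [seq tsh 1 a | a <- G] (rctx_tsh T) [seq psh 1 0 0 h | h <- H]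
    (PEq a (TApp (msh 1 0 t) (TVar 0)) (TApp (msh 1 0 u) (TVar 0))) ->
  eqv' (TPi a) t u.
Proof.
move=> A B P; split=> //.
have X : pr _ := pr_axiom H (or_introl (ext_pi T A B)).
by apply: pr_impE X _; apply: pr_allTI.
Qed.

End Relations.

(** * Equality relations, graphs and identity extension *)

Lemma psub_RelEquiv st sm sr a b r r' : psub st sm sr (PRelEquiv a b r r') =
  PRelEquiv (tsub st a) (tsub st b) (rsub st sm sr r) (rsub st sm sr r').
Proof. by rewrite /PRelEquiv /PIff; sub_eq. Qed.

Lemma rsub_req st sm sr a : rsub st sm sr (req a) = req (tsub st a).
Proof. by []. Qed.

Lemma rsh_req k j a : rsh 0 k j (req a) = req a.
Proof. by rewrite /rsh rren_as_sub rsub_req; congr req; sub_eq. Qed.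

(* x ~ y iff f x = g y, in the shape produced by [ir_reindex]; it is the graph of f if g is an
   identity, and the opposite of the graph of g if f is one. *)
Definition rcospan a b c f g : Defs.rel :=
  RAbs a b (PRel (rsh 0 2 0 (req c)) (App (msh 0 2 f) (Var 1)) (App (msh 0 2 g) (Var 0))).

Lemma rsh_rcospan k j a b c f g :
  rsh 0 k j (rcospan a b c f g) = rcospan a b c (msh 0 k f) (msh 0 k g).
Proof. by rewrite /rcospan /req; sub_eq. Qed.

Section Graphs.
Variables (n : nat) (G : seq ty) (T : rctx) (H : seq prop).
Notation eqv' := (eqv n G T H).
Notation pr := (pv n G T H).
Notation ht := (has_type n (un G)).

Lemma eqv_bang a t t' : eqv' a t t' -> eqv' (TBang a) (Bang t) (Bang t').
Proof.
move=> E; have W := has_type_ctx (eqv_l E); have Wa := has_type_twf (eqv_l E).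
have M v : minst v (Bang (Var 0)) = Bang v by [].
rewrite -(M t) -(M t'); apply: eqv_ctx E.
by apply: (has_type_bang (no_lin_un _)); type_var.
Qed.

Lemma rwf_req a : twf n a -> all (twf n) G -> rwf n G T (req a) a a.
Proof. by move=> Wa W; split=> //; split; type_var. Qed.

Lemma rel_reqE a x y : pr (PRel (req a) x y) -> pr (PEq a x y).
Proof. by move/pr_relE; rewrite /pinstM2 /= tsub_id. Qed.

Lemma rel_reqI a x y : eqv' a x y -> pr (PRel (req a) x y).
Proof.
case=> A B P; apply: pr_relI; last by rewrite /pinstM2 /= tsub_id.
by exists a, a; split=> //; apply: rwf_req (has_type_twf A) (has_type_ctx A).
Qed.

Lemma requivE a b r r' x y : pr (PRelEquiv a b r r') -> ht x a -> ht y b ->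
  pr (PIff (PRel r x y) (PRel r' x y)).
Proof.
move=> P X Y; apply: prov_cast (pr_allM2E P X Y) _.
by rewrite /PIff; sub_eq.
Qed.

(** The schema instantiated at concrete types. Two type variables cover every use: sigma has two,
    the continuation types have one, and closed types are handled with a constant environment. *)
Lemma idext a s : twf 2 a -> twf n (s 0) -> twf n (s 1) ->
  pr (PRelEquiv (tsub s a) (tsub s a) (tyrel s s (fun i => req (s i)) a) (req (tsub s a))).
Proof.
move=> Wa W0 W1.
have Ax0 : LAPL_par n G T _ := or_intror (id_ext n G T Wa).
set p := PRelEquiv _ _ _ _ in Ax0.
(* The outer quantifier binds variable 1, so [s 1] is instantiated before [s 0]. *)
have P : pr (PAllT (psub (tup (scons (s 1) TVar)) (fun i => msh 1 0 (Var i))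
    (fun i => rsh 1 0 0 (RVar i)) p)) := pr_allTE (pr_axiom H Ax0) W1.
apply: prov_cast (pr_allTE P W0) _.
rewrite /pinstT !psub_RelEquiv !rsub_tyrel !rsub_req !tsub_sub.
have E i : i < 2 -> tsub (scons (s 0) TVar) (tsub (tup (scons (s 1) TVar)) (TVar i)) = s i.
  by case: i => [|[|i]] // _; sub_eq.
have -> : tsub (tsub (scons (s 0) TVar) \o tup (scons (s 1) TVar)) a = tsub s a.
  by apply: tsub_ext Wa _ => i; apply: E.
congr PRelEquiv; apply: tyrel_ext Wa _ => i /E Ei.
by split; rewrite ?rsub_req // /= -[in RHS]Ei.
Qed.

Lemma idextI a s x y : twf 2 a -> twf n (s 0) -> twf n (s 1) ->
  eqv' (tsub s a) x y -> pr (PRel (tyrel s s (fun i => req (s i)) a) x y).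
Proof.
move=> Wa W0 W1 E; have P := requivE (idext Wa W0 W1) (eqv_l E) (eqv_r E).
by apply: pr_impE (pr_andE2 P) _; apply: rel_reqI.
Qed.

Lemma idextE a s x y : twf 2 a -> twf n (s 0) -> twf n (s 1) ->
  ht x (tsub s a) -> ht y (tsub s a) ->
  pr (PRel (tyrel s s (fun i => req (s i)) a) x y) -> eqv' (tsub s a) x y.
Proof.
move=> Wa W0 W1 X Y R; have P := requivE (idext Wa W0 W1) X Y.
by split=> //; apply/rel_reqE/(pr_impE (pr_andE1 P)).
Qed.

Lemma rcospan_isrel a b c f g : twf n c -> ht f (TLolli a c) -> ht g (TLolli b c) ->
  isrel LAPL_par n G T AdmRel (rcospan a b c f g) a b.
Proof. by move=> Wc F F'; apply: ir_reindex F F'; constructor. Qed.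

Lemma rcospan_rwf a b c f g : ht f (TLolli a c) -> ht g (TLolli b c) ->
  rwf n G T (rcospan a b c f g) a b.
Proof.
move=> F F'; have W := has_type_ctx F; have Wf := has_type_twf F; have Wg := has_type_twf F'.
have /andP[Wa Wc] := Wf; have /andP[Wb _] := Wg.
rewrite /rcospan rsh_req; split=> //; exists c, c; split.
- by split=> //; split; type_var.
- type_app a; last by type_var.
  by apply: (has_type_ush (A := [:: _; _]) F) => //; solve_wf.
- type_app b; last by type_var.
  by apply: (has_type_ush (A := [:: _; _]) F') => //; solve_wf.
Qed.

Lemma rcospanE a b c f g x y : pr (PRel (rcospan a b c f g) x y) -> pr (PEq c (App f x) (App g y)).
Proof.
rewrite /rcospan rsh_req => /pr_relE P; apply/rel_reqE.
by apply: prov_cast P _; rewrite /req; sub_eq.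
Qed.

Lemma rcospanI a b c f g x y : ht f (TLolli a c) -> ht g (TLolli b c) -> ht x a -> ht y b ->
  pr (PEq c (App f x) (App g y)) -> pr (PRel (rcospan a b c f g) x y).
Proof.
move=> F F' X Y P; apply: pr_relI.
  by exists a, b; split=> //; apply: rcospan_rwf.
apply: (@prov_cast _ _ _ _ (PRel (req c) (App f x) (App g y))); last by rewrite /req; sub_eq.
apply: rel_reqI; split=> //; first exact: has_type_app (no_lin_un _) F X.
exact: has_type_app (no_lin_un _) F' Y.
Qed.

End Graphs.

Lemma twf_lolliE n a b : twf n (TLolli a b) -> twf n a /\ twf n b.
Proof. by case/andP. Qed.

Section BangExt.
Variables (n : nat) (G : seq ty) (T : rctx) (H : seq prop).
Notation eqv' := (eqv n G T H).
Notation pr := (pv n G T H).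
Notation ht := (has_type n (un G)).

(* By identity extension every x : !a is related to itself, and the relation on !a is generated by
   pairs of promoted terms. *)
Lemma eq_bang_ext a b k k' : ht k (TLolli (TBang a) b) -> ht k' (TLolli (TBang a) b) ->
  pv n (a :: G) T [seq psh 0 1 0 h | h <- H]
    (PEq b (App (msh 0 1 k) (Bang (Var 0))) (App (msh 0 1 k') (Bang (Var 0)))) ->
  eqv' (TLolli (TBang a) b) k k'.
Proof.
move=> A B P; have W := has_type_ctx A; have Wk := has_type_twf A;
    have [Wa Wb] : twf n a /\ twf n b := twf_lolliE Wk.
have {}P := pr_allMI Wa P; set p := PAllM _ _ in P.
have TY A' j c k0 : size A' = j -> all (twf n) A' -> ht k0 c ->
    has_type n (un (A' ++ G)) (msh 0 j k0) c.
  by move=> Ej WA Hk; apply: has_type_ush.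
have Wp : pwf n G T p.
  split=> //; split.
  - by type_app (TBang a); [apply: (TY [:: _])|apply: (has_type_bang (no_lin_un _));
      type_var] => //; solve_wf.
  - by type_app (TBang a); [apply: (TY [:: _])|apply: (has_type_bang (no_lin_un _));
      type_var] => //; solve_wf.
split=> //; apply: (prov_cut Wp P).
have K := known_head H Wp.
apply: eqv_p; apply: fun_ext => //.
have {}K := known_allM (A := [:: TBang a]) (k := 1) K erefl ltac:(by solve_wf).
have V0 : has_type n (un (TBang a :: G)) (Var 0) (TBang a) by type_var.
have R := idextI (s := scons a (scons a TVar)) (a := TBang (TVar 0)) isT Wa Wa
   (eqv_refl T [seq psh 0 1 0 h | h <- p :: H] V0).
rewrite tyrel_bang [tyrel _ _ _ _]/= [tsub _ _]/= in R.
have Q : isrel LAPL_par n (TBang a :: G) T AdmRel (req b) b b by constructor.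
(* Elimination of the relation on [!a] into equality on b leaves only promoted arguments whose
   contents are related by equality on a. *)
apply: rel_reqE; apply: (rel_bangE R Q) => //; try by apply: (TY [:: _]) => //; solve_wf.
apply: pr_allMI => //; have {}K := known_allM (A := [:: a]) (k := 1) K erefl ltac:(by solve_wf).
apply: pr_allMI => //; have {}K := known_allM (A := [:: a]) (k := 1) K erefl ltac:(by solve_wf).
rewrite !rsh_req.
set G' := [:: a, a, TBang a & G].
have WG' : all (twf n) G' by rewrite /G'; solve_wf.
have We : pwf n G' T (PRel (req a) (Var 1) (Var 0)).
  by exists a, a; split; [split=> //; split; type_var|type_var|type_var].
apply: pr_impI => //; have {}K := known_cons (PRel (req a) (Var 1) (Var 0)) K.
move: K; set H' := (X in known _ _ _ X _ -> _); move=> K.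
have E : eqv n G' T H' a (Var 1) (Var 0).
  split; try (by type_var); apply: rel_reqE; apply: pr_hyp => //; by left.
have TK k0 : ht k0 (TLolli (TBang a) b) -> has_type n (un G') (msh 0 3 k0) (TLolli (TBang a) b).
  by apply: (TY [:: _; _; _]) => //; solve_wf.
have E2 := eqv_appr (TK _ B) (eqv_bang E).
have E1 : pv n G' T H' (PEq b (App (msh 0 3 k) (Bang (Var 1))) (App (msh 0 3 k') (Bang (Var 1)))).
  have P1 : pv n G' T H' (PAllM a (PEq b (App (msh 0 4 k) (Bang (Var 0)))
    (App (msh 0 4 k') (Bang (Var 0))))) by apply: prov_cast (known_pr K) _; sub_eq.
  by apply: prov_cast (pr_allME P1 (eqv_l E)) _; sub_eq.
apply: (@prov_cast _ _ _ _ (PRel (req b) (App (msh 0 3 k) (Bang (Var 1))) (App (msh 0 3 k')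
    (Bang (Var 0))))); last first.
  by rewrite /req; sub_eq.
apply: rel_reqI; apply: (eqv_trans _ E2); split=> //; last exact: eqv_l E2.
by type_app (TBang a); [apply: TK|apply: (has_type_bang (no_lin_un _)); type_var].
Qed.
End BangExt.

(** * Action of types on morphisms *)

Definition tensmap a b f g := Lam (TTens a b) (LetPair (Var 0)
  (Pair (App (msh 0 3 f) (Var 1)) (App (msh 0 3 g) (Var 0)))).
Definition lollimap a a' b f g :=
  Lam (TLolli a b) (mcomp a' (mcomp a (msh 0 1 g) (Var 0)) (msh 0 1 f)).
Definition bangmap a f :=
  Lam (TBang a) (LetBang (Var 0) (Bang (App (msh 0 2 f) (Var 0)))).
Definition pimap a f :=
  Lam (TPi a) (TLam (App (msh 0 1 f) (TApp (Var 0) (TVar 0)))).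

Lemma tactE s s' m a : tact s s' m a = if twf 0 a then midt a else
  match a with
  | TVar i => m i
  | TOne => midt TOne
  | TTens a b => tensmap (tsub s a) (tsub s b) (tact s s' m a) (tact s s' m b)
  | TLolli a b => lollimap (tsub s a) (tsub s' a) (tsub s b) (tact s' s m a) (tact s s' m b)
  | TBang a => bangmap (tsub s a) (tact s s' m a)
  | TPi a => pimap (tsub (tup s) a)
      (tact (tup s) (tup s') (scons (midt (TVar 0)) (fun i => msh 1 0 (m i))) a)
  end.
Proof. by case: a. Qed.

Lemma msub_midt st sm a : msub st sm (midt a) = midt (tsub st a).
Proof. by []. Qed.

Lemma tact_sub st sm s s' m a :
  msub st sm (tact s s' m a) =
  tact (tsub st \o s) (tsub st \o s') (msub st sm \o m) a.
Proof.
elim: a st sm s s' m => [i||a IHa b IHb|a IHa b IHb|a IHa|a IHa] st sm s s' m;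
  rewrite (tactE s s' m) (tactE (tsub st \o s) (tsub st \o s') (msub st sm \o m));
      case W: (twf 0 _); rewrite ?msub_midt; try by rewrite ?tsub_closed.
- by rewrite -(IHa st sm s s' m) -(IHb st sm s s' m) /tensmap; sub_eq.
- by rewrite -(IHa st sm s' s m) -(IHb st sm s s' m) /lollimap /mcomp; sub_eq.
- by rewrite -(IHa st sm s s' m) /bangmap; sub_eq.
- rewrite -!tup_comp; 
  have -> : scons (midt (TVar 0)) (fun i => msh 1 0 ((msub st sm \o m) i)) =
    msub (tup st) (fun i => msh 1 0 (sm i)) \o scons (midt (TVar 0)) (fun i => msh 1 0 (m i)).
    by fext; case=> //= i; sub_eq.
  rewrite -(IHa (tup st) (fun i => msh 1 0 (sm i))) .
  rewrite /pimap; sub_eq.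
Qed.

Lemma tact_ext k s s' m t t' m' a : twf k a ->
  (forall i, i < k -> [/\ s i = t i, s' i = t' i & m i = m' i]) ->
  tact s s' m a = tact t t' m' a.
Proof.
elim: a k s s' m t t' m' => [i||a IHa b IHb|a IHa b IHb|a IHa|a IHa] k s s' m t t' m' /= W E.
- by have [_ _ ->] := E _ W.
- by [].
- case: ifP => // _; case/andP: W => Wa Wb.
  have E1 c : twf k c -> tsub s c = tsub t c.
    by move=> Wc; apply: tsub_ext Wc _ => i /E[].
  by rewrite (IHa _ _ _ _ _ _ _ Wa E) (IHb _ _ _ _ _ _ _ Wb E) !E1.
- case: ifP => // _; case/andP: W => Wa Wb.
  have E1 c : twf k c -> tsub s c = tsub t c.
    by move=> Wc; apply: tsub_ext Wc _ => i /E[].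
  have E2 c : twf k c -> tsub s' c = tsub t' c.
    by move=> Wc; apply: tsub_ext Wc _ => i /E[].
  have E' i : i < k -> [/\ s' i = t' i, s i = t i & m i = m' i] by move/E=> [].
  by rewrite (IHa _ _ _ _ _ _ _ Wa E') (IHb _ _ _ _ _ _ _ Wb E) !E1 ?E2.
- case: ifP => // _.
  have E1 c : twf k c -> tsub s c = tsub t c.
    by move=> Wc; apply: tsub_ext Wc _ => i /E[].
  by rewrite (IHa _ _ _ _ _ _ _ W E) !E1.
- case: ifP => // _.
  have E1 c : twf k.+1 c -> tsub (tup s) c = tsub (tup t) c.
    by move=> Wc; apply: tsub_ext Wc _; case=> //= i /E[->].
  rewrite E1 //.
  rewrite (IHa k.+1 _ _ _ (tup t) (tup t') (scons (midt (TVar 0)) (fun i => msh 1 0 (m' i))) W) //.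
  by case=> //= i /E[-> -> ->].
Qed.

Lemma midt_typed n G a : no_lin G -> ctx_wf n G -> twf n a ->
  has_type n G (midt a) (TLolli a a).
Proof.
move=> N W Wa; constructor; constructor; first by rewrite /= Wa.
by constructor.
Qed.

Lemma has_type_app_off n G a b t u :
  has_type n (off G) t (TLolli a b) -> has_type n G u a -> has_type n G (App t u) b.
Proof. exact: ht_app (split_off_r G). Qed.

Lemma mcomp_typed n G Gg Gf a b c g f : split_ctx G Gg Gf -> twf n a ->
  has_type n Gg g (TLolli b c) -> has_type n Gf f (TLolli a b) ->
  has_type n G (mcomp a g f) (TLolli a c).
Proof.
move=> S Wa Hg Hf; constructor.
have Wf : ctx_wf n [:: (a, Off)] by rewrite /= Wa.
apply: (ht_app (G1 := (a, Off) :: Gg) (G2 := (a, Lin) :: Gf)).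
- by constructor=> //; constructor.
- exact: (has_type_sh (A := [:: _]) Hg).
apply: (ht_app (G1 := (a, Off) :: Gf) (G2 := (a, Lin) :: off Gf)).
- by constructor; [constructor|apply: split_off_l].
- exact: (has_type_sh (A := [:: _]) Hf).
constructor; last by constructor=> //; apply: no_lin_off.
rewrite /= Wa /=; have [W _] := has_type_wf Hf.
by rewrite -(split_wf n (split_off_l Gf)).2.
Qed.

Section Maps.
Variables (n : nat) (G : ctx).
Hypothesis (N : no_lin G).

Lemma tensmap_typed a b a' b' f g : has_type n G f (TLolli a a') ->
  has_type n G g (TLolli b b') ->
  has_type n G (tensmap a b f g) (TLolli (TTens a b) (TTens a' b')).
Proof.
move=> F F'; have [W /twf_lolliE[Wa Wa']] := has_type_wf F.
have [_ /twf_lolliE[Wb Wb']] := has_type_wf F'; constructor.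
apply: (ht_letpair (a1 := a) (a2 := b) (G1 := (TTens a b, Lin) :: G)
   (G2 := (TTens a b, Off) :: G)).
- by constructor; [constructor|apply: split_self].
- by constructor; [rewrite /= Wa Wb|constructor].
have WO c : twf n c -> ctx_wf n [:: (b, Off); (a, Off); (TTens a b, Off)].
  by rewrite /= Wa Wb.
apply: (ht_pair (G1 := [:: (b, Off), (a, Lin), (TTens a b, Off) & G])
   (G2 := [:: (b, Lin), (a, Off), (TTens a b, Off) & G])).
- by do 3!(constructor; first by constructor); apply: split_self.
- apply: (@has_type_app_off _ _ a).
    rewrite /= (off_no_lin N).
    exact: (has_type_sh (A := [:: (_, Off); (_, Off); (_, Off)]) F _ _ (WO _ Wa)).
  by constructor; [rewrite /= Wa Wb|do 2!constructor].
- apply: (@has_type_app_off _ _ b).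
    rewrite /= (off_no_lin N).
    exact: (has_type_sh (A := [:: (_, Off); (_, Off); (_, Off)]) F' _ _ (WO _ Wa)).
  by constructor; [rewrite /= Wa Wb|constructor].
Qed.

Lemma lollimap_typed a b a' b' f g : has_type n G f (TLolli a' a) ->
  has_type n G g (TLolli b b') ->
  has_type n G (lollimap a a' b f g) (TLolli (TLolli a b) (TLolli a' b')).
Proof.
move=> F F'; have [W /twf_lolliE[Wa' Wa]] := has_type_wf F.
have [_ /twf_lolliE[Wb Wb']] := has_type_wf F'; constructor.
have WO : ctx_wf n [:: (TLolli a b, Off)] by rewrite /= Wa Wb.
have S m m1 m2 : split_mult m m1 m2 -> split_ctx ((TLolli a b, m) :: G)
    ((TLolli a b, m1) :: G) ((TLolli a b, m2) :: G).
  by move=> M; constructor=> //; apply: split_self.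
apply: (mcomp_typed (b := a) (S _ _ _ sm_left)) => //.
  apply: (mcomp_typed (b := b) (S _ _ _ sm_right)) => //.
    exact: (has_type_sh (A := [:: _]) F').
  by constructor; [rewrite /= Wa Wb|constructor].
exact: (has_type_sh (A := [:: _]) F).
Qed.

Lemma bangmap_typed a a' f : has_type n G f (TLolli a a') ->
  has_type n G (bangmap a f) (TLolli (TBang a) (TBang a')).
Proof.
move=> F; have [W /twf_lolliE[Wa Wa']] := has_type_wf F; constructor.
apply: (ht_letbang (a := a) (G1 := (TBang a, Lin) :: G) (G2 := (TBang a, Off) :: G)).
- by constructor; [constructor|apply: split_self].
- by constructor; [rewrite /= Wa|constructor].
constructor=> //; apply: has_type_app => //; first apply: (has_type_sh (A := [:: _; _]) F) => //.
  by rewrite /= Wa.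
by constructor; [rewrite /= Wa|constructor].
Qed.

Lemma pimap_typed a a' f : has_type n.+1 (ctx_tsh G) f (TLolli a a') ->
  has_type n G (pimap a f) (TLolli (TPi a) (TPi a')).
Proof.
move=> F; have [W /twf_lolliE[Wa Wa']] := has_type_wf F; constructor; constructor.
have N' : no_lin (ctx_tsh G) by rewrite /no_lin all_map.
have WP : twf n.+1 (tsh 1 (TPi a)) by apply: (twf_sh 1).
rewrite /=; apply: (@has_type_app_off _ _ a).
  rewrite /= (off_no_lin N').
  by apply: (has_type_sh (A := [:: (_, Off)]) F) => //; rewrite /= andbT.
apply: (has_type_tapp (a := tren (upr (addn 1)) a)) => //; last by sub_eq.
apply: ht_var; last exact: (@lookup0 (tsh 1 (TPi a)) Lin _ isT N').
by apply/andP; split; [apply: WP|case/has_type_wf: F].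
Qed.

End Maps.

(** Each [m i] has to be typed only in the directions in which i actually occurs. In the argument of
    -o the two environments trade places, and with them the two polarity hypotheses. *)
Lemma tact_typed k n G s s' m a : no_lin G -> ctx_wf n G -> twf k a ->
  (forall i, i < k -> twf n (s i) /\ twf n (s' i)) ->
  (forall i, i < k -> occurs true i a -> has_type n G (m i) (TLolli (s i) (s' i))) ->
  (forall i, i < k -> occurs false i a -> has_type n G (m i) (TLolli (s' i) (s i))) ->
  has_type n G (tact s s' m a) (TLolli (tsub s a) (tsub s' a)).
Proof.
elim: a k n G s s' m => [i||a IHa b IHb|a IHa b IHb|a IHa|a IHa] k n G s s' m N W Wk E P Q;
  rewrite tactE; case W0: (twf 0 _); try by (rewrite ?tsub_closed //;
    apply: midt_typed => //; apply: twf_closed).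
- by apply: P => //=; rewrite eqxx.
- case/andP: Wk => Wa Wb; apply: tensmap_typed => //.
    by apply: (IHa k) => // i ik O; [apply: P|apply: Q] => //=; rewrite O.
  by apply: (IHb k) => // i ik O; [apply: P|apply: Q] => //=; rewrite O orbT.
- case/andP: Wk => Wa Wb; apply: lollimap_typed => //.
    apply: (IHa k) => //.
    + by move=> i /E[].
    + by move=> i ik O; apply: Q => //=; rewrite O.
    + by move=> i ik O; apply: P => //=; rewrite O.
  by apply: (IHb k) => // i ik O; [apply: P|apply: Q] => //=; rewrite O orbT.
- by apply: bangmap_typed => //; apply: (IHa k).
- apply: pimap_typed => //; apply: (IHa k.+1) => //.
  + by rewrite /no_lin all_map.
  + exact: ctx_wf_tsh.
  + by case=> // i /E[A B]; split; apply: (twf_sh 1).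
  + case=> [|i] ik O /=; last by apply: (has_type_tsh (a := TLolli _ _)); apply: P.
    by apply: midt_typed => //; [rewrite /no_lin all_map|apply: ctx_wf_tsh].
  + case=> [|i] ik O /=; last by apply: (has_type_tsh (a := TLolli _ _)); apply: Q.
    by apply: midt_typed => //; [rewrite /no_lin all_map|apply: ctx_wf_tsh].
Qed.

Lemma reds_eq t u : t = u -> reds t u.
Proof. by move->; constructor. Qed.

Ltac red_head := first [ apply: r_lam | apply: r_tlam | apply: r_let
  | apply: r_appl; red_head | apply: r_tapp; red_head | apply: r_letl; red_head
  | apply: r_appr; red_head ].
Ltac red_step := apply: reds_step; [red_head|]; rewrite /minst /mtinst /=.

Lemma tact_sh k s a : msh 0 k (tact s s (fun i => midt (s i)) a) =
  tact s s (fun i => midt (s i)) a.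
Proof.
have I c : tsub (TVar \o addn 0) c = c by sub_eq.
have F (f : nat -> ty) : tsub (TVar \o addn 0) \o f = f by fext=> i /=; apply: I.
rewrite /msh mren_as_sub tact_sub !F; congr tact.
by fext=> i; rewrite /comp msub_midt I.
Qed.

Lemma msh_midt k a : msh 0 k (midt a) = midt a.
Proof. by rewrite /midt; sub_eq. Qed.

Lemma has_type_midt n G a : all (twf n) G -> twf n a -> has_type n (un G) (midt a) (TLolli a a).
Proof. by move=> W; apply: midt_typed; [apply: no_lin_un|rewrite wf_un]. Qed.

Lemma tact_id_typed n G k s a : all (twf n) G -> twf k a -> (forall i, i < k -> twf n (s i)) ->
  has_type n (un G) (tact s s (fun i => midt (s i)) a) (TLolli (tsub s a) (tsub s a)).
Proof.
move=> W Wk E; apply: (tact_typed (k := k)) => //; rewrite ?wf_un //.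
- exact: no_lin_un.
- by move=> i /E.
- by move=> i /E Wi _; apply: has_type_midt.
- by move=> i /E Wi _; apply: has_type_midt.
Qed.

(** * Preservation of identities by the action *)

Section Identities.
Variables (n : nat) (G : seq ty) (T : rctx) (H : seq prop).
Notation eqv' := (eqv n G T H).
Notation ht := (has_type n (un G)).

Lemma tensmap_id a b f g : eqv' (TLolli a a) f (midt a) -> eqv' (TLolli b b) g (midt b) ->
  eqv' (TLolli (TTens a b) (TTens a b)) (tensmap a b f g) (midt (TTens a b)).
Proof.
move=> F F'; have W := has_type_ctx (eqv_l F).
have [Wa _] := twf_lolliE (has_type_twf (eqv_l F));
    have [Wb _] := twf_lolliE (has_type_twf (eqv_l F')).
have E1 : eqv' (TLolli (TTens a b) (TTens a b)) (tensmap a b f g) (tensmap a b (midt a) g).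
  have M v : minst v (tensmap a b (Var 0) (msh 0 1 g)) = tensmap a b v g.
    by rewrite /tensmap; sub_eq.
  rewrite -(M f) -(M (midt a)); apply: eqv_ctx F.
  apply: tensmap_typed; [exact: no_lin_un|by type_var|].
  by apply: (has_type_ush (A := [:: _]) (eqv_l F')) => //; solve_wf.
apply: (eqv_trans E1).
have E2 : eqv' (TLolli (TTens a b) (TTens a b)) (tensmap a b (midt a) g)
    (tensmap a b (midt a) (midt b)).
  have M v : minst v (tensmap a b (midt a) (Var 0)) = tensmap a b (midt a) v.
    by rewrite /tensmap; sub_eq.
  rewrite -(M g) -(M (midt b)); apply: eqv_ctx F'.
  apply: tensmap_typed; [exact: no_lin_un| |by type_var].
  by apply: has_type_midt => //; solve_wf.
(* With identities as components the claim is external: beta in both components, then eta for the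
   tensor. The beta steps lie under a [let], out of reach of [red], so the congruence rules of
   [ext_eq] are used directly. *)
apply: (eqv_trans E2); apply: eqv_ext.
have WO G' : ctx_wf n G' -> ctx_wf n [:: (b, Lin), (a, Lin), (TTens a b, Off) & G'].
  by rewrite /= Wa Wb.
have B c G' i : has_type n G' (Var i) c ->
    ext_eq n G' (App (midt c) (Var i)) (Var i) c.
  move=> V; have [W' Wc] := has_type_wf V.
  apply: (ee_ax (ea_beta_lam _ _ _)) => //.
  apply: (@has_type_app_off _ _ c) => //; apply: midt_typed => //; first exact: no_lin_off.
  by rewrite -(split_wf n (split_off_l G')).2.
have N := no_lin_un G.
have V x y m1 m2 m3 i c : lookup [:: (b, m1), (a, m2), (TTens a b, m3) & un G] i c ->
   x = (un G) -> y = c -> has_type n [:: (b, m1), (a, m2), (TTens a b, m3) & x] (Var i) y.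
  by move=> L -> ->; apply: ht_var L; rewrite /= Wa Wb wf_un.
have S1 : split_ctx ((TTens a b, Lin) :: un G) ((TTens a b, Lin) :: un G)
    ((TTens a b, Off) :: un G).
  by constructor; [constructor|apply: split_self].
have V0 : has_type n ((TTens a b, Lin) :: un G) (Var 0) (TTens a b).
  by apply: ht_var; [rewrite /= Wa Wb wf_un|constructor].
have S2 : split_ctx [:: (b, Lin), (a, Lin), (TTens a b, Off) & un G]
   [:: (b, Off), (a, Lin), (TTens a b, Off) & un G]
   [:: (b, Lin), (a, Off), (TTens a b, Off) & un G].
  by do 3!(constructor; first by constructor); apply: split_self.
rewrite /tensmap !msh_midt.
apply: ee_lam; apply: (ee_trans (u := LetPair (Var 0) (Pair (Var 1) (Var 0)))).
  apply: (ee_letpair (a1 := a) (a2 := b) S1); first exact: ee_refl.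
  apply: (ee_pair S2).
    by apply: B; apply: V => //; do 2!constructor.
  by apply: B; apply: V => //; constructor.
apply: (ee_ax (ea_eta_pair _)) => //.
apply: (ht_letpair (a1 := a) (a2 := b) S1) => //; apply: (ht_pair S2).
  by apply: V => //; do 2!constructor.
by apply: V => //; constructor.
Qed.

Lemma bangmap_id a f : eqv' (TLolli a a) f (midt a) ->
  eqv' (TLolli (TBang a) (TBang a)) (bangmap a f) (midt (TBang a)).
Proof.
move=> F; have W := has_type_ctx (eqv_l F); have [Wa _] := twf_lolliE (has_type_twf (eqv_l F)).
have E1 : eqv' (TLolli (TBang a) (TBang a)) (bangmap a f) (bangmap a (midt a)).
  have M v : minst v (bangmap a (Var 0)) = bangmap a v by rewrite /bangmap; sub_eq.
  rewrite -(M f) -(M (midt a)); apply: eqv_ctx F.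
  by apply: bangmap_typed; [exact: no_lin_un|type_var].
apply: (eqv_trans E1); apply: eqv_ext.
have N := no_lin_un G.
have S1 : split_ctx ((TBang a, Lin) :: un G) ((TBang a, Lin) :: un G)
    ((TBang a, Off) :: un G).
  by constructor; [constructor|apply: split_self].
have V0 : has_type n ((TBang a, Lin) :: un G) (Var 0) (TBang a).
  by apply: ht_var; [rewrite /= Wa wf_un|constructor].
have V1 : has_type n [:: (a, Un), (TBang a, Off) & un G] (Var 0) a.
  by apply: ht_var; [rewrite /= Wa wf_un|constructor].
rewrite /bangmap !msh_midt.
apply: ee_lam; apply: (ee_trans (u := LetBang (Var 0) (Bang (Var 0)))).
  apply: (ee_letbang (a := a) S1); first exact: ee_refl.
  apply: ee_bang => //; apply: (ee_ax (ea_beta_lam _ _ _)) => //.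
  by apply: has_type_app V1 => //; apply: midt_typed => //; rewrite /= Wa wf_un.
apply: (ee_ax (ea_eta_bang _)) => //.
by apply: (ht_letbang (a := a) S1) => //; constructor.
Qed.

Lemma lollimap_id a b f g : eqv' (TLolli a a) f (midt a) -> eqv' (TLolli b b) g (midt b) ->
  eqv' (TLolli (TLolli a b) (TLolli a b)) (lollimap a a b f g) (midt (TLolli a b)).
Proof.
move=> F F'; have W := has_type_ctx (eqv_l F).
have [Wa _] := twf_lolliE (has_type_twf (eqv_l F));
    have [Wb _] := twf_lolliE (has_type_twf (eqv_l F')).
have N := no_lin_un G; set L := TLolli a b.
have WL : twf n L by rewrite /L; solve_wf.
have E1 : eqv' (TLolli L L) (lollimap a a b f g) (lollimap a a b (midt a) g).
  have M v : minst v (lollimap a a b (Var 0) (msh 0 1 g)) = lollimap a a b v g.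
    by rewrite /lollimap /mcomp; sub_eq.
  rewrite -(M f) -(M (midt a)); apply: eqv_ctx F.
  apply: lollimap_typed; [exact: no_lin_un|by type_var|].
  by apply: (has_type_ush (A := [:: _]) (eqv_l F')) => //; solve_wf.
apply: (eqv_trans E1).
have E2 : eqv' (TLolli L L) (lollimap a a b (midt a) g) (lollimap a a b (midt a) (midt b)).
  have M v : minst v (lollimap a a b (midt a) (Var 0)) = lollimap a a b (midt a) v.
    by rewrite /lollimap /mcomp; sub_eq.
  rewrite -(M g) -(M (midt b)); apply: eqv_ctx F'.
  apply: lollimap_typed; [exact: no_lin_un| |by type_var].
  by apply: has_type_midt => //; solve_wf.
apply: (eqv_trans E2).
apply: fun_ext; [exact: eqv_r E2|exact: has_type_midt|].
have WG1 : all (twf n) (L :: G) by solve_wf.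
have T1 : has_type n (un (L :: G)) (msh 0 1 (lollimap a a b (midt a) (midt b))) (TLolli L L).
  by apply: (has_type_ush (A := [:: _]) (eqv_r E2)) => //; solve_wf.
have T2 : has_type n (un (L :: G)) (msh 0 1 (midt L)) (TLolli L L).
  by apply: (has_type_ush (A := [:: _])) => //; [apply: has_type_midt|solve_wf].
have V : has_type n (un (L :: G)) (Var 0) L by type_var.
have A1 := has_type_app (no_lin_un _) T1 V; have A2 := has_type_app (no_lin_un _) T2 V.
apply: eqv_p; apply: fun_ext => //.
have T1' := has_type_ush (A := [:: a]) (k := 1) A1 erefl ltac:(by solve_wf).
have T2' := has_type_ush (A := [:: a]) (k := 1) A2 erefl ltac:(by solve_wf).
have V' : has_type n (un (a :: L :: G)) (Var 0) a by type_var.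
apply: eqv_p.
have A1' := has_type_app (no_lin_un _) T1' V'; have A2' := has_type_app (no_lin_un _) T2' V'.
apply: (eqv_reds2 A1' A2' (t' := App (Var 1) (Var 0)) (u' := App (Var 1) (Var 0))).
- rewrite /lollimap /mcomp /midt /msh /=.
  by do 5!red_step; apply: reds_refl.
- by rewrite /midt /msh /=; red_step; apply: reds_refl.
- by apply: eqv_refl; type_app a; type_var.
Qed.
End Identities.

(** Induction on the type, each constructor using its eta law or extensionality. The context and the
    hypotheses are generalised because the Pi case works under a fresh type variable. *)
Lemma tact_id n G T H k s a : all (twf n) G -> twf k a -> (forall i, i < k -> twf n (s i)) ->
  eqv n G T H (TLolli (tsub s a) (tsub s a)) (tact s s (fun i => midt (s i)) a) (midt (tsub s a)).
Proof.
elim: a n G T H k s => [i||a IHa b IHb|a IHa b IHb|a IHa|a IHa] n G T H k s W Wk E;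
  have TY := tact_id_typed W Wk E;
  rewrite tactE in TY *; case W0: (twf 0 _) in TY *;
  try by (rewrite (tsub_closed s W0) in TY *; apply: eqv_refl).
- exact: eqv_refl.
- exact: eqv_refl.
- by case/andP: Wk => Wa Wb; apply: tensmap_id; [apply: IHa Wa E|apply: IHb Wb E].
- by case/andP: Wk => Wa Wb; apply: lollimap_id; [apply: IHa Wa E|apply: IHb Wb E].
- by apply: bangmap_id; apply: IHa Wk E.
(* The bound type variable is acted on by the identity, so the extended family of morphisms is again
   a family of identities and the induction hypothesis applies. *)
have MM : scons (midt (TVar 0)) (fun i => msh 1 0 (midt (s i))) = fun i => midt (tup s i).
  by fext; case.
rewrite MM in TY *.
set P := TPi (tsub (tup s) a) in TY *.
have WP : twf n P by have [] := twf_lolliE (has_type_twf TY).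
apply: fun_ext => //; first exact: has_type_midt.
have WG : all (twf n) (P :: G) by apply: all_cons.
have WPl : all (twf n) [:: P] by apply: all_cons.
have T1 := has_type_ush (A := [:: P]) (k := 1) TY erefl WPl.
have T2 := has_type_ush (A := [:: P]) (k := 1) (has_type_midt W WP) erefl WPl.
have V : has_type n (un (P :: G)) (Var 0) P by type_var.
have A1 := has_type_app (no_lin_un _) T1 V; have A2 := has_type_app (no_lin_un _) T2 V.
apply: eqv_p; apply: pi_ext => //.
have eqP : tsub (tup s) a = tinst (TVar 0) (tren (upr (addn 1)) (tsub (tup s) a)) by sub_eq.
have B1 := has_type_tapp (a := tren (upr (addn 1)) (tsub (tup s) a)) (has_type_utsh A1) (b :=
    TVar 0) isT eqP.
have B2 := has_type_tapp (a := tren (upr (addn 1)) (tsub (tup s) a)) (has_type_utsh A2) (b :=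
    TVar 0) isT eqP.
apply: eqv_p; set t0 := tact _ _ _ _ in TY T1 A1 B1 *.
have V2 : has_type n.+1 (un [seq tsh 1 a | a <- P :: G]) (TApp (Var 0) (TVar 0)) (tsub (tup s) a).
  by apply: (has_type_tapp (a := tren (upr (addn 1)) (tsub (tup s) a))); [type_var|by []|sub_eq].
apply: (eqv_reds2 B1 B2 (t' := App t0 (TApp (Var 0) (TVar 0)))
   (u' := TApp (Var 0) (TVar 0))).
- rewrite /pimap /midt /msh /=.
  do 2!red_step; apply: reds_eq; congr App; rewrite -[RHS](tact_sh 1 (tup s) a) -/t0.
  by move: (t0) => t; sub_eq.
- by rewrite /midt /msh /=; red_step; apply: reds_refl.
- have WG1 : all (twf n.+1) [seq tsh 1 a | a <- P :: G] by apply: all_tsh.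
  have I := IHa n.+1 [seq tsh 1 a | a <- P :: G] (rctx_tsh T) [seq psh 1 0 0 h |
      h <- [seq psh 0 1 0 h | h <- H]] k.+1 (tup s) WG1 Wk.
  apply: (eqv_trans (eqv_appl (I _) V2)).
    by case=> // i /E; apply: (twf_sh 1).
  apply: eqv_reds; last by rewrite /midt; red_step; apply: reds_refl.
  apply: (has_type_app (no_lin_un _)) V2; apply: has_type_midt => //.
Qed.

(** * Graph lemma *)

Section Graph.
Variable (sigma : ty).
Hypotheses (hwf : twf 2 sigma) (hneg : only_negative 0 sigma) (hpos : only_positive 1 sigma).

Notation Sg := (ty2 sigma).
Notation fm := (fmap2 sigma).

Lemma ty2_sub st a b : tsub st (Sg a b) = Sg (tsub st a) (tsub st b).
Proof. by rewrite /ty2 tsub_sub; apply: tsub_ext hwf _; case=> [|[|i]]. Qed.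

Lemma ty2_ren r a b : tren r (Sg a b) = Sg (tren r a) (tren r b).
Proof. by rewrite !tren_as_sub ty2_sub. Qed.

Lemma twf_ty2 n a b : twf n a -> twf n b -> twf n (Sg a b).
Proof. by move=> Wa Wb; apply: twf_sub hwf _; case=> [|[|i]]. Qed.

Lemma fmap2_sub st sm a b a' b' f g : msub st sm (fm a b a' b' f g) =
  fm (tsub st a) (tsub st b) (tsub st a') (tsub st b') (msub st sm f) (msub st sm g).
Proof. by rewrite /fmap2 tact_sub; apply: tact_ext hwf _; case=> [|[|i]]. Qed.

Lemma fmap2_ren rt rm a b a' b' f g : mren rt rm (fm a b a' b' f g) =
  fm (tren rt a) (tren rt b) (tren rt a') (tren rt b') (mren rt rm f) (mren rt rm g).
Proof. by rewrite !mren_as_sub fmap2_sub !tren_as_sub. Qed.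

Lemma fmap2_typed n G a b a' b' f g : no_lin G ->
  has_type n G f (TLolli a' a) -> has_type n G g (TLolli b b') ->
  has_type n G (fm a b a' b' f g) (TLolli (Sg a b) (Sg a' b')).
Proof.
move=> N F F'; have [W /twf_lolliE[Wa' Wa]] := has_type_wf F.
have [_ /twf_lolliE[Wb Wb']] := has_type_wf F'.
apply: (tact_typed (k := 2)) => //.
- by case=> [|[|i]].
- by case=> [|[|i]] // _ O; move: hneg; rewrite /only_negative O.
- by case=> [|[|i]] // _ O; move: hpos; rewrite /only_positive O.
Qed.

Lemma fmap2_id n G T H a b : all (twf n) G -> twf n a -> twf n b ->
  eqv n G T H (TLolli (Sg a b) (Sg a b)) (fm a b a b (midt a) (midt b)) (midt (Sg a b)).
Proof.
move=> W Wa Wb.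
have -> : fm a b a b (midt a) (midt b) =
    tact (env2 a b) (env2 a b) (fun i => midt (env2 a b i)) sigma.
  by apply: tact_ext hwf _; case=> [|[|i]].
by apply: (@tact_id n G T H 2 (env2 a b) sigma) => //; case=> [|[|i]].
Qed.

Definition sigma_rel a0 b0 a1 b1 r0 r1 :=
  tyrel (env2 a0 b0) (env2 a1 b1) (scons r0 (scons r1 RVar)) sigma.

(* The action of sigma as a closed polymorphic term: parametricity of this one term gives both
   inclusions of the graph lemma, with no induction on sigma beyond [tact_id]. *)
Definition poly_fmap_dom1 := TBang (TLolli (TVar 1) (TVar 3)).
Definition poly_fmap_dom2 := TBang (TLolli (TVar 2) (TVar 0)).
(** Variables 3, 2, 1, 0 stand for a, b, a', b'. The two morphisms are passed under [!] because the
    action may use each of them any number of times. *)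
Definition poly_fmap_type : ty :=
  TPi (TPi (TPi (TPi (TLolli poly_fmap_dom1 (TLolli poly_fmap_dom2
    (TLolli (Sg (TVar 3) (TVar 2)) (Sg (TVar 1) (TVar 0)))))))).
Definition poly_fmap : tm :=
  TLam (TLam (TLam (TLam (Lam poly_fmap_dom1 (LetBang (Var 0) (Lam poly_fmap_dom2 (LetBang (Var 0)
    (fm (TVar 3) (TVar 2) (TVar 1) (TVar 0) (Var 2) (Var 0))))))))).

Lemma poly_fmap_twf n : twf n poly_fmap_type.
Proof. by rewrite /= !twf_ty2. Qed.

Lemma lam_bang n G a b t : no_lin G -> ctx_wf n G -> twf n a ->
  has_type n [:: (a, Un), (TBang a, Off) & G] t b ->
  has_type n G (Lam (TBang a) (LetBang (Var 0) t)) (TLolli (TBang a) b).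
Proof.
move=> N W Wa B; constructor.
apply: (ht_letbang (a := a) (G1 := (TBang a, Lin) :: G) (G2 := (TBang a, Off) :: G)) => //.
- by constructor; [constructor|apply: split_self].
- by apply: ht_var; [rewrite /= Wa|constructor].
Qed.

Lemma poly_fmap_typed n G : all (twf n) G -> has_type n (un G) poly_fmap poly_fmap_type.
Proof.
move=> W; do 4!constructor; rewrite !un_tsh.
set G4 := [seq _ | _ <- _].
have W4 : all (twf n.+4) G4 by do 4!apply: all_tsh.
have N := no_lin_un G4.
apply: lam_bang => //; first by rewrite wf_un.
apply: lam_bang => //; first by rewrite /= wf_un.
by apply: fmap2_typed => //; apply: ht_var; rewrite /= ?wf_un //; do 4?constructor.
Qed.

Lemma poly_fmap_app a b a' b' f g :
  reds (App (App (TApp (TApp (TApp (TApp poly_fmap a) b) a') b') (Bang f)) (Bang g))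
       (fm a b a' b' f g).
Proof.
rewrite /poly_fmap.
do 8!red_step; apply: reds_eq.
rewrite !fmap2_sub; congr fmap2; by sub_eq.
Qed.

(** Admissibility serves to instantiate relation quantifiers, well-formedness to state propositions
    about the relation; the rules below need both. *)
Record adm_rel n G T r a b : Prop := Adm {
  adm_src : twf n a; adm_tgt : twf n b;
  adm_is : isrel LAPL_par n G T AdmRel r a b;
  adm_wf : rwf n G T r a b }.

Lemma sigma_rel_wf n G T a0 b0 a1 b1 r0 r1 : all (twf n) G ->
  adm_rel n G T r0 a0 a1 -> adm_rel n G T r1 b0 b1 ->
  rwf n G T (sigma_rel a0 b0 a1 b1 r0 r1) (Sg a0 b0) (Sg a1 b1).
Proof.
move=> W [? ? _ ?] [? ? _ ?]; apply: (rwf_tyrel (k := 2)) => //.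
by case=> [|[|i]].
Qed.

(** Identity extension at the closed type of [poly_fmap] relates this term to itself. Its four
    quantifiers are instantiated at the given relations, its promoted arguments are supplied by
    [rel_bangI], and beta recovers the action on both sides. *)
Lemma fmap2_parametric n G T H a0 a1 ra b0 b1 rb a0' a1' ra' b0' b1' rb' f0 f1 g0 g1 x0 x1 :
  adm_rel n G T ra a0 a1 -> adm_rel n G T rb b0 b1 ->
  adm_rel n G T ra' a0' a1' -> adm_rel n G T rb' b0' b1' ->
  has_type n (un G) f0 (TLolli a0' a0) -> has_type n (un G) f1 (TLolli a1' a1) ->
  has_type n (un G) g0 (TLolli b0 b0') -> has_type n (un G) g1 (TLolli b1 b1') ->
  has_type n (un G) x0 (Sg a0 b0) -> has_type n (un G) x1 (Sg a1 b1) ->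
  pv n G T H (PRel (rlolli a0' a1' a0 a1 ra' ra) f0 f1) ->
  pv n G T H (PRel (rlolli b0 b1 b0' b1' rb rb') g0 g1) ->
  pv n G T H (PRel (sigma_rel a0 b0 a1 b1 ra rb) x0 x1) ->
  pv n G T H (PRel (sigma_rel a0' b0' a1' b1' ra' rb')
    (App (fm a0 b0 a0' b0' f0 g0) x0) (App (fm a1 b1 a1' b1' f1 g1) x1)).
Proof.
move=> A B A' B' F0 F1 G0 G1 X0 X1 F GG X; have W := has_type_ctx F0.
(* The type is closed, so any environment will do; [TOne] is well formed in every context. *)
have P := idextI (s := fun=> TOne) (poly_fmap_twf 2) isT isT
  (eqv_refl T H (t := poly_fmap) (a := tsub (fun=> TOne) poly_fmap_type) ltac:(rewrite
      tsub_closed ?poly_fmap_twf //; apply: poly_fmap_typed W)).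
have {P} P := tyrel_piE P (adm_is A) (adm_src A) (adm_tgt A).
have {P} P := tyrel_piE P (adm_is B) (adm_src B) (adm_tgt B).
have {P} P := tyrel_piE P (adm_is A') (adm_src A') (adm_tgt A').
have {P} P := tyrel_piE P (adm_is B') (adm_src B') (adm_tgt B').
move: P; set e := (X in tyrel _ _ X _); set s1 := (X in tyrel X _ _ _);
set s2 := (X in tyrel _ X _ _) => P.
have N := no_lin_un G.
have {P} P := rel_lolliE P (x := Bang f0) (y := Bang f1) (has_type_bang N F0) (has_type_bang N F1).
have {P} P := P (rel_bangI (rwf_lolli (adm_src A') (adm_tgt A') (adm_src A) (adm_tgt A) W
    (adm_wf A') (adm_wf A)) F0 F1 F).
have {P} P := rel_lolliE P (x := Bang g0) (y := Bang g1) (has_type_bang N G0) (has_type_bang N G1).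
have {P} P := P (rel_bangI (rwf_lolli (adm_src B) (adm_tgt B) (adm_src B') (adm_tgt B') W
    (adm_wf B) (adm_wf B')) G0 G1 GG).
have E1 : tyrel s1 s2 e (Sg (TVar 3) (TVar 2)) = sigma_rel a0 b0 a1 b1 ra rb.
  by rewrite /ty2 tyrel_tsub; apply: tyrel_ext hwf _; case=> [|[|i]].
have E2 : tyrel s1 s2 e (Sg (TVar 1) (TVar 0)) = sigma_rel a0' b0' a1' b1' ra' rb'.
  by rewrite /ty2 tyrel_tsub; apply: tyrel_ext hwf _; case=> [|[|i]].
have {P} P := rel_lolliE P (x := x0) (y := x1).
have Q0 : tsub s1 (Sg (TVar 3) (TVar 2)) = Sg a0 b0 by rewrite ty2_sub.
have Q1 : tsub s2 (Sg (TVar 3) (TVar 2)) = Sg a1 b1 by rewrite ty2_sub.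
have {P} P : pv n G T H (PRel (tyrel s1 s2 e (Sg (TVar 1) (TVar 0)))
   (App (App (App (TApp (TApp (TApp (TApp poly_fmap a0) b0) a0') b0') (Bang f0)) (Bang g0)) x0)
   (App (App (App (TApp (TApp (TApp (TApp poly_fmap a1) b1) a1') b1') (Bang f1)) (Bang g1)) x1)).
  by apply: P; [move: X0; rewrite -Q0|move: X1; rewrite -Q1|move: X; rewrite -E1].
rewrite E2 in P.
have R a b a' b' f g x : twf n a -> twf n b -> twf n a' -> twf n b' ->
    has_type n (un G) f (TLolli a' a) -> has_type n (un G) g (TLolli b b') ->
    has_type n (un G) x (Sg a b) -> eqv n G T H (Sg a' b')
   (App (App (App (TApp (TApp (TApp (TApp poly_fmap a) b) a') b') (Bang f)) (Bang g)) x)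
   (App (fm a b a' b' f g) x).
  move=> Wa Wb Wa' Wb' Hf Hg Hx; apply: eqv_reds (reds_appl _ (poly_fmap_app _ _ _ _ _ _)).
  type_app (Sg a b) => //; type_app (TBang (TLolli b b')); last exact: has_type_bang.
  type_app (TBang (TLolli a' a)); last exact: has_type_bang.
  have MM := poly_fmap_typed W; rewrite /poly_fmap_type /poly_fmap_dom1 /poly_fmap_dom2 in MM.
  have {}MM := ht_tapp MM Wa; rewrite /tinst /= !ty2_sub /= in MM.
  have {}MM := ht_tapp MM Wb; rewrite /tinst /= !ty2_sub /= in MM.
  have {}MM := ht_tapp MM Wa'; rewrite /tinst /= !ty2_sub /= in MM.
  by apply: (has_type_tapp MM Wb'); rewrite /tinst /= !ty2_sub /=; sub_eq.
by apply: rel_eqv P; [apply: sigma_rel_wf|apply: R; case: A; case: B; case: A'; case: B'|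
  apply: R; case: A; case: B; case: A'; case: B'].
Qed.

Lemma adm_rcospan n G T a b c f g : has_type n (un G) f (TLolli a c) ->
  has_type n (un G) g (TLolli b c) -> adm_rel n G T (rcospan a b c f g) a b.
Proof.
move=> F F'; have [Wa Wc] := twf_lolliE (has_type_twf F);
    have [Wb _] := twf_lolliE (has_type_twf F').
by split=> //; [apply: rcospan_isrel|apply: rcospan_rwf].
Qed.

Lemma adm_req n G T a : all (twf n) G -> twf n a -> adm_rel n G T (req a) a a.
Proof. by move=> W Wa; split=> //; [constructor|apply: rwf_req]. Qed.

Lemma app_midt n G T H a x : has_type n (un G) x a -> eqv n G T H a (App (midt a) x) x.
Proof.
move=> X; apply: eqv_reds; last by rewrite /midt; red_step; apply: reds_refl.
by type_app a => //; apply: has_type_midt (has_type_ctx X) (has_type_twf X).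
Qed.

(** From x = y one obtains the pair (f x, y), which lies in the converse graph of f. This is how the
    arrow f enters when the source is interpreted by equality and the target by a graph. *)
Lemma rel_into_graph n G T H a c f : has_type n (un G) f (TLolli c a) ->
  pv n G T H (PRel (rlolli c c a c (req c) (rcospan a c a (midt a) f)) f (midt c)).
Proof.
move=> F; have W := has_type_ctx F; have [Wc Wa] := twf_lolliE (has_type_twf F).
have [R C] := (rcospan_rwf T (has_type_midt W Wa) F, adm_req T W Wc).
apply: rel_lolliI => //; [exact: adm_wf C|exact: has_type_midt|].
have WG : all (twf n) (c :: c :: G) by solve_wf.
have F2 := has_type_ush (A := [:: c; c]) (k := 2) F erefl ltac:(by solve_wf).
rewrite rsh_req rsh_rcospan !msh_midt.
set H' := PRel _ _ _ :: _.
have E : eqv n (c :: c :: G) T H' c (Var 1) (Var 0).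
  split; try by type_var.
  apply: rel_reqE; apply: pr_hyp; first by left.
  by exists c, c; split; try type_var; apply: rwf_req.
have A := has_type_app (no_lin_un _) F2 (eqv_l E).
have Wm := has_type_midt WG Wc.
have B := has_type_app (no_lin_un _) Wm (eqv_r E).
apply: rcospanI => //; first by apply: has_type_midt.
apply: eqv_p; apply: (eqv_trans (app_midt _ _ A)).
apply: (eqv_appr F2); apply: (eqv_trans E); apply: eqv_sym; exact: app_midt (eqv_r E).
Qed.

(** The complementary situation: a pair (x, y) in the graph of g is sent to (g x, y), and membership
    in the graph is precisely the equality of these two. *)
Lemma rel_out_graph n G T H b b' g : has_type n (un G) g (TLolli b b') ->
  pv n G T H (PRel (rlolli b b' b' b' (rcospan b b' b' g (midt b')) (req b')) g (midt b')).
Proof.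
move=> F; have W := has_type_ctx F; have [Wb Wb'] := twf_lolliE (has_type_twf F).
have [R C] := (rcospan_rwf T F (has_type_midt W Wb'), adm_req T W Wb').
apply: rel_lolliI => //; [exact: adm_wf C|exact: has_type_midt|].
have WG : all (twf n) (b' :: b :: G) by solve_wf.
have F2 := has_type_ush (A := [:: b'; b]) (k := 2) F erefl ltac:(by solve_wf).
rewrite rsh_req rsh_rcospan !msh_midt.
have V1 : has_type n (un (b' :: b :: G)) (Var 1) b by type_var.
have V0 : has_type n (un (b' :: b :: G)) (Var 0) b' by type_var.
apply: rel_reqI; split.
- exact: has_type_app (no_lin_un _) F2 V1.
- exact: has_type_app (no_lin_un _) (has_type_midt WG Wb') V0.
apply: rcospanE; apply: pr_hyp; first by left.
by exists b, b'; split=> //; apply: rcospan_rwf => //; apply: has_type_midt.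
Qed.

Lemma sigma_rel_req n G T H a b x y : twf n a -> twf n b ->
  has_type n (un G) x (Sg a b) -> has_type n (un G) y (Sg a b) ->
  pv n G T H (PRel (sigma_rel a b a b (req a) (req b)) x y) -> eqv n G T H (Sg a b) x y.
Proof.
move=> Wa Wb X Y P; apply: (idextE hwf) => //.
apply: (prov_cast P); congr (PRel _ _ _).
by apply: tyrel_ext hwf _; case=> [|[|i]].
Qed.

Lemma sigma_rel_refl n G T H a b x : twf n a -> twf n b ->
  has_type n (un G) x (Sg a b) -> pv n G T H (PRel (sigma_rel a b a b (req a) (req b)) x x).
Proof.
move=> Wa Wb X; have P := idextI (s := env2 a b) hwf Wa Wb (eqv_refl T H X).
apply: (prov_cast P); congr (PRel _ _ _).
by apply: tyrel_ext hwf _; case=> [|[|i]].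
Qed.

Lemma app_fmap2_id n G T H a b x : twf n a -> twf n b ->
  has_type n (un G) x (Sg a b) ->
  eqv n G T H (Sg a b) (App (fm a b a b (midt a) (midt b)) x) x.
Proof.
move=> Wa Wb X; apply: (eqv_trans _ (app_midt T H X)).
by apply: (eqv_appl _ X); apply: fmap2_id (has_type_ctx X) Wa Wb.
Qed.

(** Act by (f, g) on the left and by identities on the right, with graphs as source relations and
    equalities as target relations. Contravariance puts [rel_into_graph] on f and [rel_out_graph] on
    g. Identity extension turns the resulting relation into an equation, and preservation of
    identities removes the action on y. *)
Lemma sigma_rel_graph_elim n G T H a b a' b' f g x y :
  has_type n (un G) f (TLolli a' a) -> has_type n (un G) g (TLolli b b') ->
  has_type n (un G) x (Sg a b) -> has_type n (un G) y (Sg a' b') ->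
  pv n G T H (PRel (sigma_rel a b a' b' (rcospan a a' a (midt a) f) (rcospan b b' b' g (midt
      b'))) x y) ->
  eqv n G T H (Sg a' b') (App (fm a b a' b' f g) x) y.
Proof.
move=> F F' X Y P; have W := has_type_ctx F; have [Wa' Wa] := twf_lolliE (has_type_twf F).
have [Wb Wb'] := twf_lolliE (has_type_twf F').
have A := adm_rcospan T (has_type_midt W Wa) F; have B := adm_rcospan T F' (has_type_midt W Wb').
have Q := fmap2_parametric A B (adm_req T W Wa') (adm_req T W Wb') F (has_type_midt W Wa') F'
    (has_type_midt W Wb')
  X Y (rel_into_graph T H F) (rel_out_graph T H F') P.
apply: (eqv_trans _ (app_fmap2_id T H Wa' Wb' Y)).
have N := no_lin_un G.
apply: sigma_rel_req Q => //.
- by apply: (has_type_app N) X; apply: fmap2_typed.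
- by apply: (has_type_app N) Y; apply: fmap2_typed => //; apply: has_type_midt.
Qed.

(** The opposite choice: equalities as source relations, graphs as target relations, started at the
    pair (y, y), which is related by identity extension. The roles of [rel_into_graph] and
    [rel_out_graph] are exchanged accordingly. *)
Lemma sigma_rel_graph_intro n G T H a b a' b' f g x y :
  has_type n (un G) f (TLolli a' a) -> has_type n (un G) g (TLolli b b') ->
  has_type n (un G) y (Sg a b) -> eqv n G T H (Sg a' b') x (App (fm a b a' b' f g) y) ->
  pv n G T H (PRel (sigma_rel a' b' a b (rcospan a' a a f (midt a)) (rcospan b' b b' (midt b')
      g)) x y).
Proof.
move=> F F' Y E; have W := has_type_ctx F; have [Wa' Wa] := twf_lolliE (has_type_twf F).
have [Wb Wb'] := twf_lolliE (has_type_twf F').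
have A := adm_rcospan T F (has_type_midt W Wa); have B := adm_rcospan T (has_type_midt W Wb') F'.
have Q := fmap2_parametric (adm_req T W Wa) (adm_req T W Wb) A B F (has_type_midt W Wa) F'
    (has_type_midt W Wb)
  Y Y (rel_out_graph T H F) (rel_into_graph T H F') (sigma_rel_refl T H Wa Wb Y).
apply: rel_eqv Q; first exact: sigma_rel_wf.
- exact: eqv_sym.
- exact: app_fmap2_id.
Qed.

End Graph.

(** * The initial dialgebra *)

Lemma msub_lam st sm a t : msub st sm (Lam a t) = Lam (tsub st a) (msub st (mup sm) t).
Proof. by []. Qed.
Lemma msub_app st sm t u : msub st sm (App t u) = App (msub st sm t) (msub st sm u).
Proof. by []. Qed.
Lemma msub_tapp st sm t a : msub st sm (TApp t a) = TApp (msub st sm t) (tsub st a).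
Proof. by []. Qed.
Lemma msub_tlam st sm t :
  msub st sm (TLam t) = TLam (msub (tup st) (fun i => msh 1 0 (sm i)) t).
Proof. by []. Qed.
Lemma msub_bang st sm t : msub st sm (Bang t) = Bang (msub st sm t).
Proof. by []. Qed.
Lemma msub_letbang st sm s t :
  msub st sm (LetBang s t) = LetBang (msub st sm s) (msub st (mup sm) t).
Proof. by []. Qed.
Lemma msub_v st sm i : msub st sm (Var i) = sm i.
Proof. by []. Qed.
Definition msubE := (msub_lam, msub_app, msub_tapp, msub_tlam, msub_bang, msub_letbang, msub_v).

(** Intuitionistic abstraction. It binds two indices: 0 is the unpacked variable and 1 the linear
    one already consumed by the [let], which explains the gaps in the indices used below. *)
Definition lamlet a t := Lam (TBang a) (LetBang (Var 0) t).

Lemma lamlet_typed n G a b t : twf n a ->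
  has_type n [:: (a, Un), (TBang a, Off) & G] t b ->
  has_type n G (lamlet a t) (TLolli (TBang a) b).
Proof.
move=> Wa B; have [W _] := has_type_wf B.
have WG : ctx_wf n G by case/and3P: W.
constructor.
apply: (ht_letbang (a := a) (G1 := (TBang a, Lin) :: off G) (G2 := (TBang a, Off) :: G)) => //.
- by constructor; [constructor|apply: split_off_r].
- apply: ht_var; last by constructor=> //; apply: no_lin_off.
  by rewrite /= Wa -(split_wf n (split_off_l G)).2.
Qed.

Definition appk k a a' F F' := App (App (TApp (TApp k a) a') F) F'.

Section Dialgebra.
Variable (sigma : ty).
Hypotheses (hwf : twf 2 sigma) (hneg : only_negative 0 sigma) (hpos : only_positive 1 sigma).

Notation Sg := (ty2 sigma).
Notation fm := (fmap2 sigma).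

Definition alg a a' := TLolli (Sg a' a) a.
Definition coalg a a' := TLolli a' (Sg a a').
Notation alg10 := (alg (TVar 1) (TVar 0)).
Notation coalg10 := (coalg (TVar 1) (TVar 0)).
(* [tau] encodes the limit of the positive components of all dialgebras. *)
Definition tau := TPi (TPi (TLolli (TBang alg10) (TLolli (TBang coalg10) (TVar 1)))).
(** Curried form of a map from the colimit to b: one component a' -o b for every dialgebra. *)
Definition kont b := TPi (TPi (TLolli (TBang alg10) (TLolli (TBang coalg10)
  (TLolli (TVar 0) (tsh 2 b))))).
(* [tau'] encodes the colimit of the negative components, i.e.
   exists a a'. !(alg a a') (x) !(coalg a a') (x) a'. *)
Definition tau' := TPi (TLolli (kont (TVar 0)) (TVar 0)).

Definition fold a a' f f' :=
  Lam tau (appk (Var 0) a a' (Bang (msh 0 1 f)) (Bang (msh 0 1 f'))).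
Definition pack a a' f f' := Lam a' (TLam (Lam (kont (TVar 0))
  (App (appk (Var 0) (tsh 1 a) (tsh 1 a') (Bang (msh 1 2 f)) (Bang (msh 1 2 f'))) (Var 1)))).

(** Since fold is evaluation, the square that fold must satisfy prescribes the value at every
    dialgebra. Variable 4 is the argument, 2 the algebra and 0 the coalgebra. *)
Definition tin := Lam (Sg tau' tau) (TLam (TLam (lamlet alg10 (lamlet coalg10
  (App (Var 2) (App (fm tau' tau (TVar 0) (TVar 1)
     (pack (TVar 1) (TVar 0) (Var 2) (Var 0)) (fold (TVar 1) (TVar 0) (Var 2) (Var 0)))
     (Var 4))))))).

(** The continuation on which [tout] runs a packed element: a member x of a' is unfolded by the
    coalgebra and transported along the action of fold and pack. Variable 0 is x, 1 the coalgebra, 3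
    the algebra. *)
Definition toutk := TLam (TLam (lamlet alg10 (lamlet coalg10 (Lam (TVar 0)
  (App (fm (TVar 1) (TVar 0) tau tau'
     (fold (TVar 1) (TVar 0) (Var 3) (Var 1)) (pack (TVar 1) (TVar 0) (Var 3) (Var 1)))
     (App (Var 1) (Var 0))))))).
Definition tout := Lam tau' (App (TApp (Var 0) (Sg tau tau')) toutk).

Lemma alg_twf n a a' : twf n a -> twf n a' -> twf n (alg a a').
Proof. by move=> Wa Wa'; rewrite /= twf_ty2 ?Wa. Qed.

Lemma coalg_twf n a a' : twf n a -> twf n a' -> twf n (coalg a a').
Proof. by move=> Wa Wa'; rewrite /= twf_ty2 ?Wa'. Qed.

Lemma tau_twf n : twf n tau.
Proof. by rewrite /tau /= !twf_ty2. Qed.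

Lemma kont_twf n b : twf n b -> twf n (kont b).
Proof. by move=> Wb; rewrite /kont /= !twf_ty2 //=; apply: (twf_sh 2). Qed.

Lemma tau'_twf n : twf n tau'.
Proof. by rewrite /= !twf_ty2. Qed.

Lemma alg_sub st a a' : tsub st (alg a a') = alg (tsub st a) (tsub st a').
Proof. by rewrite /= ty2_sub. Qed.

Lemma coalg_sub st a a' : tsub st (coalg a a') = coalg (tsub st a) (tsub st a').
Proof. by rewrite /= ty2_sub. Qed.

Lemma tau_sub st : tsub st tau = tau.
Proof. by apply: tsub_closed; apply: tau_twf. Qed.

Lemma tau'_sub st : tsub st tau' = tau'.
Proof. by apply: tsub_closed; apply: tau'_twf. Qed.

Lemma kont_sub st b : tsub st (kont b) = kont (tsub st b).
Proof. by rewrite /kont /= !ty2_sub //=; do 5!congr (_ _); sub_eq. Qed.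

Lemma fold_sub st sm a a' f f' : msub st sm (fold a a' f f') =
  fold (tsub st a) (tsub st a') (msub st sm f) (msub st sm f').
Proof. by rewrite /fold /appk !msubE tau_sub; congr Lam; sub_eq. Qed.

Lemma pack_sub st sm a a' f f' : msub st sm (pack a a' f f') =
  pack (tsub st a) (tsub st a') (msub st sm f) (msub st sm f').
Proof.
rewrite /pack /appk !msubE kont_sub; congr Lam; congr TLam; congr Lam.
by sub_eq.
Qed.

Lemma lamlet_sub st sm a t :
  msub st sm (lamlet a t) = lamlet (tsub st a) (msub st (mup (mup sm)) t).
Proof. by []. Qed.

Lemma tin_sub st sm : msub st sm tin = tin.
Proof.
by rewrite /tin !(msubE, lamlet_sub) !alg_sub !coalg_sub !ty2_sub // !fmap2_sub // pack_sub fold_sub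
  !tau_sub !tau'_sub.
Qed.

Lemma toutk_sub st sm : msub st sm toutk = toutk.
Proof.
by rewrite /toutk !(msubE, lamlet_sub) !alg_sub !coalg_sub !fmap2_sub // pack_sub fold_sub
  !tau_sub !tau'_sub.
Qed.

Lemma tout_sub st sm : msub st sm tout = tout.
Proof.
by rewrite /tout msub_lam msub_app toutk_sub msub_tapp msub_v tau'_sub ty2_sub // tau_sub tau'_sub.
Qed.

Lemma appk_typed n G F F' k a a' c d : has_type n G k (TPi (TPi (TLolli (TBang alg10) (TLolli
    (TBang coalg10) c)))) ->
  has_type n (off G) F (TBang (alg a a')) -> has_type n (off G) F' (TBang (coalg a a')) ->
  d = tsub (scons a' (scons a TVar)) c ->
  has_type n G (appk k a a' F F') d.
Proof.
move=> Hk HF HF' ->.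
have [_ /= /andP[_ Wa]] := has_type_wf HF; have [_ /= /andP[Wa' _]] := has_type_wf HF'.
apply: (ht_app (split_off_l G)) HF'.
apply: (ht_app (split_off_l G)) HF.
have E := ht_tapp Hk Wa; rewrite /tinst /= !ty2_sub //= in E.
apply: (has_type_tapp E Wa'); rewrite /tinst /alg /coalg /= !ty2_sub //=.
by congr TLolli; [|congr TLolli]; sub_eq.
Qed.

Lemma off_cons a m G : off ((a, m) :: G) = (a, off_mult m) :: off G.
Proof. by []. Qed.

Lemma ctx_tsh_cons a m G : ctx_tsh ((a, m) :: G) = (tsh 1 a, m) :: ctx_tsh G.
Proof. by []. Qed.

Lemma tsub_lolli s a b : tsub s (TLolli a b) = TLolli (tsub s a) (tsub s b).
Proof. by []. Qed.

Lemma alg_sh k a a' : tsh k (alg a a') = alg (tsh k a) (tsh k a').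
Proof. by rewrite /tsh !tren_as_sub alg_sub. Qed.

Lemma coalg_sh k a a' : tsh k (coalg a a') = coalg (tsh k a) (tsh k a').
Proof. by rewrite /tsh !tren_as_sub coalg_sub. Qed.

Lemma fold_typed n G a a' f f' : no_lin G -> has_type n G f (alg a a') ->
  has_type n G f' (coalg a a') -> has_type n G (fold a a' f f') (TLolli tau a).
Proof.
move=> N F F'; have [W _] := has_type_wf F; constructor.
have WO : ctx_wf n [:: (tau, Off)] by rewrite /ctx_wf /all tau_twf.
apply: (appk_typed (c := TVar 1)) => //.
- apply: ht_var; last by constructor.
  by apply/andP; split; [apply: tau_twf|].
- rewrite !off_cons (off_no_lin N); apply: ht_bang => //.
  exact: (has_type_sh (A := [:: (_, Off)]) F).
- rewrite !off_cons (off_no_lin N); apply: ht_bang => //.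
  exact: (has_type_sh (A := [:: (_, Off)]) F').
Qed.

Lemma pack_typed n G a a' f f' : no_lin G -> has_type n G f (alg a a') ->
  has_type n G f' (coalg a a') -> has_type n G (pack a a' f f') (TLolli a' tau').
Proof.
move=> N F F'; have [W WA] := has_type_wf F; have [_ Wa] := twf_lolliE WA.
have [_ WC] := has_type_wf F'; have [Wa' _] := twf_lolliE WC.
do 3!constructor.
have NT : no_lin (ctx_tsh G) by rewrite /no_lin all_map.
have WT := ctx_wf_tsh W.
set k := kont (TVar 0); have Wk : twf n.+1 k by apply: kont_twf.
have Wb : twf n.+1 (tsh 1 a') by apply: (twf_sh 1).
have WO : ctx_wf n.+1 [:: (k, Off); (tsh 1 a', Off)].
  by apply: all_cons => //; apply: all_cons.
rewrite ctx_tsh_cons.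
apply: (ht_app (a := tsh 1 a') (G1 := [:: (k, Lin), (tsh 1 a', Off) & ctx_tsh G])
  (G2 := [:: (k, Off), (tsh 1 a', Lin) & ctx_tsh G])).
- by do 2!(constructor; first by constructor); apply: split_self.
- apply: (appk_typed (c := TLolli (TVar 0) (tsh 2 (TVar 0)))) => //.
  + apply: ht_var; last by constructor.
    by apply: all_cons => //; apply: all_cons.
  + rewrite !off_cons (off_no_lin NT) -alg_sh.
    apply: ht_bang => //; rewrite (_ : msh 1 2 f = msh 0 2 (msh 1 0 f)); last by sub_eq.
    exact: (has_type_sh (A := [:: (_, Off); (_, Off)]) (has_type_tsh F)).
  + rewrite !off_cons (off_no_lin NT) -coalg_sh.
    apply: ht_bang => //; rewrite (_ : msh 1 2 f' = msh 0 2 (msh 1 0 f')); last by sub_eq.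
    exact: (has_type_sh (A := [:: (_, Off); (_, Off)]) (has_type_tsh F')).
- apply: ht_var; last by do 2!constructor.
  by apply: all_cons => //; apply: all_cons.
Qed.

Lemma tin_typed n G : all (twf n) G -> has_type n (un G) tin (TLolli (Sg tau' tau) tau).
Proof.
move=> W; do 3!constructor.
rewrite !ctx_tsh_cons !un_tsh.
set G2 := [seq _ | _ <- _]; set s := tsh 1 (tsh 1 _).
have W2 : ctx_wf n.+2 (un G2) by rewrite wf_un; do 2!apply: all_tsh.
have Es : s = Sg tau' tau by rewrite /s /tsh !ty2_ren // !tren_as_sub !tau_sub !tau'_sub.
have Ws : twf n.+2 s by rewrite Es; apply: twf_ty2 => //; [apply: tau'_twf|apply: tau_twf].
have N2 := no_lin_un G2.
apply: lamlet_typed; first by apply: alg_twf.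
apply: lamlet_typed; first by apply: coalg_twf.
have WC : ctx_wf n.+2 [:: (coalg10, Un), (TBang coalg10, Off), (alg10, Un), (TBang alg10, Off),
    (s, Lin) & un G2].
  do 2!(apply: all_cons; first by exact: (@coalg_twf n.+2 (TVar 1) (TVar 0))).
  by do 2!(apply: all_cons; first by exact: (@alg_twf n.+2 (TVar 1) (TVar 0))); apply: all_cons.
have WF : ctx_wf n.+2 [:: (coalg10, Un), (TBang coalg10, Off), (alg10, Un), (TBang alg10, Off),
    (s, Off) & un G2] by [].
have V2 : has_type n.+2 [:: (coalg10, Un), (TBang coalg10, Off), (alg10, Un), (TBang alg10,
    Off), (s, Off) & un G2] (Var 2) alg10.
  by apply: ht_var => //; do 3!constructor.
have V0 : has_type n.+2 [:: (coalg10, Un), (TBang coalg10, Off), (alg10, Un), (TBang alg10,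
    Off), (s, Off) & un G2] (Var 0) coalg10.
  by apply: ht_var => //; constructor.
apply: (has_type_app_off (a := Sg (TVar 0) (TVar 1))).
  by rewrite /= off_un.
apply: (has_type_app_off (a := Sg tau' tau)).
  rewrite /= off_un; apply: fmap2_typed => //; first by apply: pack_typed.
  by apply: fold_typed.
by apply: ht_var => //; rewrite -Es; do 5!constructor.
Qed.

Lemma toutk_typed n G : no_lin G -> ctx_wf n G -> has_type n G toutk (kont (Sg tau tau')).
Proof.
move=> N W; do 2!constructor.
set G2 := ctx_tsh _.
have W2 : ctx_wf n.+2 G2 by do 2!apply: ctx_wf_tsh.
have N2 : no_lin G2 by rewrite /no_lin !all_map.
have -> : tsh 2 (Sg tau tau') = Sg tau tau'.
  by rewrite /tsh !ty2_ren // !tren_as_sub !tau_sub !tau'_sub.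
apply: lamlet_typed; first by apply: alg_twf.
apply: lamlet_typed; first by apply: coalg_twf.
constructor.
set G3 := [:: (coalg10, Un), (TBang coalg10, Off), (alg10, Un), (TBang alg10, Off) & G2].
have WF : ctx_wf n.+2 G3.
  do 2!(apply: all_cons; first by exact: (@coalg_twf n.+2 (TVar 1) (TVar 0))).
  by do 2!(apply: all_cons; first by exact: (@alg_twf n.+2 (TVar 1) (TVar 0))).
have V3 : has_type n.+2 ((TVar 0, Off) :: G3) (Var 3) alg10.
  by apply: ht_var => //; do 4!constructor.
have V1 : has_type n.+2 ((TVar 0, Off) :: G3) (Var 1) coalg10.
  by apply: ht_var => //; do 2!constructor.
apply: (has_type_app_off (a := Sg (TVar 1) (TVar 0))).
  rewrite /= (off_no_lin N2); apply: fmap2_typed => //; first by apply: fold_typed.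
  by apply: pack_typed.
apply: (has_type_app_off (a := TVar 0)).
  by rewrite /= (off_no_lin N2).
by apply: ht_var => //; constructor.
Qed.

Lemma tout_typed n G : all (twf n) G -> has_type n (un G) tout (TLolli tau' (Sg tau tau')).
Proof.
move=> W; constructor.
have Wt := tau'_twf n; have N := no_lin_un G.
have WC m : ctx_wf n ((tau', m) :: un G) by apply: all_cons;
    rewrite -?[all _ _]/(ctx_wf _ _) ?wf_un.
apply: (ht_app (a := kont (Sg tau tau')) (G1 := (tau', Lin) :: un G) (G2 := (tau', Off) :: un G)).
- by constructor; [constructor|apply: split_self].
- apply: (has_type_tapp (a := TLolli (kont (TVar 0)) (TVar 0))).
  + by apply: ht_var => //; constructor.
  + by apply: twf_ty2 => //; apply: tau_twf.
  + by rewrite /tinst tsub_lolli kont_sub.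
- exact: toutk_typed.
Qed.

Definition subE := (fold_sub, pack_sub, fmap2_sub hwf, tau_sub, tau'_sub, kont_sub, lamlet_sub,
    msubE).
Ltac red_step_sub := apply: reds_step; [red_head|]; rewrite /minst /mtinst !subE.

Lemma fold_app a a' f f' z :
  reds (App (fold a a' f f') z) (appk z a a' (Bang f) (Bang f')).
Proof.
apply: reds_step; [exact: r_lam|apply: reds_eq].
by rewrite /minst /appk !msubE; sub_eq.
Qed.

Lemma pack_app a a' f f' x b k :
  reds (App (TApp (App (pack a a' f f') x) b) k) (App (appk k a a' (Bang f) (Bang f')) x).
Proof.
rewrite /pack /appk; red_step_sub; red_step_sub; red_step_sub; apply: reds_eq.
by sub_eq.
Qed.

Lemma tin_app x a a' f f' :
  reds (appk (App tin x) a a' (Bang f) (Bang f'))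
    (App f (App (fm tau' tau a' a (pack a a' f f') (fold a a' f f')) x)).
Proof.
rewrite /appk /tin; do 7!red_step_sub; apply: reds_eq.
congr App; first by sub_eq.
congr App; last by sub_eq.
by congr fmap2; sub_eq.
Qed.

Lemma toutk_app x a a' f f' :
  reds (App (appk toutk a a' (Bang f) (Bang f')) x)
    (App (fm a a' tau tau' (fold a a' f f') (pack a a' f f')) (App f' x)).
Proof.
rewrite /appk /toutk; do 7!red_step_sub; apply: reds_eq.
congr App; last by sub_eq.
by congr fmap2; sub_eq.
Qed.

Lemma tout_app p : reds (App tout p) (App (TApp p (Sg tau tau')) toutk).
Proof.
apply: reds_step; [exact: r_lam|apply: reds_eq].
by rewrite /minst msub_app toutk_sub msub_tapp ty2_sub // tau_sub tau'_sub.
Qed.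

Lemma mcomp_sub st sm a g f :
  msub st sm (mcomp a g f) = mcomp (tsub st a) (msub st sm g) (msub st sm f).
Proof. by rewrite /mcomp; sub_eq. Qed.

Lemma mcomp_app a g f x : reds (App (mcomp a g f) x) (App g (App f x)).
Proof.
apply: reds_step; [exact: r_lam|apply: reds_eq].
by rewrite /minst; sub_eq.
Qed.

(* Commutation of the two squares of a dialgebra morphism (h, h') out of (tau, tau', tin, tout). *)
Definition pos_square a a' f h h' := PEq (TLolli (Sg tau' tau) a) (mcomp (Sg tau' tau) h tin)
  (mcomp (Sg tau' tau) f (fm tau' tau a' a h' h)).
Definition neg_square a a' f' h h' := PEq (TLolli a' (Sg tau tau')) (mcomp a' tout h')
  (mcomp a' (fm a a' tau tau' h h') f').

Lemma psub_eq st sm sr a t u :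
  psub st sm sr (PEq a t u) = PEq (tsub st a) (msub st sm t) (msub st sm u).
Proof. by []. Qed.

Lemma sigma_rel_sh k j a0 b0 a1 b1 r0 r1 : rsh 0 k j (sigma_rel sigma a0 b0 a1 b1 r0 r1) =
  sigma_rel sigma a0 b0 a1 b1 (rsh 0 k j r0) (rsh 0 k j r1).
Proof.
rewrite /rsh !rren_as_sub rsub_tyrel.
by apply: tyrel_ext hwf _; case=> [|[|i]] // _; split=> //; sub_eq.
Qed.

Lemma pos_square_sh kt km kr a a' f h h' : psh kt km kr (pos_square a a' f h h') =
  pos_square (tsh kt a) (tsh kt a') (msh kt km f) (msh kt km h) (msh kt km h').
Proof.
rewrite /psh pren_as_sub /tsh /msh !tren_as_sub !mren_as_sub.
by rewrite /pos_square psub_eq tsub_lolli !mcomp_sub tin_sub fmap2_sub // !ty2_sub // !tau_sub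
    !tau'_sub.
Qed.

Lemma neg_square_sh kt km kr a a' f' h h' : psh kt km kr (neg_square a a' f' h h') =
  neg_square (tsh kt a) (tsh kt a') (msh kt km f') (msh kt km h) (msh kt km h').
Proof.
rewrite /psh pren_as_sub /tsh /msh !tren_as_sub !mren_as_sub.
by rewrite /neg_square psub_eq tsub_lolli !mcomp_sub tout_sub fmap2_sub // !ty2_sub // !tau_sub
    !tau'_sub.
Qed.

Lemma tin_sh k j : msh k j tin = tin.
Proof. by rewrite /msh mren_as_sub tin_sub. Qed.

Lemma tout_sh k j : msh k j tout = tout.
Proof. by rewrite /msh mren_as_sub tout_sub. Qed.

(** Typings only. The two squares stay separate, as propositions that have to travel through the
    hypothesis list and be shifted with it. *)
Record mor_data n G a a' f f' h h' : Prop := MorData {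
  md_alg : has_type n (un G) f (alg a a');
  md_coalg : has_type n (un G) f' (coalg a a');
  md_pos : has_type n (un G) h (TLolli tau a);
  md_neg : has_type n (un G) h' (TLolli a' tau') }.

Lemma mor_data_sh k n A G a a' f f' h h' : mor_data n G a a' f f' h h' ->
  size A = k -> all (twf n) A ->
  mor_data n (A ++ G) a a' (msh 0 k f) (msh 0 k f') (msh 0 k h) (msh 0 k h').
Proof. by case=> *; split; apply: has_type_ush. Qed.

Lemma tau_sh k : tsh k tau = tau.
Proof. by rewrite /tsh tren_as_sub tau_sub. Qed.

Lemma tau'_sh k : tsh k tau' = tau'.
Proof. by rewrite /tsh tren_as_sub tau'_sub. Qed.

Lemma tsh0E a : tsh 0 a = a.
Proof. by rewrite tsh0. Qed.

Lemma tsh_lolli k a b : tsh k (TLolli a b) = TLolli (tsh k a) (tsh k b).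
Proof. by []. Qed.

Lemma mor_data_tsh n G a a' f f' h h' : mor_data n G a a' f f' h h' ->
  mor_data n.+1 [seq tsh 1 c | c <- G] (tsh 1 a) (tsh 1 a')
    (msh 1 0 f) (msh 1 0 f') (msh 1 0 h) (msh 1 0 h').
Proof.
case=> A B C D; split.
- by rewrite -alg_sh; apply: has_type_utsh.
- by rewrite -coalg_sh; apply: has_type_utsh.
- by rewrite -[tau](tau_sh 1) -tsh_lolli; apply: has_type_utsh.
- by rewrite -[tau'](tau'_sh 1) -tsh_lolli; apply: has_type_utsh.
Qed.

(** * The squares of a morphism, applied to elements *)

Section Squares.
Variables (n : nat) (G : seq ty) (T : rctx).
Notation ht := (has_type n (un G)).
Variables (a a' : ty) (f f' h h' : tm).
Hypothesis D : mor_data n G a a' f f' h h'.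

Let W : all (twf n) G := has_type_ctx (md_alg D).
Let Wa : twf n a := (twf_lolliE (has_type_twf (md_alg D))).2.
Let Wa' : twf n a' := (twf_lolliE (has_type_twf (md_coalg D))).1.
Let N := no_lin_un G.
Let Wt := tau_twf n.
Let Wt' := tau'_twf n.

Lemma pos_square_typed : ht (mcomp (Sg tau' tau) h tin) (TLolli (Sg tau' tau) a) /\
  ht (mcomp (Sg tau' tau) f (fm tau' tau a' a h' h)) (TLolli (Sg tau' tau) a).
Proof.
split; apply: (mcomp_typed (split_self N)) => //; try by apply: twf_ty2.
- exact: md_pos D.
- exact: tin_typed.
- exact: md_alg D.
- by apply: fmap2_typed => //; [apply: md_neg D|apply: md_pos D].
Qed.

Lemma neg_square_typed : ht (mcomp a' tout h') (TLolli a' (Sg tau tau')) /\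
  ht (mcomp a' (fm a a' tau tau' h h') f') (TLolli a' (Sg tau tau')).
Proof.
split; apply: (mcomp_typed (split_self N)) => //; try by apply: twf_ty2.
- exact: tout_typed.
- exact: md_neg D.
- by apply: fmap2_typed => //; [apply: md_pos D|apply: md_neg D].
- exact: md_coalg D.
Qed.

Variable (H : seq prop).

Lemma pos_square_app x : pv n G T H (pos_square a a' f h h') -> ht x (Sg tau' tau) ->
  eqv n G T H a (App h (App tin x)) (App f (App (fm tau' tau a' a h' h) x)).
Proof.
move=> P X; have [A B] := pos_square_typed.
have E : eqv n G T H (TLolli (Sg tau' tau) a) (mcomp (Sg tau' tau) h tin)
  (mcomp (Sg tau' tau) f (fm tau' tau a' a h' h)) by split.
apply: eqv_trans (eqv_sym (eqv_reds T H (has_type_app N A X) (mcomp_app _ _ _ _))) _.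
apply: eqv_trans (eqv_appl E X) _.
exact: eqv_reds (has_type_app N B X) (mcomp_app _ _ _ _).
Qed.

Lemma neg_square_app x : pv n G T H (neg_square a a' f' h h') -> ht x a' ->
  eqv n G T H (Sg tau tau') (App tout (App h' x)) (App (fm a a' tau tau' h h') (App f' x)).
Proof.
move=> P X; have [A B] := neg_square_typed.
have E : eqv n G T H (TLolli a' (Sg tau tau')) (mcomp a' tout h')
  (mcomp a' (fm a a' tau tau' h h') f') by split.
apply: eqv_trans (eqv_sym (eqv_reds T H (has_type_app N A X) (mcomp_app _ _ _ _))) _.
apply: eqv_trans (eqv_appl E X) _.
exact: eqv_reds (has_type_app N B X) (mcomp_app _ _ _ _).
Qed.

End Squares.

(** Both relations lead from the carriers tau and tau' to those of the other dialgebra. As h' points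
    backwards, its converse graph is the one with this orientation. *)
Notation pos_graph a h := (rcospan tau a a h (midt a)).
Notation neg_graph a' h' := (rcospan tau' a' tau' (midt tau') h').

Lemma mor_adm n G T a a' f f' h h' : mor_data n G a a' f f' h h' ->
  adm_rel n G T (pos_graph a h) tau a /\ adm_rel n G T (neg_graph a' h') tau' a'.
Proof.
case=> F F' C C'; have W := has_type_ctx F.
split; apply: adm_rcospan => //; apply: has_type_midt => //; last exact: tau'_twf.
exact: (twf_lolliE (has_type_twf C)).2.
Qed.

(** By the graph lemma a pair related at sigma has the form (x, s(h', h) x) up to equality, so
    relatedness of the results is h (in x) = f (s(h', h) x), which is the algebra square at x. *)
Lemma tin_graph n G T H a a' f f' h h' : mor_data n G a a' f f' h h' ->
  pv n G T H (pos_square a a' f h h') ->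
  pv n G T H (PRel (rlolli (Sg tau' tau) (Sg a' a) tau a
    (sigma_rel sigma tau' tau a' a (neg_graph a' h') (pos_graph a h)) (pos_graph a h)) tin f).
Proof.
move=> D P; have [A B] := pos_square_typed D.
have W := has_type_ctx (md_alg D); have [Ws Wa] := twf_lolliE (has_type_twf (md_alg D)).
have Wt : twf n (Sg tau' tau) by apply: twf_ty2 (tau'_twf n) (tau_twf n).
have [RA RB] := mor_adm T D.
have K0 : pwf n G T (pos_square a a' f h h') by split.
apply: (prov_cut K0 P); have {P} K := known_head H K0.
apply: rel_lolliI => //; [exact: tau_twf|exact: sigma_rel_wf|exact: adm_wf RA|exact: tin_typed|
    exact: md_alg D|].
have K2 := known_allM (A := [:: Sg a' a; Sg tau' tau]) (k := 2) K erefl ltac:(by solve_wf).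
have D2 := mor_data_sh (A := [:: Sg a' a; Sg tau' tau]) (k := 2) D erefl ltac:(by solve_wf).
rewrite pos_square_sh !tsh0E in K2.
rewrite sigma_rel_sh !rsh_rcospan tin_sh !msh_midt.
have [RA2 RB2] := mor_adm T D2.
set G2 := ([:: _; _] ++ G) in D2 K2 RA2 RB2 *.
have W2 : all (twf n) G2 := has_type_ctx (md_alg D2).
have V1 : has_type n (un G2) (Var 1) (Sg tau' tau) by type_var.
have V0 : has_type n (un G2) (Var 0) (Sg a' a) by type_var.
set R := sigma_rel _ _ _ _ _ _ _.
have HR : pwf n G2 T (PRel R (Var 1) (Var 0)).
  by exists (Sg tau' tau), (Sg a' a); split=> //; apply: sigma_rel_wf.
have K3 := known_cons (PRel R (Var 1) (Var 0)) K2.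
have E3 := known_pr (known_head [seq psh 0 2 0 h0 | h0 <- pos_square a a' f h h' :: H] HR).
have E4 := sigma_rel_graph_elim hwf hneg hpos (md_neg D2) (md_pos D2) V1 V0 E3.
have E5 := pos_square_app D2 (known_pr K3) V1.
have N := no_lin_un G2.
have TX := has_type_app N (tin_typed W2) V1.
have TY := has_type_app N (md_alg D2) V0.
apply: rcospanI => //; [exact: md_pos D2|exact: has_type_midt|].
apply: eqv_p; apply: (eqv_trans E5); apply: (eqv_trans (eqv_appr (md_alg D2) E4)).
exact: eqv_sym (app_midt _ _ TY).
Qed.

(** Related arguments are, up to equality, h' y and y. The introduction half of the graph lemma then
    asks for out (h' y) = s(h, h') (f' y), the coalgebra square at y. *)
Lemma tout_graph n G T H a a' f f' h h' : mor_data n G a a' f f' h h' ->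
  pv n G T H (neg_square a a' f' h h') ->
  pv n G T H (PRel (rlolli tau' a' (Sg tau tau') (Sg a a') (neg_graph a' h')
    (sigma_rel sigma tau tau' a a' (pos_graph a h) (neg_graph a' h'))) tout f').
Proof.
move=> D P; have [A B] := neg_square_typed D.
have W := has_type_ctx (md_alg D); have [Ws Wa] := twf_lolliE (has_type_twf (md_alg D)).
have Wa' := (twf_lolliE (has_type_twf (md_coalg D))).1.
have [RA RB] := mor_adm T D.
have K0 : pwf n G T (neg_square a a' f' h h') by split.
apply: (prov_cut K0 P); have {P} K := known_head H K0.
have Wt := tau_twf n; have Wt' := tau'_twf n.
apply: rel_lolliI => //; try (by apply: twf_ty2);
  [exact: adm_wf RB|exact: sigma_rel_wf|exact: tout_typed|exact: md_coalg D|].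
have K2 := known_allM (A := [:: a'; tau']) (k := 2) K erefl ltac:(by solve_wf).
have D2 := mor_data_sh (A := [:: a'; tau']) (k := 2) D erefl ltac:(by solve_wf).
rewrite neg_square_sh !tsh0E in K2.
rewrite sigma_rel_sh !rsh_rcospan tout_sh !msh_midt.
have [RA2 RB2] := mor_adm T D2.
set G2 := ([:: _; _] ++ G) in D2 K2 RA2 RB2 *.
have W2 : all (twf n) G2 := has_type_ctx (md_alg D2).
have V1 : has_type n (un G2) (Var 1) tau' by type_var.
have V0 : has_type n (un G2) (Var 0) a' by type_var.
set R := rcospan _ _ _ _ _.
have HR : pwf n G2 T (PRel R (Var 1) (Var 0)).
  by exists tau', a'; split=> //; apply: adm_wf RB2.
have K3 := known_cons (PRel R (Var 1) (Var 0)) K2.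
have E3 := rcospanE (known_pr (known_head [seq psh 0 2 0 h0 |
    h0 <- neg_square a a' f' h h' :: H] HR)).
have N := no_lin_un G2.
apply: sigma_rel_graph_intro (md_pos D2) (md_neg D2) _ _ => //.
  exact: has_type_app N (md_coalg D2) V0.
apply: (eqv_trans _ (neg_square_app D2 (known_pr K3) V0)).
apply: (eqv_appr (tout_typed W2)).
apply: (eqv_trans (eqv_sym (app_midt _ _ V1))); split=> //.
- by type_app tau' => //; apply: has_type_midt.
- exact: has_type_app N (md_neg D2) V0.
Qed.

Lemma alg_rel s1 s2 e : tyrel s1 s2 e (TBang alg10) =
  rbang (alg (s1 1) (s1 0)) (alg (s2 1) (s2 0))
    (rlolli (Sg (s1 0) (s1 1)) (Sg (s2 0) (s2 1)) (s1 1) (s2 1)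
      (sigma_rel sigma (s1 0) (s1 1) (s2 0) (s2 1) (e 0) (e 1)) (e 1)).
Proof.
rewrite tyrel_bang tyrel_lolli !alg_sub /= !ty2_sub //; congr rbang; congr rlolli.
by rewrite /ty2 tyrel_tsub; apply: tyrel_ext hwf _; case=> [|[|i]].
Qed.

Lemma coalg_rel s1 s2 e : tyrel s1 s2 e (TBang coalg10) =
  rbang (coalg (s1 1) (s1 0)) (coalg (s2 1) (s2 0))
    (rlolli (s1 0) (s2 0) (Sg (s1 1) (s1 0)) (Sg (s2 1) (s2 0)) (e 0)
      (sigma_rel sigma (s1 1) (s1 0) (s2 1) (s2 0) (e 1) (e 0))).
Proof.
rewrite tyrel_bang tyrel_lolli !coalg_sub /= !ty2_sub //; congr rbang; congr rlolli.
by rewrite /ty2 tyrel_tsub; apply: tyrel_ext hwf _; case=> [|[|i]].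
Qed.

Lemma tsub_bang s a : tsub s (TBang a) = TBang (tsub s a).
Proof. by []. Qed.

(** * Naturality along a dialgebra morphism *)

Section Naturality.
Variables (n : nat) (G : seq ty) (T : rctx) (H : seq prop).
Notation ht := (has_type n (un G)).
Notation pr := (pv n G T H).
Variables (a a' : ty) (f f' h h' : tm).
Hypothesis D : mor_data n G a a' f f' h h'.
Hypotheses (P1 : pr (pos_square a a' f h h')) (P2 : pr (neg_square a a' f' h h')).

Let W : all (twf n) G := has_type_ctx (md_alg D).
Let Wa : twf n a := (twf_lolliE (has_type_twf (md_alg D))).2.
Let Wa' : twf n a' := (twf_lolliE (has_type_twf (md_coalg D))).1.
Let N := no_lin_un G.
Let Wt := tau_twf n.
Let Wt' := tau'_twf n.

(** The part common to elements of [tau] and continuations: the two type quantifiers are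
    instantiated at the graphs of h and h', and the two promoted arguments are discharged by
    [tin_graph] and [tout_graph]. The remaining type d is left open. *)
Lemma appk_rel s s' e d t u :
  pr (PRel (tyrel s s' e (TPi (TPi (TLolli (TBang alg10) (TLolli (TBang coalg10) d))))) t u) ->
  pr (PRel (tyrel (scons tau' (scons tau s)) (scons a' (scons a s'))
      (scons (neg_graph a' h') (scons (pos_graph a h) e)) d)
    (appk t tau tau' (Bang tin) (Bang tout)) (appk u a a' (Bang f) (Bang f'))).
Proof.
move=> P; have [RA RB] := mor_adm T D.
have {}P := tyrel_piE P (adm_is RA) Wt Wa.
have {P} P := tyrel_piE P (adm_is RB) Wt' Wa'.
rewrite tyrel_lolli alg_rel tyrel_lolli coalg_rel in P.
rewrite !tsub_bang !alg_sub !coalg_sub in P.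
have B1 := has_type_bang N (tin_typed W); have B1' := has_type_bang N (md_alg D).
have B2 := has_type_bang N (tout_typed W); have B2' := has_type_bang N (md_coalg D).
have Q1 := rel_bangI _ (tin_typed W) (md_alg D) (tin_graph D P1).
have Q2 := rel_bangI _ (tout_typed W) (md_coalg D) (tout_graph D P2).
have Ws : twf n (Sg tau' tau) by apply: twf_ty2.
have Ws' : twf n (Sg tau tau') by apply: twf_ty2.
have Wsa : twf n (Sg a' a) by apply: twf_ty2.
have Wsa' : twf n (Sg a a') by apply: twf_ty2.
have {}P := rel_lolliE P B1 B1' (Q1 _).
have {}P := P (rwf_lolli Ws Wsa Wt Wa W (sigma_rel_wf hwf W RB RA) (adm_wf RA)).
have {}P := rel_lolliE P B2 B2' (Q2 _).
by apply: P; apply: (rwf_lolli Wt' Wa' Ws' Wsa' W (adm_wf RB) (sigma_rel_wf hwf W RA RB)).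
Qed.

(** Here d is the positive carrier, interpreted by the graph of h, so relatedness of the two
    evaluations of z is already the equation, up to an identity applied on the right. *)
Lemma tau_natural z : ht z tau ->
  eqv n G T H a (App h (appk z tau tau' (Bang tin) (Bang tout)))
    (appk z a a' (Bang f) (Bang f')).
Proof.
move=> Z.
have Z0 : ht z (tsub (fun=> TOne) tau) by rewrite tau_sub.
have P := idextI (s := fun=> TOne) (tau_twf 2) isT isT (eqv_refl T H Z0).
have {}P := rcospanE (appk_rel P).
have A1 : ht (appk z tau tau' (Bang tin) (Bang tout)) tau.
  by apply: (appk_typed Z); rewrite ?off_un; first apply: has_type_bang N (tin_typed W);
    first apply: has_type_bang N (tout_typed W).
have A2 : ht (appk z a a' (Bang f) (Bang f')) a.
  by apply: (appk_typed Z); rewrite ?off_un; first apply: has_type_bang N (md_alg D);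
    first apply: has_type_bang N (md_coalg D).
apply: (eqv_trans _ (app_midt _ _ A2)); split=> //.
- exact: has_type_app N (md_pos D) A1.
- by type_app a => //; apply: has_type_midt.
Qed.

(** Here d is a' -o b. Viewing b as the value of a type variable makes its interpretation equality,
    while h' x and x are related by the converse graph of h'. *)
Lemma kont_natural k b x : ht k (kont b) -> ht x a' -> twf n b ->
  eqv n G T H b (App (appk k tau tau' (Bang tin) (Bang tout)) (App h' x))
    (App (appk k a a' (Bang f) (Bang f')) x).
Proof.
move=> Z X Wb.
have E0 : tsub (fun=> b) (kont (TVar 0)) = kont b by rewrite kont_sub.
have Z0 : ht k (tsub (fun=> b) (kont (TVar 0))) by rewrite E0.
have P := idextI (s := fun=> b) (@kont_twf 2 (TVar 0) isT) Wb Wb (eqv_refl T H Z0).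
have {}P := appk_rel P.
have X' := has_type_app N (md_neg D) X.
have {}P := rel_lolliE P X' X.
have Q : pr (PRel (neg_graph a' h') (App h' x) x).
  apply: rcospanI => //; [exact: has_type_midt|exact: md_neg D|].
  exact: eqv_p (app_midt _ _ X').
have {P} P := rel_reqE (P Q).
split=> //.
- type_app tau' => //; apply: (appk_typed Z); rewrite ?off_un;
    first apply: has_type_bang N (tin_typed W) => //.
    by apply: has_type_bang N (tout_typed W).
  by rewrite tsub_lolli; congr TLolli; sub_eq.
- type_app a' => //; apply: (appk_typed Z); rewrite ?off_un;
    first apply: has_type_bang N (md_alg D) => //.
    by apply: has_type_bang N (md_coalg D).
  by rewrite tsub_lolli; congr TLolli; sub_eq.
Qed.
End Naturality.

Lemma fold_sh j k a a' f f' :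
  msh j k (fold a a' f f') = fold (tsh j a) (tsh j a') (msh j k f) (msh j k f').
Proof. by rewrite /msh /tsh !mren_as_sub !tren_as_sub fold_sub. Qed.

Lemma pack_sh j k a a' f f' :
  msh j k (pack a a' f f') = pack (tsh j a) (tsh j a') (msh j k f) (msh j k f').
Proof. by rewrite /msh /tsh !mren_as_sub !tren_as_sub pack_sub. Qed.

Lemma fmap2_sh k a b a' b' f g : msh 0 k (fm a b a' b' f g) = fm a b a' b' (msh 0 k f) (msh 0 k g).
Proof. by rewrite /msh fmap2_ren // !tren_idP. Qed.

Lemma mcomp_sh k a g f : msh 0 k (mcomp a g f) = mcomp a (msh 0 k g) (msh 0 k f).
Proof. by rewrite /msh !mren_as_sub mcomp_sub; congr mcomp; sub_eq. Qed.

Lemma has_type_sh_app n G t a b : has_type n (un G) t (TLolli a b) ->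
  has_type n (un (a :: G)) (App (msh 0 1 t) (Var 0)) b.
Proof.
move=> Ht; have W := has_type_ctx Ht; have [Wa _] := twf_lolliE (has_type_twf Ht).
type_app a; last by type_var.
by apply: (has_type_ush (A := [:: a]) Ht) => //; solve_wf.
Qed.

Lemma has_type_sh_app_bang n G t a b : has_type n (un G) t (TLolli (TBang a) b) ->
  has_type n (un (a :: G)) (App (msh 0 1 t) (Bang (Var 0))) b.
Proof.
move=> Ht; have W := has_type_ctx Ht; have [Wa _] := twf_lolliE (has_type_twf Ht).
have {}Wa : twf n a by [].
type_app (TBang a); last by apply: (has_type_bang (no_lin_un _)); type_var.
by apply: (has_type_ush (A := [:: a]) Ht) => //; solve_wf.
Qed.

Lemma has_type_sh_tapp n G t a : has_type n (un G) t (TPi a) ->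
  has_type n.+1 (un [seq tsh 1 c | c <- G]) (TApp (msh 1 0 t) (TVar 0)) a.
Proof. by move=> Ht; apply: (has_type_tapp (a := tren (upr (addn 1)) a) (has_type_utsh Ht)) =>
    //; sub_eq. Qed.

Lemma fun_ext_reds n G T H t u a b w : has_type n (un G) t (TLolli a b) ->
  has_type n (un G) u (TLolli a b) ->
  reds (App (msh 0 1 t) (Var 0)) w -> reds (App (msh 0 1 u) (Var 0)) w ->
  eqv n G T H (TLolli a b) t u.
Proof.
move=> A B R Q; apply: fun_ext => //; apply: eqv_p.
apply: (eqv_trans (eqv_reds _ _ (has_type_sh_app A) R)); apply: eqv_sym.
exact: eqv_reds (has_type_sh_app B) Q.
Qed.

Lemma fold_pack_mor n G a a' f f' : has_type n (un G) f (alg a a') ->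
  has_type n (un G) f' (coalg a a') ->
  mor_data n G a a' f f' (fold a a' f f') (pack a a' f f').
Proof.
by move=> F F'; split=> //; [apply: fold_typed|apply: pack_typed]; rewrite ?no_lin_un.
Qed.

Lemma fold_pack_squares n G T H a a' f f' : has_type n (un G) f (alg a a') ->
  has_type n (un G) f' (coalg a a') ->
  pv n G T H (pos_square a a' f (fold a a' f f') (pack a a' f f')) /\
  pv n G T H (neg_square a a' f' (fold a a' f f') (pack a a' f f')).
Proof.
move=> F F'; have D := fold_pack_mor F F'.
split; apply: eqv_p.
- have [A B] := pos_square_typed D; apply: (fun_ext_reds _ _ A B).
    rewrite mcomp_sh tin_sh fold_sh; apply: reds_trans (mcomp_app _ _ _ _) _.
    apply: reds_trans (fold_app _ _ _ _ _) _; exact: tin_app.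
  rewrite mcomp_sh fmap2_sh fold_sh pack_sh !tsh0E; exact: mcomp_app.
- have [A B] := neg_square_typed D; apply: (fun_ext_reds _ _ A B).
    rewrite mcomp_sh tout_sh pack_sh; apply: reds_trans (mcomp_app _ _ _ _) _.
    apply: reds_trans (tout_app _) _; apply: reds_trans (pack_app _ _ _ _ _ _ _) _.
    exact: toutk_app.
  rewrite mcomp_sh fmap2_sh fold_sh pack_sh !tsh0E; exact: mcomp_app.
Qed.

(** * Reduction of equations to a generic dialgebra *)

Section Extensionality.
Variables (n : nat) (G : seq ty) (T : rctx) (H : seq prop).
Notation G2 := [seq tsh 1 c | c <- [seq tsh 1 c | c <- G]].
Notation H2 := [seq psh 1 0 0 p | p <- [seq psh 1 0 0 p | p <- H]].
Notation H3 := [seq psh 0 1 0 p | p <- [seq psh 0 1 0 p | p <- H2]].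

(** Maps out of [!] may be compared on promoted variables, so it suffices to evaluate at variable
    types with variables 1 and 0 as algebra and coalgebra. These form a generic dialgebra, whose own
    fold and pack are available to the proof. *)
Lemma pibang_ext t u c :
  let p := TPi (TPi (TLolli (TBang alg10) (TLolli (TBang coalg10) c))) in
  has_type n (un G) t p -> has_type n (un G) u p ->
  pv n.+2 (coalg10 :: alg10 :: G2) (rctx_tsh (rctx_tsh T)) H3
    (PEq c (appk (msh 2 2 t) (TVar 1) (TVar 0) (Bang (Var 1)) (Bang (Var 0)))
           (appk (msh 2 2 u) (TVar 1) (TVar 0) (Bang (Var 1)) (Bang (Var 0)))) ->
  eqv n G T H p t u.
Proof.
move=> p A B P; apply: pi_ext => //.
have A1 := has_type_sh_tapp A; have B1 := has_type_sh_tapp B.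
apply: eqv_p; apply: pi_ext => //.
have A2 := has_type_sh_tapp A1; have B2 := has_type_sh_tapp B1.
apply: eqv_p; apply: eq_bang_ext => //.
have A3 := has_type_sh_app_bang A2; have B3 := has_type_sh_app_bang B2.
apply: eqv_p; apply: eq_bang_ext => //.
by apply: prov_cast P _; congr PEq; rewrite /appk; sub_eq.
Qed.

Lemma kont_ext t u b : has_type n (un G) t (kont b) -> has_type n (un G) u (kont b) ->
  pv n.+2 [:: TVar 0, coalg10, alg10 & G2] (rctx_tsh (rctx_tsh T))
      [seq psh 0 1 0 p | p <- H3]
    (PEq (tsh 2 b)
      (App (appk (msh 2 3 t) (TVar 1) (TVar 0) (Bang (Var 2)) (Bang (Var 1))) (Var 0))
      (App (appk (msh 2 3 u) (TVar 1) (TVar 0) (Bang (Var 2)) (Bang (Var 1))) (Var 0))) ->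
  eqv n G T H (kont b) t u.
Proof.
move=> A B P; apply: pibang_ext => //.
have E v : has_type n (un G) v (kont b) -> 
    has_type n.+2 (un (coalg10 :: alg10 :: G2)) (appk (msh 2 2 v) (TVar 1) (TVar 0) (Bang (Var
        1)) (Bang (Var 0)))
     (TLolli (TVar 0) (tsh 2 b)).
  move=> V; have := has_type_sh_app_bang (has_type_sh_app_bang (has_type_sh_tapp
      (has_type_sh_tapp V))).
  by congr has_type; rewrite /appk; sub_eq.
apply: eqv_p; apply: fun_ext; try exact: E.
by apply: prov_cast P _; congr PEq; rewrite /appk; sub_eq.
Qed.
End Extensionality.

Lemma appk_sh k a a' F F' i j : msh i j (appk k a a' F F') =
  appk (msh i j k) (tsh i a) (tsh i a') (msh i j F) (msh i j F').
Proof. by []. Qed.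

Lemma has_type_appk n G F F' k a a' d : has_type n (un G) k (TPi (TPi (TLolli (TBang alg10)
    (TLolli (TBang coalg10) d)))) ->
  has_type n (un G) F (alg a a') -> has_type n (un G) F' (coalg a a') ->
  has_type n (un G) (appk k a a' (Bang F) (Bang F')) (tsub (scons a' (scons a TVar)) d).
Proof.
by move=> K A B; apply: (appk_typed K); rewrite ?off_un; try apply: (has_type_bang (no_lin_un G)).
Qed.

(** Evaluate both sides at the generic dialgebra. On the left this is fold applied to z in out, by
    beta; naturality of z along the morphism given by fold and pack identifies it with the value of
    z there. *)
Lemma tau_eta n G T H z : has_type n (un G) z tau ->
  eqv n G T H tau (appk z tau tau' (Bang tin) (Bang tout)) z.
Proof.
move=> Z; have W := has_type_ctx Z.
have A := has_type_appk Z (tin_typed W) (tout_typed W).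
apply: pibang_ext => //.
set G' := coalg10 :: _.
have WG' : all (twf n.+2) G'.
  do 2!(apply: all_cons; first by [apply: (@coalg_twf n.+2 (TVar 1) (TVar 0))|
      apply: (@alg_twf n.+2 (TVar 1) (TVar 0))]).
  by do 2!apply: all_tsh.
have V1 : has_type n.+2 (un G') (Var 1) alg10 by apply: has_type_var.
have V0 : has_type n.+2 (un G') (Var 0) coalg10 by apply: has_type_var.
have Z' : has_type n.+2 (un G') (msh 2 2 z) tau.
  rewrite -(tau_sh 2); apply: (has_type_sh2 (A := [:: coalg10; alg10]) Z) => //.
  by case/and3P: WG' => *; do 2?apply: all_cons.
rewrite appk_sh !tau_sh !tau'_sh.
have -> : msh 2 2 (Bang tin) = Bang tin by rewrite -[RHS](congr1 Bang (tin_sh 2 2)).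
have -> : msh 2 2 (Bang tout) = Bang tout by rewrite -[RHS](congr1 Bang (tout_sh 2 2)).
set T' := rctx_tsh _; set H' := [seq psh 0 1 0 _ | _ <- _].
have D := fold_pack_mor V1 V0; have [P1 P2] := fold_pack_squares T' H' V1 V0.
have A' := has_type_appk Z' (tin_typed WG') (tout_typed WG').
apply: eqv_p; apply: (eqv_trans _ (tau_natural D P1 P2 Z')).
apply: eqv_sym; apply: eqv_reds (fold_app _ _ _ _ _).
exact: has_type_app (no_lin_un _) (md_pos D) A'.
Qed.

(** * Continuations and the eta law of the negative carrier *)

Definition kcomp q k := TLam (TLam (lamlet alg10 (lamlet coalg10 (Lam (TVar 0)
  (App (msh 2 5 q) (App (appk (msh 2 5 k) (TVar 1) (TVar 0) (Bang (Var 3)) (Bang (Var 1)))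
     (Var 0))))))).

Lemma kcomp_sub st sm q k : msub st sm (kcomp q k) = kcomp (msub st sm q) (msub st sm k).
Proof. by rewrite /kcomp /appk !subE !alg_sub !coalg_sub; sub_eq. Qed.

Lemma kcomp_sh i j q k : msh i j (kcomp q k) = kcomp (msh i j q) (msh i j k).
Proof. by rewrite /msh !mren_as_sub kcomp_sub. Qed.

Lemma kcomp_typed n G b c q k : has_type n (off G) q (TLolli b c) ->
  has_type n G k (kont b) -> has_type n G (kcomp q k) (kont c).
Proof.
move=> Q K; have [W _] := has_type_wf K.
do 2!constructor; set G2 := ctx_tsh _.
have W2 : ctx_wf n.+2 G2 by do 2!apply: ctx_wf_tsh.
apply: lamlet_typed; first by apply: alg_twf.
apply: lamlet_typed; first by apply: coalg_twf.
constructor.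
set A := [:: (TVar 0, Off); (coalg10, Un); (TBang coalg10, Off); (alg10, Un); (TBang alg10, Off)].
have WA : ctx_wf n.+2 A.
  apply: all_cons => //.
  do 2!(apply: all_cons; first by exact: (@coalg_twf n.+2 (TVar 1) (TVar 0))).
  by do 2!(apply: all_cons; first by exact: (@alg_twf n.+2 (TVar 1) (TVar 0))).
have WAG G' : ctx_wf n.+2 G' -> ctx_wf n.+2 (A ++ G').
  by move=> W'; rewrite /ctx_wf all_cat; apply/andP.
have EG : off G2 = ctx_tsh (ctx_tsh (off G)) by rewrite /G2 !off_tsh.
have WO : ctx_wf n.+2 (off G2) by rewrite -(split_wf n.+2 (split_off_l G2)).2.
apply: (has_type_app_off (a := tsh 2 b)).
  rewrite [off _]/(A ++ off G2) EG (_ : msh 2 5 q = msh 0 5 (msh 1 0 (msh 1 0 q))); last by sub_eq.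
  apply: (has_type_sh (A := A)) => //.
  by rewrite -[2]/(1 + 1) -!tsh_sh -!tsh_lolli; do 2!apply: has_type_tsh.
apply: (ht_app (a := TVar 0) (G1 := A ++ G2)
   (G2 := [:: (TVar 0, Lin), (coalg10, Un), (TBang coalg10, Off), (alg10, Un), (TBang alg10,
       Off) & off G2])).
- by do 5!(constructor; first by constructor); apply: split_off_l.
- apply: (appk_typed (c := TLolli (TVar 0) (tsh 2 (tsh 2 b)))).
  + rewrite (_ : msh 2 5 k = msh 0 5 (msh 1 0 (msh 1 0 k))); last by sub_eq.
    apply: (has_type_sh (A := A)) => //.
    have E : tsh 1 (tsh 1 (kont b)) = kont (tsh 2 b).
      by rewrite /tsh !tren_as_sub !kont_sub; congr kont; sub_eq.
    by rewrite -[TPi _]/(kont (tsh 2 b)) -E; do 2!apply: has_type_tsh.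
  + constructor; first by rewrite no_lin_off.
    apply: ht_var; first exact: WAG.
    by do 4!constructor=> //; apply: no_lin_off.
  + constructor; first by rewrite no_lin_off.
    apply: ht_var; first exact: WAG.
    by do 2!constructor=> //; apply: no_lin_off.
  + by rewrite tsub_lolli; congr TLolli; sub_eq.
- apply: ht_var; first by apply: (WAG (off G2)).
  by constructor=> //; apply: no_lin_off.
Qed.

Lemma kcomp_app q k a a' f f' x : reds (App (appk (kcomp q k) a a' (Bang f) (Bang f')) x)
  (App q (App (appk k a a' (Bang f) (Bang f')) x)).
Proof.
rewrite /appk /kcomp; do 7!red_step_sub; apply: reds_eq.
by congr App; sub_eq.
Qed.

(** The colimit cocone as a continuation. It is the universal one: [kcomp_evalk] recovers every
    continuation from it by post-composition. *)
Definition packk := TLam (TLam (lamlet alg10 (lamlet coalg10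
  (pack (TVar 1) (TVar 0) (Var 2) (Var 0))))).

Lemma packk_app a a' f f' : reds (appk packk a a' (Bang f) (Bang f')) (pack a a' f f').
Proof.
rewrite /appk /packk; do 6!red_step_sub; apply: reds_eq.
by congr pack; sub_eq.
Qed.

Lemma packk_sub st sm : msub st sm packk = packk.
Proof. by rewrite /packk !subE !alg_sub !coalg_sub. Qed.

Lemma packk_typed n G : no_lin G -> ctx_wf n G -> has_type n G packk (kont tau').
Proof.
move=> N W; do 2!constructor.
set G2 := ctx_tsh _.
have W2 : ctx_wf n.+2 G2 by do 2!apply: ctx_wf_tsh.
have N2 : no_lin G2 by rewrite /no_lin !all_map.
rewrite tau'_sh.
apply: lamlet_typed; first by apply: alg_twf.
apply: lamlet_typed; first by apply: coalg_twf.
set G3 := (_ :: _).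
have WF : ctx_wf n.+2 G3.
  do 2!(apply: all_cons; first by exact: (@coalg_twf n.+2 (TVar 1) (TVar 0))).
  by do 2!(apply: all_cons; first by exact: (@alg_twf n.+2 (TVar 1) (TVar 0))).
by apply: pack_typed => //; apply: ht_var => //; do 3?constructor.
Qed.

(* Its parametricity, with the source related by equality and the target by the graph of q, is the
   naturality of p : tau'. *)
Definition natk p := TLam (TLam (lamlet (TLolli (TVar 1) (TVar 0)) (Lam (kont (TVar 1))
  (App (TApp (msh 2 3 p) (TVar 0)) (kcomp (Var 1) (Var 0)))))).
Definition natk_type := TPi (TPi (TLolli (TBang (TLolli (TVar 1) (TVar 0)))
  (TLolli (kont (TVar 1)) (TVar 0)))).

Lemma natk_twf m : twf m natk_type.
Proof. by rewrite /natk_type /= !twf_ty2. Qed.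

Lemma natk_app p b c q k : reds (App (App (TApp (TApp (natk p) b) c) (Bang q)) k)
  (App (TApp p c) (kcomp q k)).
Proof.
rewrite /natk.
do 5!(apply: reds_step; [red_head|]; rewrite /minst /mtinst !(kcomp_sub, subE)).
apply: reds_eq; congr App; first by sub_eq.
by congr kcomp; sub_eq.
Qed.

Lemma natk_typed n G p : has_type n (un G) p tau' -> has_type n (un G) (natk p) natk_type.
Proof.
move=> P; have W := has_type_ctx P; do 2!constructor; rewrite !un_tsh.
set G2 := [seq _ | _ <- _].
have W2 : all (twf n.+2) G2 by do 2!apply: all_tsh.
apply: lamlet_typed => //; constructor.
set A := [:: (TLolli (TVar 1) (TVar 0), Un); (TBang (TLolli (TVar 1) (TVar 0)), Off)].
have Wk : twf n.+2 (kont (TVar 1)) by apply: kont_twf.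
have WC m : ctx_wf n.+2 ((kont (TVar 1), m) :: A ++ un G2).
  by apply: all_cons => //; rewrite -[all _ _]/(ctx_wf _ _) /= wf_un.
apply: (has_type_app_off (a := kont (TVar 0))).
  apply: (has_type_tapp (a := TLolli (kont (TVar 0)) (TVar 0))) => //; last first.
    by rewrite /tinst tsub_lolli kont_sub.
  rewrite !off_cons off_un.
  rewrite (_ : msh 2 3 p = msh 0 3 (msh 1 0 (msh 1 0 p))); last by sub_eq.
  apply: (has_type_sh (A := [:: (_, Off); (_, Un); (_, Off)])) => //; last first.
    by apply: all_cons.
  by rewrite -[TPi _]/tau' -[tau'](tau'_sh 1) -[in X in tsh 1 X](tau'_sh 1);
      do 2!apply: has_type_utsh.
apply: (kcomp_typed (b := TVar 1)).
  rewrite !off_cons off_un; apply: ht_var; first exact: (WC Off).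
  by do 2!constructor=> //; apply: no_lin_un.
by apply: ht_var => //; constructor=> //; apply: no_lin_un.
Qed.

Lemma tsub_pi s a : tsub s (TPi a) = TPi (tsub (tup s) a).
Proof. by []. Qed.

Lemma kont_ext_reds n G T H t u b :
  has_type n (un G) t (kont b) -> has_type n (un G) u (kont b) ->
  (forall G' T' H', G' = [:: TVar 0, coalg10, alg10 & [seq tsh 1 c | c <- [seq tsh 1 c |
      c <- G]]] ->
    all (twf n.+2) G' ->
    eqv n.+2 G' T' H' (tsh 2 b)
      (App (appk (msh 2 3 t) (TVar 1) (TVar 0) (Bang (Var 2)) (Bang (Var 1))) (Var 0))
      (App (appk (msh 2 3 u) (TVar 1) (TVar 0) (Bang (Var 2)) (Bang (Var 1))) (Var 0))) ->
  eqv n G T H (kont b) t u.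
Proof.
move=> A B E; apply: kont_ext => //; apply: eqv_p; apply: E => //.
apply: all_cons => //; apply: all_cons; first exact: (@coalg_twf n.+2 (TVar 1) (TVar 0)).
apply: all_cons; first exact: (@alg_twf n.+2 (TVar 1) (TVar 0)).
by do 2!apply: all_tsh; apply: has_type_ctx A.
Qed.

Lemma kont_sh j b : tsh j (kont b) = kont (tsh j b).
Proof. by rewrite /tsh !tren_as_sub kont_sub. Qed.

Lemma has_type_appk3 n G k b : all (twf n.+2) ([:: TVar 0; coalg10; alg10] ++ G) ->
  has_type n.+2 (un ([:: TVar 0; coalg10; alg10] ++ G)) k (kont b) ->
  has_type n.+2 (un ([:: TVar 0; coalg10; alg10] ++ G))
    (App (appk k (TVar 1) (TVar 0) (Bang (Var 2)) (Bang (Var 1))) (Var 0)) b.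
Proof.
move=> W K; type_app (TVar 0); last by apply: has_type_var.
have := has_type_appk (F := Var 2) (F' := Var 1) (a := TVar 1) (a' := TVar 0) K.
rewrite tsub_lolli (_ : tsub _ (tsh 2 b) = b); last by sub_eq.
by apply; apply: has_type_var.
Qed.

Lemma kcomp_id n G T H b k : has_type n (un G) k (kont b) -> twf n b ->
  eqv n G T H (kont b) (kcomp (midt b) k) k.
Proof.
move=> K Wb; have W := has_type_ctx K.
have K1 : has_type n (un G) (kcomp (midt b) k) (kont b).
  by apply: (kcomp_typed (b := b)) => //; rewrite off_un; apply: has_type_midt.
apply: kont_ext_reds => // G' T' H' EG W'.
have S2 v : has_type n (un G) v (kont b) -> has_type n.+2 (un G') (msh 2 3 v) (kont (tsh 2 b)).
  move=> V; rewrite EG -kont_sh; apply: (has_type_sh2 (A := [:: TVar 0; coalg10; alg10]) V) => //.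
  by move: W'; rewrite EG => /and4P[w1 w2 w3 _]; do 3?apply: all_cons.
have A := S2 _ K; have B := S2 _ K1; rewrite EG in A B W' *.
apply: (eqv_trans (eqv_reds T' H' (has_type_appk3 W' B) _)).
  rewrite kcomp_sh; exact: kcomp_app.
rewrite (_ : msh 2 3 (midt b) = midt (tsh 2 b)); last by rewrite /midt; sub_eq.
by apply: app_midt; apply: has_type_appk3.
Qed.

(** From x = y one obtains the pair (x, q y) in the graph of q. It supplies the pair of arrows at
    which the two copies of [natk p] are compared. *)
Lemma rel_id_graph n G T H b c q : has_type n (un G) q (TLolli b c) ->
  pv n G T H (PRel (rlolli b b b c (req b) (rcospan b c c q (midt c))) (midt b) q).
Proof.
move=> F; have W := has_type_ctx F; have [Wb Wc] := twf_lolliE (has_type_twf F).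
have R := rcospan_rwf T F (has_type_midt W Wc); have C := adm_req T W Wb.
apply: rel_lolliI => //; [exact: adm_wf C|exact: has_type_midt|].
have WG : all (twf n) (b :: b :: G) by solve_wf.
have F2 := has_type_ush (A := [:: b; b]) (k := 2) F erefl ltac:(by solve_wf).
rewrite rsh_req rsh_rcospan !msh_midt.
set H' := PRel _ _ _ :: _.
have E : eqv n (b :: b :: G) T H' b (Var 1) (Var 0).
  split; try by type_var.
  apply: rel_reqE; apply: pr_hyp; first by left.
  by exists b, b; split; try type_var; apply: rwf_req.
have M1 := app_midt T H' (eqv_l E).
have B := has_type_app (no_lin_un _) F2 (eqv_r E).
apply: rcospanI; [exact: F2|exact: has_type_midt|exact: eqv_l M1|exact: B|].
apply: eqv_p; apply: (eqv_trans (eqv_appr F2 (eqv_trans M1 E))).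
exact: eqv_sym (app_midt _ _ B).
Qed.

(** [natk p] is related to itself with its first type variable interpreted by equality on b and the
    second by the graph of q. Supplying the related arrows [midt b] and q, and k on both sides,
    gives q (p b (id after k)) = p c (q after k); [kcomp_id] removes the identity. *)
Lemma kont_comp n G T H p b c q k : has_type n (un G) p tau' ->
  has_type n (un G) q (TLolli b c) -> has_type n (un G) k (kont b) ->
  eqv n G T H c (App q (App (TApp p b) k)) (App (TApp p c) (kcomp q k)).
Proof.
move=> P Q K; have W := has_type_ctx P; have [Wb Wc] := twf_lolliE (has_type_twf Q).
have N := no_lin_un G.
have P0 : has_type n (un G) (natk p) (tsub (fun=> TOne) natk_type).
  by rewrite tsub_closed ?natk_twf //; apply: natk_typed.
have R := idextI (s := fun=> TOne) (natk_twf 2) isT isT (eqv_refl T H P0).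
have RB := adm_req T W Wb; have RC := adm_rcospan T Q (has_type_midt W Wc).
have {}R := tyrel_piE R (adm_is RB) Wb Wb.
have {R} R := tyrel_piE R (adm_is RC) Wb Wc.
rewrite tyrel_lolli tyrel_bang tyrel_lolli in R.
have {}R := rel_lolliE R (has_type_bang N (has_type_midt W Wb)) (has_type_bang N Q).
have {}R := R (rel_bangI (rwf_lolli Wb Wb Wb Wc W (adm_wf RB) (adm_wf RC)) (has_type_midt W Wb) Q
  (rel_id_graph T H Q)).
move: R; set e := (X in tyrel _ _ X _); set s1 := (X in tyrel X _ _ _);
  set s2 := (X in tyrel _ X _ _); rewrite tyrel_lolli => R.
have K1 : has_type n (un G) k (tsub s1 (kont (TVar 1))) by rewrite kont_sub.
have K2 : has_type n (un G) k (tsub s2 (kont (TVar 1))) by rewrite kont_sub.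
have {}R := rel_lolliE R K1 K2.
have E0 : tsub (fun=> TVar 1) (kont (TVar 0)) = kont (TVar 1) by rewrite kont_sub.
have K0 : has_type n (un G) k (tsub (fun=> b) (kont (TVar 0))) by rewrite kont_sub.
have KK := idextI (s := fun=> b) (@kont_twf 2 (TVar 0) isT) Wb Wb (eqv_refl T H K0).
(* The type of k mentions only the variable interpreted by equality, so k is related to itself by
   identity extension. *)
have E3 : tyrel s1 s2 e (kont (TVar 1)) =
    tyrel (fun=> b) (fun=> b) (fun=> req b) (kont (TVar 0)).
  rewrite -E0 tyrel_tsub; apply: tyrel_ext (@kont_twf 1 (TVar 0) isT) _.
  by case.
rewrite E3 in R; have {R KK} R := rcospanE (R KK).
have PA c0 k0 : twf n c0 -> has_type n (un G) k0 (kont c0) ->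
    has_type n (un G) (App (TApp p c0) k0) c0.
  move=> W0 Hk; type_app (kont c0) => //; apply: (has_type_tapp P W0).
  by rewrite /tinst tsub_lolli kont_sub.
have NA c0 q0 : twf n c0 -> has_type n (un G) q0 (TLolli b c0) ->
    has_type n (un G) (App (App (TApp (TApp (natk p) b) c0) (Bang q0)) k) c0.
  move=> W0 Hq; type_app (kont b) => //; type_app (TBang (TLolli b c0)); last exact: has_type_bang.
  apply: (has_type_tapp (a := TLolli (TBang (TLolli (tsh 1 b) (TVar 0))) (TLolli (kont (tsh 1
      b)) (TVar 0)))).
  - apply: (has_type_tapp (natk_typed P) Wb).
    by rewrite /tinst tsub_pi !tsub_lolli kont_sub.
  - by [].
  - by rewrite /tinst !tsub_lolli tsub_bang tsub_lolli kont_sub (_ : tsub _ (tsh 1 b) = b) //;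
      sub_eq.
have KQ : has_type n (un G) (kcomp q k) (kont c).
  by apply: (kcomp_typed (b := b)); rewrite ?off_un.
have E1 := eqv_reds T H (NA _ _ Wb (has_type_midt W Wb)) (natk_app _ _ _ _ _).
have E2 := eqv_reds T H (NA _ _ Wc Q) (natk_app _ _ _ _ _).
have E4 : eqv n G T H b (App (TApp p b) (kcomp (midt b) k)) (App (TApp p b) k).
  apply: eqv_appr (kcomp_id T H K Wb).
  by apply: (has_type_tapp P Wb); rewrite /tinst tsub_lolli kont_sub.
apply: (eqv_trans (eqv_sym (eqv_appr Q (eqv_trans E1 E4)))).
apply: (eqv_trans _ (eqv_trans (app_midt T H (eqv_l E2)) E2)).
split=> //.
- exact: has_type_app N Q (eqv_l E1).
- by type_app c; [apply: has_type_midt|apply: eqv_l E2].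
Qed.

Lemma bang_sh i j t : msh i j (Bang t) = Bang (msh i j t).
Proof. by []. Qed.

(** Two candidates for the map tau' -o b induced by a continuation k: run the packed element on k,
    or, in [evalk0], take the component of k at the dialgebra (tau, tau', in, out). [tau'_eta] shows
    that they agree. *)
Definition evalk b k := Lam tau' (App (TApp (Var 0) b) (msh 0 1 k)).
Definition evalk0 k := Lam tau' (App (appk (msh 0 1 k) tau tau' (Bang tin) (Bang tout)) (Var 0)).

Lemma evalk_sh i j b k : msh i j (evalk b k) = evalk (tsh i b) (msh i j k).
Proof. by rewrite /msh /tsh !mren_as_sub !tren_as_sub /evalk !msubE tau'_sub; sub_eq. Qed.

Lemma evalk0_sh i j k : msh i j (evalk0 k) = evalk0 (msh i j k).
Proof.
rewrite /msh /tsh !mren_as_sub /evalk0 /appk.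
rewrite msub_lam !msub_app !msub_tapp !msub_bang tin_sub tout_sub tau_sub !tau'_sub.
by congr (Lam _ (App (App (App (TApp (TApp _ _) _) _) _) _)); sub_eq.
Qed.

Lemma evalk_app b k s : reds (App (evalk b k) s) (App (TApp s b) k).
Proof.
apply: reds_step; [exact: r_lam|apply: reds_eq].
by rewrite /minst !msubE; congr App; sub_eq.
Qed.

Lemma evalk0_app k s :
  reds (App (evalk0 k) s) (App (appk k tau tau' (Bang tin) (Bang tout)) s).
Proof.
apply: reds_step; [exact: r_lam|apply: reds_eq].
rewrite /minst /appk !msub_app !msub_tapp !msub_bang tin_sub tout_sub tau_sub tau'_sub.
by congr (App (App (App (TApp (TApp _ _) _) _) _) _); sub_eq.
Qed.

Lemma has_type_eval n G p b k : has_type n (un G) p tau' -> has_type n (un G) k (kont b) ->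
  twf n b -> has_type n (un G) (App (TApp p b) k) b.
Proof.
move=> P K Wb; type_app (kont b) => //.
by apply: (has_type_tapp P Wb); rewrite /tinst tsub_lolli kont_sub.
Qed.

Lemma has_type_eval0 n G k b : has_type n (un G) k (kont b) ->
  has_type n (un G) (appk k tau tau' (Bang tin) (Bang tout)) (TLolli tau' b).
Proof.
move=> K; have W := has_type_ctx K.
have := has_type_appk K (tin_typed W) (tout_typed W).
by rewrite tsub_lolli (_ : tsub _ (tsh 2 b) = b); last by sub_eq.
Qed.

Lemma evalk_typed n G k b : has_type n (un G) k (kont b) -> twf n b ->
  has_type n (un G) (evalk b k) (TLolli tau' b).
Proof.
move=> K Wb; have W := has_type_ctx K; constructor.
have WT m : ctx_wf n ((tau', m) :: un G).
  by apply: all_cons; [exact: tau'_twf|rewrite -[all _ _]/(ctx_wf _ _) wf_un].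
apply: (ht_app (a := kont b) (split_off_l _)).
  apply: (has_type_tapp (a := TLolli (kont (TVar 0)) (TVar 0))) => //.
    by apply: ht_var => //; constructor=> //; apply: no_lin_un.
  by rewrite /tinst tsub_lolli kont_sub.
rewrite off_cons off_un; apply: (has_type_sh (A := [:: (_, Off)]) K) => //.
by apply: all_cons => //; exact: tau'_twf.
Qed.

Lemma evalk0_typed n G k b : has_type n (un G) k (kont b) ->
  has_type n (un G) (evalk0 k) (TLolli tau' b).
Proof.
move=> K; have W := has_type_ctx K; constructor.
have WT m : ctx_wf n ((tau', m) :: un G).
  by apply: all_cons; [exact: tau'_twf|rewrite -[all _ _]/(ctx_wf _ _) wf_un].
apply: (has_type_app_off (a := tau')); last first.
  by apply: ht_var => //; constructor=> //; apply: no_lin_un.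
rewrite off_cons off_un.
rewrite (_ : appk _ _ _ _ _ = msh 0 1 (appk k tau tau' (Bang tin) (Bang tout))); last first.
  by rewrite appk_sh !bang_sh tin_sh tout_sh !tsh0E.
apply: (has_type_sh (A := [:: (_, Off)]) (has_type_eval0 K)) => //.
by apply: all_cons => //; exact: tau'_twf.
Qed.

Lemma packk_sh i j : msh i j packk = packk.
Proof. by rewrite /msh mren_as_sub packk_sub. Qed.

Lemma has_type_packk n G : all (twf n) G -> has_type n (un G) packk (kont tau').
Proof. by move=> W; apply: packk_typed; [apply: no_lin_un|rewrite wf_un]. Qed.

Lemma has_type_kcomp n G q b c k : has_type n (un G) q (TLolli b c) ->
    has_type n (un G) k (kont b) ->
  has_type n (un G) (kcomp q k) (kont c).
Proof. by move=> Q K; apply: (kcomp_typed (b := b)); rewrite ?off_un. Qed.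

Lemma has_type_sh23 n G G' k b : has_type n (un G) k (kont b) ->
  G' = [:: TVar 0, coalg10, alg10 & [seq tsh 1 c | c <- [seq tsh 1 c | c <- G]]] ->
  all (twf n.+2) G' -> has_type n.+2 (un G') (msh 2 3 k) (kont (tsh 2 b)).
Proof.
move=> V EG W'; rewrite EG -kont_sh.
apply: (has_type_sh2 (A := [:: TVar 0; coalg10; alg10]) V) => //.
by move: W'; rewrite EG => /and4P[w1 w2 w3 _]; do 3?apply: all_cons.
Qed.

(** At a generic dialgebra and a variable x of its negative carrier, packing x and running the
    result on k is the component of k at x, by beta. *)
Lemma kcomp_evalk n G T H k b : has_type n (un G) k (kont b) -> twf n b ->
  eqv n G T H (kont b) (kcomp (evalk b k) packk) k.
Proof.
move=> K Wb; have W := has_type_ctx K.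
have KC := has_type_kcomp (evalk_typed K Wb) (has_type_packk W).
apply: kont_ext_reds => // G' T' H' EG W'.
have A := has_type_sh23 KC EG W'.
subst G'; apply: eqv_reds (has_type_appk3 W' A) _.
rewrite kcomp_sh packk_sh evalk_sh; apply: reds_trans (kcomp_app _ _ _ _ _ _ _) _.
apply: reds_trans (evalk_app _ _ _) _.
apply: reds_trans (pack_app _ _ _ _ _ _ _).
by apply/reds_appl/reds_tapp/reds_appl/packk_app.
Qed.

(** Here beta is not enough: the component of k at (in, out), applied to the packed x, equals its
    component at the generic dialgebra applied to x by naturality of k along fold and pack. *)
Lemma kcomp_evalk0 n G T H k b : has_type n (un G) k (kont b) -> twf n b ->
  eqv n G T H (kont b) (kcomp (evalk0 k) packk) k.
Proof.
move=> K Wb; have W := has_type_ctx K.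
have KC := has_type_kcomp (evalk0_typed K) (has_type_packk W).
apply: kont_ext_reds => // G' T' H' EG W'.
have A := has_type_sh23 KC EG W'; have B := has_type_sh23 K EG W'.
have V0 : has_type n.+2 (un G') (Var 0) (TVar 0) by rewrite EG in W' *; apply: has_type_var.
have V1 : has_type n.+2 (un G') (Var 1) coalg10 by rewrite EG in W' *; apply: has_type_var.
have V2 : has_type n.+2 (un G') (Var 2) alg10 by rewrite EG in W' *; apply: has_type_var.
have D := fold_pack_mor V2 V1; have [P1 P2] := fold_pack_squares T' H' V2 V1.
have Wb2 : twf n.+2 (tsh 2 b) by apply: (twf_sh 2).
apply: (eqv_trans _ (kont_natural D P1 P2 B V0 Wb2)).
subst G'; apply: eqv_reds (has_type_appk3 W' A) _.
rewrite kcomp_sh packk_sh evalk0_sh; apply: reds_trans (kcomp_app _ _ _ _ _ _ _) _.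
apply: reds_trans (evalk0_app _ _) _.
by apply/reds_appr/reds_appl/packk_app.
Qed.

(** Naturality of p at the universal continuation: every q that restricts to k along [packk] sends
    the repacked p to the value of p at k. The two eta laws below come from the two choices [evalk]
    and [evalk0] for q. *)
Lemma kont_comp_packk n G T H p q k b : has_type n (un G) p tau' ->
  has_type n (un G) q (TLolli tau' b) -> has_type n (un G) k (kont b) -> twf n b ->
  eqv n G T H (kont b) (kcomp q packk) k ->
  eqv n G T H b (App q (App (TApp p tau') packk)) (App (TApp p b) k).
Proof.
move=> P Q K Wb E; apply: (eqv_trans (kont_comp T H P Q (has_type_packk (has_type_ctx P)))).
apply: eqv_appr E; apply: (has_type_tapp P Wb).
by rewrite /tinst tsub_lolli kont_sub.
Qed.

(** By extensionality it is enough to test both sides on a variable result type and a variable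
    continuation k; the test map is [evalk], which restricts to k along [packk]. *)
Lemma tau'_repack n G T H p : has_type n (un G) p tau' ->
  eqv n G T H tau' (App (TApp p tau') packk) p.
Proof.
move=> P; have W := has_type_ctx P; have Wt := tau'_twf n.
have P0 := has_type_eval P (has_type_packk W) Wt.
apply: pi_ext => //; have A := has_type_sh_tapp P0; have B := has_type_sh_tapp P.
apply: eqv_p; apply: fun_ext => //.
have A1 := has_type_sh_app A; have B1 := has_type_sh_app B.
set G1 := kont _ :: _ in A1 B1 *.
have P1 : has_type n.+1 (un G1) (msh 1 1 p) tau'.
  rewrite (_ : msh 1 1 p = msh 0 1 (msh 1 0 p)); last by sub_eq.
  apply: (has_type_ush (A := [:: kont (TVar 0)])) => //.
  by rewrite -(tau'_sh 1); apply: has_type_utsh.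
have W1 := has_type_ctx P1.
have V0 : has_type n.+1 (un G1) (Var 0) (kont (TVar 0)) by apply: has_type_var.
have F : App (msh 0 1 (TApp (msh 1 0 (App (TApp p tau') packk)) (TVar 0))) (Var 0) =
   App (TApp (App (TApp (msh 1 1 p) tau') packk) (TVar 0)) (Var 0).
  (* Both constants are closed: their shifts are made explicit and the constants then abstracted, so
     that [sub_eq] does not unfold them. *)
  rewrite -[in RHS](packk_sh 1 1) -[in RHS](tau'_sh 1).
  by move: (packk) (tau') => u c; sub_eq.
have F' : App (msh 0 1 (TApp (msh 1 0 p) (TVar 0))) (Var 0) =
   App (TApp (msh 1 1 p) (TVar 0)) (Var 0) by sub_eq.
rewrite F F'; apply: eqv_p.
apply: (eqv_trans _ (kont_comp_packk P1 (evalk_typed V0 isT) V0 isT (kcomp_evalk _ _ V0 isT))).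
apply: eqv_sym; apply: eqv_reds (evalk_app _ _ _).
apply: (has_type_app (no_lin_un _) (evalk_typed V0 isT)).
exact: has_type_eval P1 (has_type_packk W1) (tau'_twf n.+1).
Qed.

(** Replace p by its repacked form; there the map [evalk0 k], which also restricts to k along
    [packk], can be computed. *)
Lemma tau'_eta n G T H p k b : has_type n (un G) p tau' -> has_type n (un G) k (kont b) ->
  twf n b ->
  eqv n G T H b (App (appk k tau tau' (Bang tin) (Bang tout)) p) (App (TApp p b) k).
Proof.
move=> P K Wb; have W := has_type_ctx P.
have P0 := has_type_eval P (has_type_packk W) (tau'_twf n).
apply: (eqv_trans (eqv_sym (eqv_appr (has_type_eval0 K) (tau'_repack T H P)))).
apply: (eqv_trans _ (kont_comp_packk P (evalk0_typed K) K Wb (kcomp_evalk0 T H K Wb))).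
apply: eqv_sym; apply: eqv_reds (evalk0_app _ _).
exact: has_type_app (no_lin_un _) (evalk0_typed K) P0.
Qed.

Lemma squares_sh i j k a a' f f' h h' : psh i j k (PAnd (pos_square a a' f h h') (neg_square a
    a' f' h h')) =
  PAnd (pos_square (tsh i a) (tsh i a') (msh i j f) (msh i j h) (msh i j h'))
       (neg_square (tsh i a) (tsh i a') (msh i j f') (msh i j h) (msh i j h')).
Proof. by rewrite -(pos_square_sh i j k) -(neg_square_sh i j k). Qed.

(** * Uniqueness of dialgebra morphisms out of the initial one *)

Section Uniqueness.
Variables (n : nat) (G : seq ty) (T : rctx) (H : seq prop).
Notation pr := (pv n G T H).
Variables (a a' : ty) (f f' h h' : tm).
Hypothesis D : mor_data n G a a' f f' h h'.
Hypotheses (P1 : pr (pos_square a a' f h h')) (P2 : pr (neg_square a a' f' h h')).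

(** Joined into one proposition, the squares need a single stored hypothesis to pass through the
    quantifier introductions. *)
Let P12 : pr (PAnd (pos_square a a' f h h') (neg_square a a' f' h h')) := pr_andI P1 P2.
Let W12 : pwf n G T (PAnd (pos_square a a' f h h') (neg_square a a' f' h h')).
Proof. by split; [exact: pos_square_typed D|exact: neg_square_typed D]. Qed.

(** For a variable z the chain is h z = h (z in out) = z f f' = fold z, by [tau_eta], [tau_natural]
    and beta. *)
Lemma fold_unique : eqv n G T H (TLolli tau a) h (fold a a' f f').
Proof.
have W := has_type_ctx (md_alg D); have Wt := tau_twf n.
have Wa := (twf_lolliE (has_type_twf (md_pos D))).2.
have D0 := fold_pack_mor (md_alg D) (md_coalg D).
split; [exact: md_pos D|exact: md_pos D0|].
apply: (prov_cut W12 P12); have K := known_head H W12.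
apply: eqv_p; apply: fun_ext; [exact: md_pos D|exact: md_pos D0|].
have Wl : all (twf n) [:: tau] by apply: all_cons.
have {}K := known_allM (A := [:: tau]) (k := 1) K erefl (all_cons Wt W).
have D1 := mor_data_sh (A := [:: tau]) (k := 1) D erefl Wl.
set G1 := ([:: tau] ++ G) in D1 K *.
have W1 := has_type_ctx (md_alg D1).
have V : has_type n (un G1) (Var 0) tau by apply: has_type_var.
rewrite !squares_sh !tsh0E in K; have Q1 := pr_andE1 (known_pr K); have Q2 := pr_andE2 (known_pr K).
rewrite fold_sh !tsh0E; apply: eqv_p.
apply: (eqv_trans (eqv_sym (eqv_appr (md_pos D1) (tau_eta _ _ V)))).
apply: (eqv_trans (tau_natural D1 Q1 Q2 V)).
apply: eqv_sym; apply: eqv_reds (fold_app _ _ _ _ _).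
exact: has_type_app (no_lin_un _) (md_pos (fold_pack_mor (md_alg D1) (md_coalg D1))) V.
Qed.

(** Elements of tau' are compared on a variable result type and a variable continuation k. The chain
    is (h' x) k = k in out (h' x) = k f f' x = (pack x) k, by [tau'_eta], [kont_natural] and
    beta. *)
Lemma pack_unique : eqv n G T H (TLolli a' tau') h' (pack a a' f f').
Proof.
have W := has_type_ctx (md_alg D); have Wt := tau'_twf n.
have Wa' := (twf_lolliE (has_type_twf (md_neg D))).1.
have D0 := fold_pack_mor (md_alg D) (md_coalg D).
split; [exact: md_neg D|exact: md_neg D0|].
apply: (prov_cut W12 P12); have K := known_head H W12.
apply: eqv_p; apply: fun_ext; [exact: md_neg D|exact: md_neg D0|].
have Wl : all (twf n) [:: a'] by apply: all_cons.
have {}K := known_allM (A := [:: a']) (k := 1) K erefl (all_cons Wa' W).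
have D1 := mor_data_sh (A := [:: a']) (k := 1) D erefl Wl.
have D1' := fold_pack_mor (md_alg D1) (md_coalg D1).
set G1 := ([:: a'] ++ G) in D1 D1' K *.
have W1 := has_type_ctx (md_alg D1).
have V : has_type n (un G1) (Var 0) a' by apply: has_type_var.
have A1 := has_type_app (no_lin_un _) (md_neg D1) V;
    have B1 := has_type_app (no_lin_un _) (md_neg D1') V.
rewrite pack_sh !tsh0E; apply: eqv_p; apply: pi_ext => //.
(* The result type is a fresh type variable, so the stored squares and the typings of the morphism
   are shifted below it, and once more below the continuation. *)
have {}K := known_allT K W1; have D2 := mor_data_tsh D1.
have A2 := has_type_sh_tapp A1; have B2 := has_type_sh_tapp B1.
apply: eqv_p; apply: fun_ext => //.
have A3 := has_type_sh_app A2; have B3 := has_type_sh_app B2.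
have Wk : twf n.+1 (kont (TVar 0)) by apply: kont_twf.
have Wkl : all (twf n.+1) [:: kont (TVar 0)] by apply: all_cons.
have {}K := known_allM (A := [:: kont (TVar 0)]) (k := 1) K erefl (all_cons Wk (all_tsh W1)).
have D3 := mor_data_sh (A := [:: kont (TVar 0)]) (k := 1) D2 erefl Wkl.
have V3 : has_type n.+1 (un (kont (TVar 0) :: [seq tsh 1 c | c <- G1])) (Var 1) (tsh 1 a').
  by apply: has_type_var => //; apply: has_type_ctx A3.
have V0 : has_type n.+1 (un (kont (TVar 0) :: [seq tsh 1 c | c <- G1])) (Var 0) (kont (TVar 0)).
  by apply: has_type_var => //; apply: has_type_ctx A3.
rewrite !squares_sh !tsh0E in K; have Q1 := pr_andE1 (known_pr K); have Q2 := pr_andE2 (known_pr K).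
have X3 := has_type_app (no_lin_un _) (md_neg D3) V3.
have E1 := tau'_eta _ _ X3 V0 (b := TVar 0) isT.
have E2 := kont_natural D3 Q1 Q2 V0 V3 (b := TVar 0) isT.
apply: eqv_p; apply: (eqv_trans (eqv_sym (E1 _ _))).
apply: (eqv_trans E2); apply: eqv_sym.
apply: (eqv_reds _ _ B3).
rewrite (_ : App _ _ = App (TApp (App (msh 0 1 (msh 1 0 (pack a a' (msh 0 1 f) (msh 0 1 f'))))
  (Var 1)) (TVar 0)) (Var 0)) //.
rewrite !pack_sh !tsh0E; exact: pack_app.
Qed.
End Uniqueness.

Lemma tau_dialg_initial n : initial_dialg LAPL_par n sigma (Dialg tau tau' tin tout).
Proof.
split.
  split; [exact: tau_twf|exact: tau'_twf|exact: (@tin_typed n [::])|exact: (@tout_typed n [::])].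
case=> a a' f f' [/= Wa Wa' F F']; split.
  have D := @fold_pack_mor n [::] a a' f f' F F'.
  have [P1 P2] := @fold_pack_squares n [::] [::] [::] a a' f f' F F'.
  exists (fold a a' f f'), (pack a a' f f'); split=> //; [exact: md_pos D|exact: md_neg D].
move=> h1 h1' h2 h2' [/= A1 A1' P1 P1'] [/= A2 A2' P2 P2'].
have D1 : mor_data n [::] a a' f f' h1 h1' by split.
have D2 : mor_data n [::] a a' f f' h2 h2' by split.
split.
- exact: eqv_p (eqv_trans (fold_unique D1 P1 P1') (eqv_sym (fold_unique D2 P2 P2'))).
- exact: eqv_p (eqv_trans (pack_unique D1 P1 P1') (eqv_sym (pack_unique D2 P2 P2'))).
Qed.

End Dialgebra.

Theorem theorem2p38 (n : nat) (sigma : ty)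
    (hwf : twf 2 sigma) (hind : ind_constructed sigma)
    (hneg : only_negative 0 sigma) (hpos : only_positive 1 sigma) :
  exists D : dialg, initial_dialg LAPL_par n sigma D.
Proof. by eexists; apply: tau_dialg_initial. Qed.
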